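(* The map $\rho_{E,2^k} : \mathrm{Gal}(K_k/\mathbb{Q}) \to I_k$ is surjective for all $k \ge 3$.
   Context: Let $E : y^2 + xy = x^3 + x^2 - 2x$ and $P = (2,2) \in E(\mathbb{Q})$. For $k \ge 1$ let $K_k$ be the field obtained by adjoining to $\mathbb{Q}$ the $x$- and $y$-coordinates of all points $\beta$ with $2^k\beta = P$. Fix a basis $A, B$ of $E[2^k]$ (chosen compatibly with the 2-isogeny $\phi : E \to E'$, $E' : y^2+xy = x^3+x^2+8x+10$, $\phi(x,y) = \left(\frac{x^2-2}{x}, \frac{x^2y+2x+2y}{x^2}\right)$, so that $\phi(A)=C$, $\phi(B)=2D$ for a basis $C,D$ of $E'[2^k]$) and a point $\beta$ with $2^k\beta = P$. For $\sigma \in \mathrm{Gal}(K_k/\mathbb{Q})$ write $\sigma(\beta) = \beta + eA + fB$, $\sigma(A) = aA + bB$, $\sigma(B) = cA + dB$, and define $\rho_{E,2^k}(\sigma) = (\vec v, M) \in \mathrm{AGL}_2(\mathbb{Z}/2^k\mathbb{Z})$ with $\vec v = (e\ f)$ and $M = \begin{bmatrix} a & b \\ c & d\end{bmatrix}$; group law $(\vec v_1, M_1)(\vec v_2, M_2) = (\vec v_1 + \vec v_2 M_1, M_2 M_1)$. For $k \ge 3$, $I_k$ is the subgroup of $\mathrm{AGL}_2(\mathbb{Z}/2^k\mathbb{Z})$ of pairs $(\vec v, M)$ with $M \bmod 8$ in the group generated by $\begin{bmatrix}1&1\\0&1\end{bmatrix}$, $\begin{bmatrix}7&0\\2&1\end{bmatrix}$,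 $\begin{bmatrix}5&0\\2&1\end{bmatrix}$, and $e \equiv 0 \pmod 2$ if and only if $\det M \equiv 1$ or $7 \pmod 8$; the image of $\rho_{E,2^k}$ lies in $I_k$. *)

(* Defs.v *)
From HB Require Import structures.
From mathcomp Require Import all_boot all_order all_fingroup all_algebra all_solvable all_field.

Set Implicit Arguments.
Unset Strict Implicit.
Unset Printing Implicit Defensive.

Import GRing.Theory.
Local Open Scope ring_scope.

(* y^2 + a1 x y + a3 y = x^3 + a2 x^2 + a4 x + a6.  The coefficients are
   integers, so that the same curve has points over every field. *)
Record weierstrass := Weierstrass { a1 : int; a2 : int; a3 : int; a4 : int; a6 : int }.

(* None is the point at infinity, Some (x, y) an affine point.  Lying on the
   curve is the separate predicate [on_curve]; the group operations below are
   meaningful only for points that satisfy it. *)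
Definition point (F : fieldType) := option (F * F).

Definition map_point (F F' : fieldType) (f : F -> F') : point F -> point F' :=
  omap (fun p => (f p.1, f p.2)).

Section GroupLaw.
Variables (F : fieldType) (W : weierstrass).

Definition on_curve (T : point F) : bool :=
  if T is Some (x, y) then
    y ^+ 2 + (a1 W)%:~R * x * y + (a3 W)%:~R * y
      == x ^+ 3 + (a2 W)%:~R * x ^+ 2 + (a4 W)%:~R * x + (a6 W)%:~R
  else true.

(* Chord and tangent: [l] is the slope of the line through S and T (the
   tangent line if S = T), and y = l * x + m is its equation. *)
Definition add_point (S T : point F) : point F :=
  match S, T with
  | None, _ => T
  | _, None => S
  | Some (x1, y1), Some (x2, y2) =>
    if (x1 == x2) && (y1 + y2 + (a1 W)%:~R * x2 + (a3 W)%:~R == 0) then None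
    else
      let l := if x1 == x2 then
                 (3 * x1 ^+ 2 + 2 * (a2 W)%:~R * x1 + (a4 W)%:~R - (a1 W)%:~R * y1)
                   / (2 * y1 + (a1 W)%:~R * x1 + (a3 W)%:~R)
               else (y2 - y1) / (x2 - x1) in
      let m := y1 - l * x1 in
      let x := l ^+ 2 + (a1 W)%:~R * l - (a2 W)%:~R - x1 - x2 in
      Some (x, - (l + (a1 W)%:~R) * x - m - (a3 W)%:~R)
  end.

Definition mul_point (n : nat) (T : point F) : point F :=
  iter n (add_point T) None.

Definition torsion (n : nat) (T : point F) : bool :=
  on_curve T && (mul_point n T == None).

Definition lin_comb (m n : nat) (S T : point F) : point F :=
  add_point (mul_point m S) (mul_point n T).

(* (S, T) is a basis of the Z/n-module W[n] of n-torsion points over F. *)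
Definition torsion_basis (n : nat) (S T : point F) : Prop :=
  [/\ torsion n S, torsion n T &
      forall U : point F, torsion n U ->
        exists! c : 'I_n * 'I_n, U = lin_comb c.1 c.2 S T].

End GroupLaw.

Definition E : weierstrass := Weierstrass 1 1 0 (-2) 0.

Definition E' : weierstrass := Weierstrass 1 1 0 8 10.

Definition P (F : fieldType) : point F := Some (2, 2).

(* The only affine point of E with x = 0 is (0, 0), which generates the kernel. *)
Definition phi (F : fieldType) (T : point F) : point F :=
  if T is Some (x, y) then
    if x == 0 then None
    else Some ((x ^+ 2 - 2) / x, (x ^+ 2 * y + 2 * x + 2 * y) / x ^+ 2)
  else None.

(* Through the embedding iota, L is the subfield K_k of algC: it is generated
   over Q by the finitely many coordinates of the points beta of E over algC
   with 2^k beta = P. *)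
Definition is_division_field (k : nat) (L : fieldExtType rat)
    (iota : {rmorphism L -> algC}) : Prop :=
  exists s : seq L,
    (forall z : algC, z \in [seq iota u | u <- s] <->
       exists x y : algC,
         [/\ on_curve E (Some (x, y)),
             mul_point E (2 ^ k) (Some (x, y)) = P algC & z = x \/ z = y])
    /\ <<1 & s>>%VS = fullv.

Definition AGL2 (n : nat) := ('rV['Z_n]_2 * {'GL_2['Z_n]})%type.

Section AffineGroup.
Variable n : nat.

HB.instance Definition _ := Finite.on (AGL2 n).

Definition agl_mul (g h : AGL2 n) : AGL2 n :=
  (g.1 + h.1 *m GLval g.2, (h.2 * g.2)%g).

Definition agl_one : AGL2 n := (0, 1%g).

Definition agl_inv (g : AGL2 n) : AGL2 n :=
  (- (g.1 *m GLval g.2^-1%g), g.2^-1%g).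

Lemma agl_mulA : associative agl_mul.
Proof.
move=> [u A] [v B] [w C]; rewrite /agl_mul /= mulgA mulmxDl addrA.
by congr (_, _); rewrite -mulmxA.
Qed.

Lemma agl_mul1 : left_id agl_one agl_mul.
Proof. by case=> v A; rewrite /agl_mul /= add0r mulmx1 mulg1. Qed.

Lemma agl_mulV : left_inverse agl_one agl_inv agl_mul.
Proof. by case=> v A; rewrite /agl_mul /agl_inv /= addNr mulgV. Qed.

HB.instance Definition _ :=
  Finite_isGroup.Build (AGL2 n) agl_mulA agl_mul1 agl_mulV.

End AffineGroup.

Definition mx2 (R : nmodType) (a b c d : R) : 'M[R]_2 :=
  \matrix_(i, j) if i == 0 then (if j == 0 then a else b)
                 else (if j == 0 then c else d).

(* The three matrices are invertible, so each is the value of one element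
   of GL_2. *)
Definition H8 : {set {'GL_2['Z_8]}} :=
  <<[set g : {'GL_2['Z_8]} |
      GLval g \in [:: mx2 1 1 0 1; mx2 7 0 2 1; mx2 5 0 2 1]]>>%g.

(* A ring morphism when 8 divides n, 1 < n. *)
Definition mod8 (n : nat) (x : 'Z_n) : 'Z_8 := (x : nat)%:R.

Definition Ik (k : nat) : {set AGL2 (2 ^ k)} :=
  [set g : AGL2 (2 ^ k) |
     (map_mx (@mod8 (2 ^ k)) (GLval g.2) \in [set GLval h | h in H8])
     && (~~ odd (g.1 0 0) == (mod8 (\det (GLval g.2)) \in [:: 1; 7]))].

Section Representation.
Variables (k : nat) (L : splittingFieldType rat) (A B beta : point L).

(* With g = ((e f), [a b; c d]): sigma(beta) = beta + eA + fB,
   sigma(A) = aA + bB and sigma(B) = cA + dB. *)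
Definition acts_as (sigma : gal_of {:L}) (g : AGL2 (2 ^ k)) : bool :=
  let M := GLval g.2 in
  [&& map_point sigma beta
        == add_point E beta (lin_comb E (g.1 0 0) (g.1 0 1) A B),
      map_point sigma A == lin_comb E (M 0 0) (M 0 1) A B &
      map_point sigma B == lin_comb E (M 1 0) (M 1 1) A B].

(* rho sigma is Some g for the g describing sigma (unique when A, B is a basis
   of E[2^k]), and would be None if there were no such g. *)
Definition rho (sigma : gal_of {:L}) : option (AGL2 (2 ^ k)) :=
  [pick g | acts_as sigma g].

End Representation.

(* Main.v *)
(** Associativity of the group law is read off the ideals of the affine coordinate
    ring: the product of the maximal ideals of two points agrees with the ideal of
    their sum up to principal ideals, and the ideal of an affine point is not
    principal.

    With X = 4 x and Y = 8 y + 4 x the curve E becomes Y^2 = X (X^2 + 5 X - 32).  The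
    compatibility phi(B) = 2 D forces 2^(k-1) B = (0, 0), the other points of order
    two being defined over Q(sqrt 17).  Halving coordinates make explicit how a pair
    of generators of E[8] determines square roots of -1 and of 2 on which M acts
    through det M mod 8 (the Weil pairing).  The X-coordinate of 2^(k-2) B is a square
    root of -32, and half coordinates of 2^(k-1) beta contain a square root of 8; this
    ties c/2 and e to det M mod 8, so that the image lies in I_k.

    I_k is a 2-group and its squares generate the subgroup of index 8 given by
    b = 0 mod 2 and det M = 1 mod 8.  A subgroup of I_k is therefore everything unless
    it is killed by one of the seven nontrivial characters of the quotient; on the
    image of Galois these are the quadratic characters of the nontrivial products of
    17, -1 and 2, none of which is a square in Q. *)

From HB Require Import structures.
Require Import Defs.
From mathcomp Require Import all_boot all_order all_fingroup all_algebra all_solvable all_field.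
From mathcomp Require Import ring zify.

Set Implicit Arguments.
Unset Strict Implicit.
Unset Printing Implicit Defensive.

Import GRing.Theory.
Local Open Scope ring_scope.

(** The pair (R, S) = (2^(k-3) A, 2^(k-3) B) carries four field elements: [i], [t], [kappa] = X(2 S)
    and [e] = X(4 R), a root of x^2 + 5 x - 32, whose discriminant is 153 = 9 * 17. The pair
    determines them, and a field morphism carries the elements of a pair to those of its image.
    Their behaviour under a change of basis is known once it is known for the moves -R, -S, 5 R, 5
    S, R + S and S + 2 R, which produce modulo 8 every matrix with a, d odd and c even. Computing
    the elements of (sigma R, sigma S) in both ways gives the action of sigma on them in terms of M.
    Addition on E is heavy for this purpose; in half coordinates it is short, and a rational
    parametrisation of the pairs turns each move into a substitution such as v -> 1/v. Since sigma
    may exchange the two irrational points of order two, it may also exchange the half coordinates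
    attached to them; the one attached to (0, 0) keeps its place. *)

(** * The coordinate ring of the affine curve and classes of products of point ideals *)

Definition curve_lin (F : fieldType) (W : weierstrass) : {poly F} :=
  (a1 W)%:~R%:P * 'X + (a3 W)%:~R%:P.

Definition curve_cubic (F : fieldType) (W : weierstrass) : {poly F} :=
  'X ^+ 3 + (a2 W)%:~R%:P * 'X ^+ 2 + (a4 W)%:~R%:P * 'X + (a6 W)%:~R%:P.

(* The affine coordinate ring of the curve, (p, q) standing for p + q y. *)
Definition curve_ring (F : fieldType) (W : weierstrass) : Type :=
  ({poly F} * {poly F})%type.

HB.instance Definition _ F W := GRing.Zmodule.on (@curve_ring F W).

Section CoordRing.
Variables (F : fieldType) (W : weierstrass).
Local Notation R := (curve_ring F W).
Local Notation h := (curve_lin F W).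
Local Notation f := (curve_cubic F W).

Definition coord_mul (z w : R) : R :=
  (z.1 * w.1 + z.2 * w.2 * f, z.1 * w.2 + z.2 * w.1 - z.2 * w.2 * h).

Definition coord_one : R := (1, 0).

Fact coord_mulA : associative coord_mul.
Proof.
by move=> [a b] [c d] [e g]; rewrite /coord_mul /=; congr (_, _); ring.
Qed.

Fact coord_mulC : commutative coord_mul.
Proof.
by move=> [a b] [c d]; rewrite /coord_mul /=; congr (_, _); ring.
Qed.

Fact coord_mul1 : left_id coord_one coord_mul.
Proof.
by move=> [a b]; rewrite /coord_mul /=; congr (_, _); ring.
Qed.

Fact coord_mulDl : left_distributive coord_mul +%R.
Proof.
by move=> [a b] [c d] [e g]; rewrite /coord_mul /=; congr (_, _) => /=; ring.
Qed.

Fact coord_one_neq0 : coord_one != 0.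
Proof. by apply/eqP => -[/eqP]; rewrite oner_eq0. Qed.

HB.instance Definition _ := GRing.Zmodule_isComNzRing.Build R
  coord_mulA coord_mulC coord_mul1 coord_mulDl coord_one_neq0.

Lemma coord_mulE (z w : R) : z * w =
  (z.1 * w.1 + z.2 * w.2 * f, z.1 * w.2 + z.2 * w.1 - z.2 * w.2 * h).
Proof. by []. Qed.

Definition coord_of (p : {poly F}) : R := (p, 0).

Fact coord_of_is_additive : zmod_morphism coord_of.
Proof. by move=> p q; rewrite /coord_of /GRing.add /= /add_pair /= subr0. Qed.

Fact coord_of_is_multiplicative : monoid_morphism coord_of.
Proof.
split=> [|p q]; first by [].
by rewrite coord_mulE /coord_of /=; congr (_, _); ring.
Qed.

HB.instance Definition _ :=
  GRing.isZmodMorphism.Build {poly F} R coord_of coord_of_is_additive.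
HB.instance Definition _ :=
  GRing.isMonoidMorphism.Build {poly F} R coord_of coord_of_is_multiplicative.

Definition coordY : R := (0, 1).

Lemma coordY2 : coordY ^+ 2 = coord_of f - coord_of h * coordY.
Proof.
have ->: coord_of f - coord_of h * coordY = (f - (h * 0 + 0), 0 - h) :> R.
  rewrite coord_mulE /coord_of /coordY /=.
  by congr (_, _) => /=; ring.
by rewrite expr2 coord_mulE /=; congr (_, _); ring.
Qed.

(** The product of p + q y with its conjugate p + q (- y - h): the norm from the coordinate ring to
    the polynomials in x. *)
Definition coord_norm (z : R) : {poly F} :=
  z.1 ^+ 2 - z.1 * z.2 * h - z.2 ^+ 2 * f.

Lemma coord_normM z w : coord_norm (z * w) = coord_norm z * coord_norm w.
Proof. by rewrite coord_mulE /coord_norm /=; ring. Qed.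

Lemma size_curve_cubic : size f = 4%N.
Proof.
have ->: f = 'X^3 + ((a2 W)%:~R%:P * 'X ^+ 2 + (a4 W)%:~R%:P * 'X + (a6 W)%:~R%:P).
  by rewrite /curve_cubic !addrA.
rewrite size_polyDl size_polyXn // ltnS.
rewrite (leq_trans (size_polyD _ _)) // geq_max (leq_trans (size_polyC_leq1 _)) // andbT.
rewrite (leq_trans (size_polyD _ _)) // geq_max !mul_polyC.
rewrite (leq_trans (size_scale_leq _ _)) ?size_polyXn //=.
by rewrite (leq_trans (size_scale_leq _ _)) ?size_polyX.
Qed.

Lemma size_curve_lin : (size h <= 2)%N.
Proof.
rewrite (leq_trans (size_polyD _ _)) // geq_max (leq_trans (size_polyC_leq1 _)) // andbT.
by rewrite mul_polyC (leq_trans (size_scale_leq _ _)) ?size_polyX.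
Qed.

(* The pole order at infinity of p + q y is max (2 deg p) (2 deg q + 3). *)
Lemma size_coord_norm (z : R) : z.2 != 0 -> (3 < size (coord_norm z))%N.
Proof.
case: z => p q /= q0; rewrite /coord_norm /=.
have f0 : f != 0 by rewrite -size_poly_gt0 size_curve_cubic.
have q_gt0 : (0 < size q)%N by rewrite size_poly_gt0.
have s2 : size (q ^+ 2 * f) = (size q).*2.+2.
  rewrite size_mul ?expf_neq0 // expr2 size_mul // size_curve_cubic.
  by case: (size q) q_gt0 => // m _; lia.
have [->|p0] := eqVneq p 0.
  by rewrite expr2 !mul0r subr0 sub0r size_polyN s2; lia.
have p_gt0 : (0 < size p)%N by rewrite size_poly_gt0.
have s1 : size (p ^+ 2) = (size p).*2.-1 by rewrite expr2 size_mul // addnn.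
have s3 : (size (p * q * h)%R <= size p + size q)%N.
  apply: leq_trans (size_polyMleq _ _) _; rewrite size_mul //.
  have := size_curve_lin; move: (size h) (size p) (size q) p_gt0 q_gt0 => a b c.
  by lia.
have [le|lt] := leqP (size p) (size q).+1.
  rewrite addrC size_polyDl size_polyN s2; first by case: (size q) q_gt0.
  rewrite ltnS (leq_trans (size_polyD _ _)) // geq_max s1 size_polyN.
  move: le s3; move: (size p) (size q) (size (p * q * h)%R) => a b c le s3.
  by apply/andP; split; lia.
rewrite -addrA size_polyDl s1.
  by move: lt q_gt0; move: (size p) (size q) => a b lt b0; lia.
rewrite -opprD size_polyN (leq_ltn_trans (size_polyD _ _)) // gtn_max s2.
move: lt s3; move: (size p) (size q) (size (p * q * h)%R) => a b c lt s3.
by apply/andP; split; lia.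
Qed.

Lemma coord_norm_eq0 (z : R) : coord_norm z = 0 -> z = 0.
Proof.
move=> z0; have [q0|/size_coord_norm] := eqVneq z.2 0; last by rewrite z0 size_poly0.
case: z q0 z0 => p q /= ->; rewrite /coord_norm /= mulr0 mul0r subr0 expr0n mul0r subr0.
by move=> /eqP; rewrite expf_eq0 => /eqP ->.
Qed.

Lemma coord_mulf_eq0 (z w : R) : z * w = 0 -> z = 0 \/ w = 0.
Proof.
move=> zw0; have /eqP : coord_norm z * coord_norm w = 0.
  by rewrite -coord_normM zw0 /coord_norm /= expr0n !mul0r !subr0.
by rewrite mulf_eq0 => /orP[] /eqP /coord_norm_eq0; [left|right].
Qed.

Lemma coord_mulfI (z u v : R) : z != 0 -> z * u = z * v -> u = v.
Proof.
move=> z0 e; apply/eqP; rewrite -subr_eq0; apply/eqP.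
have : z * (u - v) = 0 by rewrite mulrBr e subrr.
by case/coord_mulf_eq0 => // zE; rewrite zE eqxx in z0.
Qed.

Definition coord_x (a : F) : R := coord_of ('X - a%:P).
Definition coord_y (b : F) : R := coordY - coord_of b%:P.

(** Membership in the product of the ideals (x - a, y - b) over the points (a, b) of [s],
    repetitions allowed; the empty product is the whole ring. *)
Fixpoint ideal (s : seq (F * F)) (z : R) : Prop :=
  if s is p :: s' then
    exists u v, [/\ ideal s' u, ideal s' v & z = coord_x p.1 * u + coord_y p.2 * v]
  else True.

Lemma idealD s z w : ideal s z -> ideal s w -> ideal s (z + w).
Proof.
elim: s z w => //= p s IH z w [u [v [su sv ->]]] [u' [v' [su' sv' ->]]].
by exists (u + u'), (v + v'); split; [exact: IH|exact: IH|ring].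
Qed.

Lemma idealM s z w : ideal s w -> ideal s (z * w).
Proof.
elim: s z w => //= p s IH z w [u [v [su sv ->]]].
by exists (z * u), (z * v); split; [exact: IH|exact: IH|ring].
Qed.

Lemma ideal_x p s u : ideal s u -> ideal (p :: s) (coord_x p.1 * u).
Proof.
move=> su; exists u, 0; split=> //; last by rewrite mulr0 addr0.
by rewrite -(mul0r u); apply: idealM.
Qed.

Lemma ideal_y p s u : ideal s u -> ideal (p :: s) (coord_y p.2 * u).
Proof.
move=> su; exists 0, u; split=> //; last by rewrite mulr0 add0r.
by rewrite -(mul0r u); apply: idealM.
Qed.

(** Equality of ideal classes, stated as f I = g J with f, g nonzero so that no fractional ideals
    occur. *)
Definition same_class (s t : seq (F * F)) : Prop :=
  exists f g : R, [/\ f != 0, g != 0 & forall z,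
    (exists2 u, ideal s u & z = f * u) <-> (exists2 v, ideal t v & z = g * v)].

Lemma same_class_refl s : same_class s s.
Proof. by exists 1, 1; split; rewrite ?oner_eq0. Qed.

Lemma same_class_sym s t : same_class s t -> same_class t s.
Proof. by move=> [f [g [f0 g0 H]]]; exists g, f; split=> // z; rewrite H. Qed.

Lemma coord_mulf_neq0 (z w : R) : z != 0 -> w != 0 -> z * w != 0.
Proof.
move=> /eqP z0 /eqP w0; apply/eqP => /coord_mulf_eq0[] //.
Qed.

Lemma same_class_trans t s r : same_class s t -> same_class t r -> same_class s r.
Proof.
move=> [f [g [f0 g0 H]]] [f' [g' [f'0 g'0 H']]].
exists (f' * f), (g * g'); split; try exact: coord_mulf_neq0.
move=> z; split=> [[u su ->]|[v rv ->]].
  have [v tv e] : exists2 v, ideal t v & f * u = g * v by apply/H; exists u.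
  have [w rw e'] : exists2 w, ideal r w & f' * v = g' * w by apply/H'; exists v.
  by exists w => //; rewrite -mulrA e mulrCA e' mulrA.
have [w tw e] : exists2 w, ideal t w & g' * v = f' * w by apply/H'; exists v.
have [u su e'] : exists2 u, ideal s u & g * w = f * u by apply/H; exists w.
by exists u => //; rewrite -mulrA e mulrCA e' mulrA.
Qed.

Lemma same_class_cons p s t : same_class s t -> same_class (p :: s) (p :: t).
Proof.
move=> [f [g [f0 g0 H]]]; exists f, g; split=> // z; split.
  move=> [_ [u [v [su sv ->]]] ->].
  have [u' tu eu] : exists2 w, ideal t w & f * u = g * w by apply/H; exists u.
  have [v' tv ev] : exists2 w, ideal t w & f * v = g * w by apply/H; exists v.
  exists (coord_x p.1 * u' + coord_y p.2 * v'); first by exists u', v'.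
  by rewrite !mulrDr ![_ * (coord_x _ * _)]mulrCA ![_ * (coord_y _ * _)]mulrCA eu ev.
move=> [_ [u [v [su sv ->]]] ->].
have [u' tu eu] : exists2 w, ideal s w & g * u = f * w by apply/H; exists u.
have [v' tv ev] : exists2 w, ideal s w & g * v = f * w by apply/H; exists v.
exists (coord_x p.1 * u' + coord_y p.2 * v'); first by exists u', v'.
by rewrite !mulrDr ![_ * (coord_x _ * _)]mulrCA ![_ * (coord_y _ * _)]mulrCA eu ev.
Qed.

Lemma same_class_cat l s t : same_class s t -> same_class (l ++ s) (l ++ t).
Proof. by move=> st; elim: l => //= p l; apply: same_class_cons. Qed.

End CoordRing.

(** * Associativity of the chord and tangent law *)

Section LineIdeal.
Variables (F : fieldType) (W : weierstrass).
Local Notation R := (curve_ring F W).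
Local Notation b1 := ((a1 W)%:~R : F).
Local Notation b2 := ((a2 W)%:~R : F).
Local Notation b3 := ((a3 W)%:~R : F).
Local Notation b4 := ((a4 W)%:~R : F).
Local Notation b6 := ((a6 W)%:~R : F).

(** The two equations are the vanishing of the partial derivatives of the Weierstrass equation in y
    and, up to sign, in x. *)
Definition smooth_curve : Prop := forall x y : F, on_curve W (Some (x, y)) ->
  2 * y + b1 * x + b3 = 0 -> 3 * x ^+ 2 + 2 * b2 * x + b4 - b1 * y = 0 -> False.

Local Notation cst a := (@coord_of F W a%:P).
Local Notation X := (@coord_of F W 'X).
Local Notation Y := (coordY F W).

Lemma coord_xE a : coord_x W a = X - cst a.
Proof. by rewrite /coord_x rmorphB. Qed.

Lemma coord_yE b : coord_y W b = Y - cst b.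
Proof. by []. Qed.

Lemma coord_eq : Y ^+ 2 = X ^+ 3 + cst b2 * X ^+ 2 + cst b4 * X + cst b6
   - (cst b1 * X + cst b3) * Y.
Proof. by rewrite coordY2 /curve_cubic /curve_lin !rmorphD !rmorphM. Qed.

Definition coord_line (l m : F) : R := Y - cst l * X - cst m.

Definition is_ideal (J : R -> Prop) : Prop :=
  (forall z w, J z -> J w -> J (z + w)) /\ (forall z w, J w -> J (z * w)).

Lemma is_ideal_cst J a z : is_ideal J -> a != 0 -> J (cst a * z) -> J z.
Proof.
move=> [_ JM] a0 /(JM (cst a^-1)).
by rewrite mulrA -!rmorphM /= mulVf // !rmorph1 mul1r.
Qed.

(* [c] is the value at (x, l x + m) of minus the conjugate of the line. *)
Lemma is_ideal_double J l m x (c := 2 * (l * x + m) + b1 * x + b3) :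
  is_ideal J -> c != 0 ->
  J (coord_x W x * coord_x W x) -> J (coord_line l m * coord_x W x) ->
  J (coord_line l m * coord_line l m) ->
  J (Y + cst b1 * X + cst b3 + cst l * X + cst m) -> J 1.
Proof.
move=> JI c0; have [JD JM] := JI.
set d := coord_x W x; set e := coord_line l m; set e' := (Y + _ + _ + _ + _).
move=> Jdd Jed Jee Je'.
have ec : cst c = e' - e - cst (b1 + 2 * l) * d.
  rewrite /e' /e /d /coord_line coord_xE /c !(rmorphD, rmorphM) /=.
  by ring.
have Jd : J d.
  apply: (is_ideal_cst JI c0).
  have -> : cst c * d = d * e' + ((-1) * (e * d) + (- cst (b1 + 2 * l)) * (d * d)).
    by rewrite ec; ring.
  by apply: (JD); [exact: (JM)|apply: (JD); exact: (JM)].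
have Je : J e.
  apply: (is_ideal_cst JI c0).
  have -> : cst c * e = e * e' + ((-1) * (e * e) + (- cst (b1 + 2 * l)) * (e * d)).
    by rewrite ec; ring.
  by apply: (JD); [exact: (JM)|apply: (JD); exact: (JM)].
apply: (is_ideal_cst JI c0); rewrite ec mulr1.
have -> : e' - e - cst (b1 + 2 * l) * d = e' + ((-1) * e + (- cst (b1 + 2 * l)) * d).
  by ring.
by apply: (JD) => //; apply: (JD); apply: (JM).
Qed.

Section OnLine.
Variables (l m x1 x2 x3 : F).
Hypothesis sm : smooth_curve.
Hypothesis e1 : x1 + x2 + x3 = l ^+ 2 + b1 * l - b2.
Hypothesis e2 : x1 * x2 + x1 * x3 + x2 * x3 = b4 - 2 * l * m - b1 * m - b3 * l.
Hypothesis e3 : x1 * x2 * x3 = m ^+ 2 + b3 * m - b6.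

Let b2E : b2 = l ^+ 2 + b1 * l - (x1 + x2 + x3).
Proof. by rewrite e1; ring. Qed.
Let b4E : b4 = x1 * x2 + x1 * x3 + x2 * x3 + 2 * l * m + b1 * m + b3 * l.
Proof. by rewrite e2; ring. Qed.
Let b6E : b6 = m ^+ 2 + b3 * m - x1 * x2 * x3.
Proof. by rewrite e3; ring. Qed.

(** The hypotheses are Vieta's relations for the intersection with y = l x + m, and the second
    factor is minus the conjugate of the line, so this is its norm up to sign. *)
Lemma coord_lineM :
  coord_line l m * (Y + cst b1 * X + cst b3 + cst l * X + cst m) =
  coord_x W x1 * coord_x W x2 * coord_x W x3.
Proof.
rewrite /coord_line !coord_xE.
transitivity (Y ^+ 2 + (cst b1 * X + cst b3) * Y
   - (cst l * X + cst m) * (cst b1 * X + cst b3 + cst l * X + cst m)); first by ring.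
rewrite coord_eq b2E b4E b6E !(rmorphB, rmorphD, rmorphM, rmorphXn) /=.
by ring.
Qed.

Lemma line_on_curve : on_curve W (Some (x3, l * x3 + m)).
Proof. by rewrite /on_curve b2E b4E b6E; apply/eqP; ring. Qed.

(** At a double intersection the x-derivative of the equation is, up to sign, l times the
    y-derivative; if the latter vanished, the point would be singular. *)
Lemma line_double : x1 = x2 -> 2 * (l * x1 + m) + b1 * x1 + b3 != 0.
Proof.
move=> e12; apply/eqP => c0.
apply: (@sm x1 (l * x1 + m)) => //.
  by rewrite /on_curve b2E b4E b6E; apply/eqP; ring.
suff -> : 3 * x1 ^+ 2 + 2 * b2 * x1 + b4 - b1 * (l * x1 + m) =
   l * (2 * (l * x1 + m) + b1 * x1 + b3) by rewrite c0 mulr0.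
by rewrite b2E b4E -e12; ring.
Qed.

End OnLine.

(** One inclusion expands the generators with y - y_i = e + l (x - x_i), e being the line, and
    [coord_lineM]. For the other, [J] is the ideal of all j such that e j lies in the product: if
    the x_i are distinct, 1 is a combination of the products (x - x_i)(x - x_j), and a repeated x_i
    is handled by [is_ideal_double]. *)
Lemma line_ideal l m x1 x2 x3 s (z : R) : smooth_curve ->
  x1 + x2 + x3 = l ^+ 2 + b1 * l - b2 ->
  x1 * x2 + x1 * x3 + x2 * x3 = b4 - 2 * l * m - b1 * m - b3 * l ->
  x1 * x2 * x3 = m ^+ 2 + b3 * m - b6 ->
  ideal [:: (x1, l * x1 + m), (x2, l * x2 + m), (x3, l * x3 + m) & s] z <->
  exists2 w, ideal s w & z = coord_line l m * w.
Proof.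
move=> sm e1 e2 e3; set e := coord_line l m.
have yE x : coord_y W (l * x + m) = e + cst l * coord_x W x.
  by rewrite coord_yE coord_xE /e /coord_line !(rmorphD, rmorphM) /=; ring.
have eM := coord_lineM e1 e2 e3; rewrite -/e in eM.
set e' := (Y + _ + _ + _ + _) in eM.
split.
  move=> [_ [_ [[_ [_ [[u1 [v1 [su1 sv1 ->]]] [u2 [v2 [su2 sv2 ->]]] ->]]]
    [_ [_ [[u3 [v3 [su3 sv3 ->]]] [u4 [v4 [su4 sv4 ->]]] ->]]] ->]]] /=.
  rewrite !yE.
  move: eM; set d1 := coord_x W x1; set d2 := coord_x W x2; set d3 := coord_x W x3.
  set k := cst l => eM.
  pose c2 := (d1 + k * d1) * 0.
  (* The coefficient of [d1 * d2 * d3] in the expansion; all remaining terms contain [e], and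
     [d1 * d2 * d3 = e * e']. *)
  pose T := u1 + k * v1 + k * u2 + k * k * v2 + k * u3 + k * k * v3 + k * k * u4 + k * k * k * v4.
  exists (e' * T
    + (d1 * d2) * (v1 + k * v2 + k * v3 + k * k * v4)
    + (d1 * d3) * (u2 + k * v2 + k * u4 + k * k * v4)
    + (d2 * d3) * (u3 + k * v3 + k * u4 + k * k * v4)
    + e * d1 * (v2 + k * v4) + e * d2 * (v3 + k * v4) + e * d3 * (u4 + k * v4)
    + e * e * v4).
    by rewrite /T; do !(apply: idealD || apply: idealM).
  transitivity (d1 * d2 * d3 * T + e * ((d1 * d2) * (v1 + k * v2 + k * v3 + k * k * v4)
    + (d1 * d3) * (u2 + k * v2 + k * u4 + k * k * v4)
    + (d2 * d3) * (u3 + k * v3 + k * u4 + k * k * v4)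
    + e * d1 * (v2 + k * v4) + e * d2 * (v3 + k * v4) + e * d3 * (u4 + k * v4)
    + e * e * v4)); first by rewrite /T; ring.
  by rewrite -eM; ring.
move=> [w sw ->].
pose J (j : R) := forall w : R, ideal s w -> ideal
  [:: (x1, l * x1 + m), (x2, l * x2 + m), (x3, l * x3 + m) & s] (e * j * w).
suff J1 : J 1 by have := J1 _ sw; rewrite mulr1.
have JI : is_ideal J.
  split=> [a b Ja Jb u su|a b Jb u su].
    by rewrite mulrDr mulrDl; apply: idealD; [exact: Ja|exact: Jb].
  by rewrite mulrCA -mulrA; apply: idealM; apply: Jb.
have ide x t u : ideal t u -> ideal ((x, l * x + m) :: t) (e * u).
  move=> tu; exists (- cst l * u), u; split=> //=; first exact: idealM.
  by rewrite yE; ring.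
have idx x t u : ideal t u -> ideal ((x, l * x + m) :: t) (coord_x W x * u).
  exact: ideal_x.
have J12 : J (coord_x W x1 * coord_x W x2).
  move=> u su; rewrite (_ : _ * u = coord_x W x1 * (coord_x W x2 * (e * u))); last by ring.
  by do 2 apply: (idx); apply: (ide).
have J13 : J (coord_x W x1 * coord_x W x3).
  move=> u su; rewrite (_ : _ * u = coord_x W x1 * (e * (coord_x W x3 * u))); last by ring.
  by apply: (idx); apply: (ide); apply: (idx).
have J23 : J (coord_x W x2 * coord_x W x3).
  move=> u su; rewrite (_ : _ * u = e * (coord_x W x2 * (coord_x W x3 * u))); last by ring.
  by apply: (ide); apply: (idx); apply: (idx).
have Je1 : J (e * coord_x W x1).
  move=> u su; rewrite (_ : _ * u = coord_x W x1 * (e * (e * u))); last by ring.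
  by apply: (idx); apply: (ide); apply: (ide).
have Je2 : J (e * coord_x W x2).
  move=> u su; rewrite (_ : _ * u = e * (coord_x W x2 * (e * u))); last by ring.
  by apply: (ide); apply: (idx); apply: (ide).
have Je3 : J (e * coord_x W x3).
  move=> u su; rewrite (_ : _ * u = e * (e * (coord_x W x3 * u))); last by ring.
  by apply: (ide); apply: (ide); apply: (idx).
have Jee : J (e * e).
  move=> u su; rewrite (_ : _ * u = e * (e * (e * u))); last by ring.
  by do 3 apply: (ide).
have Je' : J e'.
  by move=> u su; rewrite eM -!mulrA; do 3 apply: (idx).
have cE x x' : cst (x' - x) = coord_x W x - coord_x W x'.
  by rewrite !coord_xE !rmorphB /=; ring.
have [e12|n12] := eqVneq x1 x2.
  by apply: (is_ideal_double JI (line_double sm e1 e2 e3 e12)); rewrite // {2}e12.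
have [e13|n13] := eqVneq x1 x3.
  have := @line_double l m x1 x3 x2 sm; rewrite (addrAC x1) e1 (mulrAC x1) e3.
  rewrite (addrC (x1 * x3)) (mulrC x3) e2 => /(_ erefl erefl erefl e13) c0.
  by apply: (is_ideal_double JI c0); rewrite // {2}e13.
have [e23|n23] := eqVneq x2 x3.
  have := @line_double l m x2 x3 x1 sm.
  rewrite (_ : x2 + x3 + x1 = x1 + x2 + x3); last by ring.
  rewrite (_ : x2 * x3 + x2 * x1 + x3 * x1 = x1 * x2 + x1 * x3 + x2 * x3); last by ring.
  rewrite (_ : x2 * x3 * x1 = x1 * x2 * x3); last by ring.
  move=> /(_ e1 e2 e3 e23) c0.
  by apply: (is_ideal_double JI c0); rewrite // {2}e23.
have [JD JM] := JI.
have Jd1 : J (coord_x W x1).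
  apply: (@is_ideal_cst _ (x3 - x2) _ JI); first by rewrite subr_eq0 eq_sym.
  rewrite cE (_ : _ * _ = coord_x W x1 * coord_x W x2 + (-1) * (coord_x W x1 * coord_x W x3)).
    by apply: (JD) => //; apply: (JM).
  by ring.
have Jd2 : J (coord_x W x2).
  apply: (@is_ideal_cst _ (x3 - x1) _ JI); first by rewrite subr_eq0 eq_sym.
  rewrite cE (_ : _ * _ = coord_x W x1 * coord_x W x2 + (-1) * (coord_x W x2 * coord_x W x3)).
    by apply: (JD) => //; apply: (JM).
  by ring.
apply: (@is_ideal_cst _ (x2 - x1) _ JI); first by rewrite subr_eq0 eq_sym.
rewrite cE mulr1 (_ : _ - _ = coord_x W x1 + (-1) * coord_x W x2); last by ring.
by apply: (JD) => //; apply: (JM).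
Qed.

Definition opp_point (T : point F) : point F :=
  omap (fun p => (p.1, - p.2 - b1 * p.1 - b3)) T.

Lemma opp_on_curve T : on_curve W T -> on_curve W (opp_point T).
Proof.
case: T => [[x y]|] //= /eqP H; apply/eqP; rewrite -H; ring.
Qed.

(** (Y - y)(Y - y') is X - x times the cofactor [K]. If y = y', the value of [K] at the point is, up
    to sign, the x-derivative of the equation, nonzero by smoothness; if y != y', the nonzero
    constant y' - y does the work. *)
Lemma vertical_ideal x y y' s (z : R) : smooth_curve -> on_curve W (Some (x, y)) ->
  y + y' + b1 * x + b3 = 0 ->
  ideal [:: (x, y), (x, y') & s] z <-> exists2 w, ideal s w & z = coord_x W x * w.
Proof.
move=> sm oc yy'; set d := coord_x W x.
have y'E : y' = - y - b1 * x - b3 by rewrite -[RHS]add0r -yy'; ring.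
pose K : R := X ^+ 2 + X * cst x + cst x ^+ 2 + cst b2 * (X + cst x) + cst b4 - cst b1 * Y.
have yM : coord_y W y * coord_y W y' = d * K.
  move: oc => /eqP oc.
  have {}oc : b6 = y ^+ 2 + b1 * x * y + b3 * y - (x ^+ 3 + b2 * x ^+ 2 + b4 * x).
    by rewrite oc; ring.
  rewrite !coord_yE /d coord_xE /K y'E.
  transitivity (Y ^+ 2 + Y * (cst b1 * cst x + cst b3)
    - cst y * (cst y + cst b1 * cst x + cst b3)).
    by rewrite !(rmorphB, rmorphN, rmorphM) /=; ring.
  by rewrite coord_eq oc !(rmorphB, rmorphD, rmorphM, rmorphXn) /=; ring.
split.
  move=> [_ [_ [[u1 [v1 [su1 sv1 ->]]] [u2 [v2 [su2 sv2 ->]]] ->]]] /=.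
  rewrite -/d; exists (d * u1 + coord_y W y' * v1 + coord_y W y * u2 + K * v2).
    by do !(apply: idealD || apply: idealM).
  transitivity (d * (d * u1 + coord_y W y' * v1 + coord_y W y * u2)
    + coord_y W y * coord_y W y' * v2); first by ring.
  by rewrite yM; ring.
move=> [w sw ->].
pose J (j : R) := forall w : R, ideal s w -> ideal [:: (x, y), (x, y') & s] (d * j * w).
suff J1 : J 1 by have := J1 _ sw; rewrite mulr1.
have JI : is_ideal J.
  split=> [a b Ja Jb u su|a b Jb u su].
    by rewrite mulrDr mulrDl; apply: idealD; [exact: Ja|exact: Jb].
  by rewrite mulrCA -mulrA; apply: idealM; apply: Jb.
have Jd : J d.
  by move=> u su; rewrite -mulrA; apply: (ideal_x (x, y)); apply: (ideal_x (x, y')).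
have Jy : J (coord_y W y).
  move=> u su; rewrite (_ : _ * _ = coord_y W y * (d * u)); last by ring.
  by apply: (ideal_y (x, y)); apply: (ideal_x (x, y')).
have Jy' : J (coord_y W y').
  move=> u su; rewrite -mulrA.
  by apply: (ideal_x (x, y)); apply: (ideal_y (x, y')).
have JK : J K.
  move=> u su; rewrite -yM -mulrA.
  by apply: (ideal_y (x, y)); apply: (ideal_y (x, y')).
have [JD JM] := JI.
have [eyy'|nyy'] := eqVneq y y'; last first.
  apply: (@is_ideal_cst _ (y' - y) _ JI); first by rewrite subr_eq0 eq_sym.
  rewrite mulr1 (_ : cst _ = coord_y W y + (-1) * coord_y W y').
    by apply: (JD) => //; apply: (JM).
  by rewrite !coord_yE !rmorphB /=; ring.
apply: (@is_ideal_cst _ (3 * x ^+ 2 + 2 * b2 * x + b4 - b1 * y) _ JI).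
  apply/eqP; apply: sm oc _; rewrite -yy' -eyy'; ring.
rewrite mulr1 (_ : cst _ =
    K + ((- X - 2 * cst x - cst b2) * d + cst b1 * coord_y W y)).
  by apply: (JD) => //; apply: (JD); apply: (JM).
rewrite /K /d coord_xE coord_yE !(rmorphB, rmorphD, rmorphM, rmorphXn) /=.
by ring.
Qed.

End LineIdeal.

(** * From ideal classes to the group law *)

Section PointGroup.
Variables (F : fieldType) (W : weierstrass).
Local Notation R := (curve_ring F W).
Local Notation b1 := ((a1 W)%:~R : F).
Local Notation b2 := ((a2 W)%:~R : F).
Local Notation b3 := ((a3 W)%:~R : F).
Local Notation b4 := ((a4 W)%:~R : F).
Local Notation b6 := ((a6 W)%:~R : F).
Local Notation "S +' T" := (@add_point F W S T) (at level 50).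
Local Notation "-' T" := (@opp_point F W T) (at level 35).

(** Chord and tangent are treated alike: x1, x2, x3 are the abscissae, with multiplicity, of the
    intersection with y = l x + m, recorded through Vieta's relations. *)
Variant add_spec x1 y1 x2 y2 : point F -> Prop :=
| AddSpec l m x3 of y1 = l * x1 + m & y2 = l * x2 + m
    & x1 + x2 + x3 = l ^+ 2 + b1 * l - b2
    & x1 * x2 + x1 * x3 + x2 * x3 = b4 - 2 * l * m - b1 * m - b3 * l
    & x1 * x2 * x3 = m ^+ 2 + b3 * m - b6 :
    add_spec x1 y1 x2 y2 (opp_point W (Some (x3, l * x3 + m))).

Lemma add_pointP x1 y1 x2 y2 :
  on_curve W (Some (x1, y1)) -> on_curve W (Some (x2, y2)) ->
  ~~ ((x1 == x2) && (y1 + y2 + b1 * x2 + b3 == 0)) ->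
  add_spec x1 y1 x2 y2 (Some (x1, y1) +' Some (x2, y2)).
Proof.
move=> /eqP o1 /eqP o2 /= /negPf ne; rewrite ne.
set l := if _ then _ else _.
set m := y1 - l * x1; set x3 := l ^+ 2 + _ - _ - _ - _.
have -> : Some (x3, - (l + b1) * x3 - m - b3) = opp_point W (Some (x3, l * x3 + m)).
  by rewrite /=; congr (Some (_, _)); ring.
have y1E : y1 = l * x1 + m by rewrite /m; ring.
have e1 : x1 + x2 + x3 = l ^+ 2 + b1 * l - b2 by rewrite /x3; ring.
(* [al] and [be] are the defects of the last two Vieta relations. A known intersection abscissa x
   gives [al * x + be = 0]; a second one, or the tangency condition, then kills both. *)
pose al := x1 * x2 + x1 * x3 + x2 * x3 - (b4 - 2 * l * m - b1 * m - b3 * l).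
pose be := m ^+ 2 + b3 * m - b6 - x1 * x2 * x3.
have b2E : b2 = l ^+ 2 + b1 * l - (x1 + x2 + x3) by rewrite e1; ring.
have ab1 : al * x1 + be = 0.
  rewrite -(subrr (y1 ^+ 2 + b1 * x1 * y1 + b3 * y1)) {2}o1 y1E b2E /al /be; ring.
suff [y2E al0] : y2 = l * x2 + m /\ al = 0.
  split=> //; first by apply/eqP; rewrite -subr_eq0 -/al al0.
  by apply/eqP; rewrite eq_sym -subr_eq0 -/be -ab1 al0 mul0r add0r.
have [e12|n12] := eqVneq x1 x2.
  rewrite -e12 in o2; rewrite -e12 eqxx /= in ne.
  have yy : y1 = y2.
    apply/eqP; rewrite -subr_eq0; apply/eqP/(mulIf (negbT ne)).
    rewrite mul0r -(subrr (y1 ^+ 2 + b1 * x1 * y1 + b3 * y1)) {2}o1 -o2; ring.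
  split; first by rewrite -e12 -yy.
  have lE : l * (2 * y1 + b1 * x1 + b3) = 3 * x1 ^+ 2 + 2 * b2 * x1 + b4 - b1 * y1.
    rewrite /l e12 eqxx -e12 mulfVK //.
    by apply: contraFneq ne => <-; rewrite -yy; apply/eqP; ring.
  have b4E : b4 = l * (2 * y1 + b1 * x1 + b3) + b1 * y1 - (3 * x1 ^+ 2 + 2 * b2 * x1).
    by rewrite lE; ring.
  by rewrite /al b4E b2E -e12 y1E; ring.
have d0 : x2 - x1 != 0 by rewrite subr_eq0 eq_sym.
have lE : l * (x2 - x1) = y2 - y1 by rewrite /l (negPf n12) mulfVK.
have y2E : y2 = l * x2 + m.
  by rewrite /m -[LHS](subrK y1) -lE; ring.
split=> //; apply: (mulIf d0); rewrite mul0r.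
have ab2 : al * x2 + be = 0.
  rewrite -(subrr (y2 ^+ 2 + b1 * x2 * y2 + b3 * y2)) {2}o2 y2E b2E /al /be; ring.
transitivity ((al * x2 + be) - (al * x1 + be)); first by ring.
by rewrite ab1 ab2 subrr.
Qed.

Lemma add_pointN x1 y1 x2 y2 :
  (x1 == x2) && (y1 + y2 + b1 * x2 + b3 == 0) ->
  Some (x1, y1) +' Some (x2, y2) = None.
Proof. by rewrite /= => ->. Qed.

Lemma add_on_curve (S T : point F) : on_curve W S -> on_curve W T -> on_curve W (S +' T).
Proof.
case: S T => [[x1 y1]|] [[x2 y2]|] // o1 o2.
have [/add_pointN -> //|ne] := boolP ((x1 == x2) && (y1 + y2 + b1 * x2 + b3 == 0)).
case: (add_pointP o1 o2 ne) => l m x3 _ _ e1 e2 e3.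
by apply: opp_on_curve; apply: line_on_curve e1 e2 e3.
Qed.

Lemma opp_pointK : involutive (@opp_point F W).
Proof. by case=> [[x y]|] //=; congr (Some (_, _)); ring. Qed.

Lemma add_pointNr (T : point F) : T +' (-' T) = None.
Proof.
case: T => [[x y]|] //; apply: add_pointN; rewrite eqxx /=.
by apply/eqP; ring.
Qed.

Lemma add_point_eq0 (S T : point F) : S +' T = None -> T = -' S.
Proof.
case: S T => [[x1 y1]|] [[x2 y2]|] //=.
case: ifP => // /andP[/eqP -> /eqP e] _; congr (Some (_, _)).
by rewrite -[RHS]addr0 -e; ring.
Qed.

Lemma add_pointC (S T : point F) : on_curve W S -> on_curve W T -> S +' T = T +' S.
Proof.
case: S T => [[x1 y1]|] [[x2 y2]|] // o1 o2.
have [H|ne] := boolP ((x1 == x2) && (y1 + y2 + b1 * x2 + b3 == 0)).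
  rewrite (add_pointN H) add_pointN //.
  case/andP: H => /eqP <- /eqP <-; rewrite eqxx /=; apply/eqP; ring.
have ne' : ~~ ((x2 == x1) && (y2 + y1 + b1 * x1 + b3 == 0)).
  by apply: contra ne => /andP[/eqP <- /eqP <-]; rewrite eqxx /=; apply/eqP; ring.
rewrite /= (negPf ne) (negPf ne') [x2 == x1]eq_sym.
have [e12|n12] := eqVneq x1 x2.
  rewrite -e12 in ne o2 *; rewrite eqxx /= in ne.
  suff -> : y1 = y2 by [].
  apply/eqP; rewrite -subr_eq0; apply/eqP/(mulIf ne).
  rewrite mul0r; move/eqP: o1 => o1; move/eqP: o2 => o2.
  by rewrite -(subrr (y1 ^+ 2 + b1 * x1 * y1 + b3 * y1)) {2}o1 -o2; ring.
have -> : (y1 - y2) / (x1 - x2) = (y2 - y1) / (x2 - x1).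
  by rewrite -(opprB y2) -(opprB x2) invrN mulrNN.
set l := _ / _; have lE : l * (x2 - x1) = y2 - y1.
  by rewrite /l mulfVK // subr_eq0 eq_sym.
have y2E : y2 = l * (x2 - x1) + y1 by rewrite lE; ring.
rewrite [in RHS]y2E.
by congr (Some (_, _)); ring.
Qed.

Definition point_divisor (T : point F) : seq (F * F) := if T is Some p then [:: p] else [::].

Hypothesis sm : smooth_curve F W.

Lemma same_class_opp x y y' s : on_curve W (Some (x, y)) ->
  y + y' + b1 * x + b3 = 0 -> same_class W [:: (x, y), (x, y') & s] s.
Proof.
move=> oc yy'; exists 1, (coord_x W x); split; first exact: oner_neq0.
  by apply/eqP => -[/eqP]; rewrite polyXsubC_eq0.
move=> z; split.
  by move=> [u /(vertical_ideal s u sm oc yy') [w sw ->] ->]; exists w; rewrite ?mul1r.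
move=> [w sw ->]; exists (coord_x W x * w); rewrite ?mul1r //.
by apply/(vertical_ideal s _ sm oc yy'); exists w.
Qed.

Lemma same_class_line l m x1 x2 x3 s :
  x1 + x2 + x3 = l ^+ 2 + b1 * l - b2 ->
  x1 * x2 + x1 * x3 + x2 * x3 = b4 - 2 * l * m - b1 * m - b3 * l ->
  x1 * x2 * x3 = m ^+ 2 + b3 * m - b6 ->
  same_class W [:: (x1, l * x1 + m), (x2, l * x2 + m), (x3, l * x3 + m) & s] s.
Proof.
move=> e1 e2 e3; exists 1, (coord_line W l m); split; first exact: oner_neq0.
  have c1 : (coord_line W l m).2 = 1 by rewrite /coord_line coord_mulE /=; ring.
  by apply/eqP => c0; move/eqP: c1; rewrite c0 eq_sym oner_eq0.
move=> z; split.
  by move=> [u /(line_ideal s u sm e1 e2 e3) [w sw ->] ->]; exists w; rewrite ?mul1r.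
move=> [w sw ->]; exists (coord_line W l m * w); rewrite ?mul1r //.
by apply/(line_ideal s _ sm e1 e2 e3); exists w.
Qed.

(** The third intersection point mediates: its ideal times those of S and T is principal, and so is
    its ideal times that of S + T. *)
Lemma same_class_add (S T : point F) s : on_curve W S -> on_curve W T ->
  same_class W (point_divisor S ++ point_divisor T ++ s) (point_divisor (S +' T) ++ s).
Proof.
case: S T => [[x1 y1]|] [[x2 y2]|] o1 o2; try exact: same_class_refl.
have [H|ne] := boolP ((x1 == x2) && (y1 + y2 + b1 * x2 + b3 == 0)).
  rewrite (add_pointN H); case/andP: H => /eqP e /eqP; rewrite /= -e.
  by apply: same_class_opp.
case: (add_pointP o1 o2 ne) => l m x3 -> -> e1 e2 e3 /=.
set y3 := (- _ - _ - _); apply: same_class_sym.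
apply: same_class_trans (same_class_sym (same_class_line ((x3, y3) :: s) e1 e2 e3)) _.
do 2 apply: same_class_cons.
apply: same_class_opp; first exact: line_on_curve e1 e2 e3.
by rewrite /y3; ring.
Qed.

(** A generator u would divide X - a, so its norm divides (X - a)^2 and has degree at most 2.
    Elements involving y have norm of degree at least 3, hence u is a polynomial in x; as it divides
    Y - b it is constant, yet it vanishes at the point. *)
Lemma point_not_principal (p : F * F) :
  on_curve W (Some p) -> ~ same_class W [::] [:: p].
Proof.
case: p => a b /eqP oc [f [g [f0 g0 H]]].
have [u [u' [v' [_ _ uE]]] fE] :
    exists2 v : R, ideal [:: (a, b)] v & f = g * v.
  by have [v iv e] : exists2 v, ideal [:: (a, b)] v & f * 1 = g * v;
    [apply/H; exists 1 | exists v; rewrite // -e mulr1].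
rewrite /= in uE; have {H} Hu z : ideal [:: (a, b)] z -> exists w, z = u * w.
  move=> iz; have [w _ e] : exists2 w, ideal [::] w & g * z = f * w by apply/H; exists z.
  by exists w; apply: (coord_mulfI g0); rewrite e fE mulrA.
have [w xE] : exists w, coord_x W a = u * w.
  by apply: Hu; have := @ideal_x _ W (a, b) [::] 1 I; rewrite mulr1.
have [t yE] : exists t, coord_y W b = u * t.
  by apply: Hu; have := @ideal_y _ W (a, b) [::] 1 I; rewrite mulr1.
have nM : coord_norm u * coord_norm w = ('X - a%:P) ^+ 2.
  by rewrite -coord_normM -xE /coord_norm /=; ring.
have n0 : coord_norm u * coord_norm w != 0.
  by rewrite nM expf_neq0 // polyXsubC_eq0.
have u2 : u.2 = 0.
  apply/eqP/negPn/negP => /size_coord_norm; apply/negP; rewrite -leqNgt.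
  have <- : size (coord_norm u * coord_norm w)%R = 3%N.
    by rewrite nM size_exp_XsubC.
  have := n0; rewrite mulf_eq0 negb_or => /andP[nu0 nw0].
  rewrite size_mul //; move: nw0; rewrite -size_poly_gt0.
  by move: (size _) (size _) => m n; lia.
have u1t : u.1 * t.2 = 1.
  have -> : u.1 * t.2 = (u * t).2 by rewrite coord_mulE /= u2; ring.
  by rewrite -yE /coord_y /=; ring.
have u1C : size u.1 = 1%N.
  have : u.1 \is a GRing.unit by apply/unitrP; exists t.2; rewrite mulrC u1t.
  by rewrite poly_unitE => /andP[/eqP].
have c0 : u.1.[a] = 0.
  have : u.1.[a] + b * u.2.[a] = 0; last by rewrite u2 horner0 mulr0 addr0.
  have b6E : b6 = b ^+ 2 + b1 * a * b + b3 * b - (a ^+ 3 + b2 * a ^+ 2 + b4 * a).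
    by rewrite oc; ring.
  rewrite uE /coord_x /coord_y !coord_mulE /= /curve_cubic /curve_lin !hornerE /=.
  by rewrite b6E; ring.
have /size_poly1P [c c1 uC] : size u.1 == 1%N by rewrite u1C.
by move: c0; rewrite uC hornerC => c00; rewrite c00 eqxx in c1.
Qed.

(** If the classes agree, that of (- S) + T is trivial, so this sum is not an affine point.
    Associativity follows, both sides having the class of S, T and U together. *)
Lemma same_class_point S T : on_curve W S -> on_curve W T ->
  same_class W (point_divisor S) (point_divisor T) -> S = T.
Proof.
move=> oS oT cST; suff : (-' S) +' T = None by move/add_point_eq0; rewrite opp_pointK.
have oN := opp_on_curve oS.
have : same_class W [::] (point_divisor ((-' S) +' T)).
  rewrite -[point_divisor _]cats0.
  apply: same_class_trans (same_class_add [::] oN oT).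
  rewrite cats0; apply: same_class_trans (same_class_cat _ cST).
  apply: same_class_sym; have := same_class_add [::] oN oS.
  by rewrite !cats0 add_pointC // add_pointNr.
have := add_on_curve oN oT; case: (_ +' _) => // p op.
by move/(point_not_principal op).
Qed.

Lemma add_pointA S T U : on_curve W S -> on_curve W T -> on_curve W U ->
  S +' (T +' U) = (S +' T) +' U.
Proof.
move=> oS oT oU; have oST := add_on_curve oS oT; have oTU := add_on_curve oT oU.
apply: same_class_point; try exact: add_on_curve.
have c1 := same_class_add [::] oS oTU; have c2 := same_class_add [::] oST oU.
have c3 := same_class_cat (point_divisor S) (same_class_add [::] oT oU).
have c4 := same_class_add (point_divisor U) oS oT.
rewrite !cats0 in c1 c2 c3.
apply: same_class_trans c2; apply: same_class_trans c4.
apply: same_class_trans (same_class_sym c3).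
exact: same_class_sym.
Qed.

End PointGroup.

Section EllipticGroup.
Variables (F : fieldType) (W : weierstrass) (sm : smooth_curve F W).

(** The proof of smoothness is a parameter of the type so that the group structure, which depends on
    it, can be inferred from the type. *)
Definition elliptic (_ : smooth_curve F W) := {T : point F | on_curve W T}.

HB.instance Definition _ := Choice.on (elliptic sm).
HB.instance Definition _ := SubType.on (elliptic sm).

Implicit Types S T U : elliptic sm.

Definition ell_zero : elliptic sm := Sub (None : point F) isT.
Definition ell_opp T : elliptic sm := Sub (opp_point W (val T)) (opp_on_curve (valP T)).
Definition ell_add S T : elliptic sm :=
  Sub (add_point W (val S) (val T)) (add_on_curve (valP S) (valP T)).

Fact ell_addA : associative ell_add.
Proof. by move=> S T U; apply: val_inj; apply: (add_pointA sm); apply: valP. Qed.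

Fact ell_addC : commutative ell_add.
Proof. by move=> S T; apply: val_inj; apply: add_pointC; apply: valP. Qed.

Fact ell_add0 : left_id ell_zero ell_add.
Proof. by move=> T; apply: val_inj. Qed.

Fact ell_addN : left_inverse ell_zero ell_opp ell_add.
Proof.
move=> T; rewrite ell_addC; apply: val_inj; exact: add_pointNr.
Qed.

HB.instance Definition _ := GRing.isZmodule.Build (elliptic sm)
  ell_addA ell_addC ell_add0 ell_addN.

Lemma val_ellD S T : val (S + T) = add_point W (val S) (val T).
Proof. by []. Qed.

Lemma val_ellN T : val (- T) = opp_point W (val T).
Proof. by []. Qed.

Lemma val_ellMn T n : val (T *+ n) = mul_point W n (val T).
Proof. by elim: n => [|n IH]; rewrite ?mulr0n // mulrS val_ellD IH. Qed.

Lemma val_ell_lin_comb m n S T :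
  val (S *+ m + T *+ n) = lin_comb W m n (val S) (val T).
Proof. by rewrite val_ellD !val_ellMn. Qed.

End EllipticGroup.

(** * The curves E and E' in characteristic zero *)

Section MapPoint.
Variables (F F' : fieldType) (W : weierstrass) (f : {rmorphism F -> F'}).

Lemma on_curve_map T : on_curve W (map_point f T) = on_curve W T.
Proof.
case: T => [[x y]|] //=.
by rewrite -(fmorph_eq f) !(rmorph_int, rmorphXn, rmorphD, rmorphM).
Qed.

Lemma map_point_add S T :
  map_point f (add_point W S T) = add_point W (map_point f S) (map_point f T).
Proof.
case: S T => [[x1 y1]|] [[x2 y2]|] //=.
rewrite fmorph_eq -(rmorph_int f (a1 W)) -(rmorph_int f (a2 W)) -(rmorph_int f (a3 W)).
rewrite -(rmorph_int f (a4 W)) -!rmorphM -!rmorphD fmorph_eq0.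
case: ifP => //= _; case: (x1 == x2) => /=; congr (Some (_, _)).
all: by rewrite !(rmorph_nat, rmorphXn, fmorphV, rmorphB, rmorphN, rmorphD, rmorphM).
Qed.

Lemma map_point_mul n T : map_point f (mul_point W n T) = mul_point W n (map_point f T).
Proof. by elim: n => //= n IH; rewrite map_point_add IH. Qed.

Lemma map_point_inj : injective (map_point f).
Proof.
by move=> [[x y]|] [[x' y']|] //= -[] /fmorph_inj -> /fmorph_inj ->.
Qed.

End MapPoint.

Section Curves.
Variable F : fieldType.
Hypothesis char0 : [pchar F] =i pred0.

Lemma char0_natr n : (n.+1%:R : F) != 0.
Proof. by have /pcharf0P -> := char0. Qed.

Lemma on_curve_E (x y : F) :
  on_curve E (Some (x, y)) = (y ^+ 2 + x * y == x ^+ 3 + x ^+ 2 - 2 * x).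
Proof. by rewrite /= mul0r !addr0 mulrNz !mul1r mulNr. Qed.

Lemma on_curve_E' (x y : F) :
  on_curve E' (Some (x, y)) = (y ^+ 2 + x * y == x ^+ 3 + x ^+ 2 + 8 * x + 10).
Proof. by rewrite /= mul0r !addr0 !mul1r. Qed.

(** At a singular point x = - 2 y, which leaves a quadratic and a cubic condition on x. The cubic
    factors, and the integers 4 and 612 = 2^2 * 3^2 * 17 are combinations of the quadratic with each
    of the factors; for E' they are 306 and 1224. *)
Lemma smooth_E : smooth_curve F E.
Proof.
move=> x y; rewrite on_curve_E => /eqP oc /=; rewrite !mul1r addr0 => h1 h2.
have xE : x = - (2 * y) by rewrite -[RHS]add0r -h1; ring.
have q0 : 6 * x ^+ 2 + 5 * x - 4 = 0.
  transitivity (2 * (3 * x ^+ 2 + 2 * 1%:~R * x + (-2)%:~R - y) + (2 * y + x)).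
    by ring.
  by rewrite h1 h2 mulr0 addr0.
have /eqP : x * (4 * x ^+ 2 + 5 * x - 8) = 0.
  by rewrite -(subrr (4 * (y ^+ 2 + x * y))) {1}oc xE; ring.
rewrite mulf_eq0 => /orP[] /eqP p0.
  have := char0_natr 3; rewrite (_ : 4%:R = - (6 * x ^+ 2 + 5 * x - 4)).
    by rewrite q0 oppr0 eqxx.
  by rewrite p0; ring.
have := char0_natr 611; rewrite (_ : 612%:R = 25 * ((6 * x ^+ 2 + 5 * x - 4) -
    (4 * x ^+ 2 + 5 * x - 8)) - 2 * ((5 * x + 16) * (3 * (4 * x ^+ 2 + 5 * x - 8)
    - 2 * (6 * x ^+ 2 + 5 * x - 4)))); last by ring.
by rewrite p0 q0 !(mulr0, subr0) eqxx.
Qed.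

Lemma smooth_E' : smooth_curve F E'.
Proof.
move=> x y; rewrite on_curve_E' => /eqP oc /=; rewrite !mul1r addr0 => h1 h2.
have xE : x = - (2 * y) by rewrite -[RHS]add0r -h1; ring.
have q0 : 6 * x ^+ 2 + 5 * x + 16 = 0.
  transitivity (2 * (3 * x ^+ 2 + 2 * 1%:~R * x + 8%:~R - y) + (2 * y + x)).
    by ring.
  by rewrite h1 h2 mulr0 addr0.
have /eqP : (4 * x + 5) * (x ^+ 2 + 8) = 0.
  by rewrite -(subrr (4 * (y ^+ 2 + x * y))) {1}oc xE; ring.
rewrite mulf_eq0 => /orP[] /eqP p0.
  have := char0_natr 305; rewrite (_ : 306%:R = 16 * (6 * x ^+ 2 + 5 * x + 16)
      - (4 * x + 5) * (24 * x - 10)); last by ring.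
  by rewrite p0 q0 mul0r mulr0 subr0 eqxx.
have := char0_natr 1223; rewrite (_ : 1224%:R = 25 * (x ^+ 2 + 8)
    - (5 * x + 32) * ((6 * x ^+ 2 + 5 * x + 16) - 6 * (x ^+ 2 + 8))); last by ring.
by rewrite p0 q0 !(mulr0, subr0) eqxx.
Qed.

End Curves.

Section ShortForm.
Variable F : fieldType.
Hypothesis char0 : [pchar F] =i pred0.

Let two_neq0 : 2 != 0 :> F := char0_natr char0 1.
Let four_neq0 : 4 != 0 :> F := char0_natr char0 3.
Let eight_neq0 : 8 != 0 :> F := char0_natr char0 7.

Let numE := (two_neq0, four_neq0, eight_neq0).

(* The point of E given by X, Y with Y^2 = X^3 + 5 X^2 - 32 X. *)
Definition short_point (X Y : F) : point F := Some (X / 4, (Y - X) / 8).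

Lemma short_pointE (x y : F) : Some (x, y) = short_point (4 * x) (8 * y + 4 * x).
Proof. by congr (Some (_, _)); field; rewrite ?numE. Qed.

Lemma short_point_inj X Y X' Y' :
  short_point X Y = short_point X' Y' -> X = X' /\ Y = Y'.
Proof.
case=> /(mulIf (invr_neq0 four_neq0)) -> /(mulIf (invr_neq0 eight_neq0)).
by move/addIr ->.
Qed.

Lemma short_on_curve X Y :
  on_curve E (short_point X Y) = (Y ^+ 2 == X ^+ 3 + 5 * X ^+ 2 - 32 * X).
Proof.
rewrite on_curve_E -subr_eq0 -[RHS]subr_eq0.
have -> : Y ^+ 2 - (X ^+ 3 + 5 * X ^+ 2 - 32 * X) =
  64 * (((Y - X) / 8) ^+ 2 + X / 4 * ((Y - X) / 8) -
  ((X / 4) ^+ 3 + (X / 4) ^+ 2 - 2 * (X / 4))).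
  by field; rewrite ?numE.
by rewrite mulf_eq0 (negPf (char0_natr char0 63)).
Qed.

Lemma short_opp X Y : opp_point E (short_point X Y) = short_point X (- Y).
Proof.
rewrite /= !mul1r subr0; congr (Some (_, _)).
by field; rewrite ?numE.
Qed.

Lemma short_add X1 Y1 X2 Y2 (l := (Y2 - Y1) / (X2 - X1))
    (X3 := l ^+ 2 - 5 - X1 - X2) : X1 != X2 ->
  add_point E (short_point X1 Y1) (short_point X2 Y2) =
  short_point X3 (l * (X1 - X3) - Y1).
Proof.
move=> ne; rewrite /= (inj_eq (mulIf (invr_neq0 four_neq0))) (negPf ne) /=.
rewrite !mul1r subr0.
have d0 : X2 - X1 != 0 by rewrite subr_eq0 eq_sym.
have sl : ((Y2 - X2) / 8 - (Y1 - X1) / 8) / (X2 / 4 - X1 / 4) = (l - 1) / 2.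
  by rewrite /l; field; rewrite ?(d0, numE).
rewrite sl /X3; move: l {sl X3} => l.
by congr (Some (_, _)); field; rewrite ?numE.
Qed.

Lemma short_dbl X Y (l := (3 * X ^+ 2 + 10 * X - 32) / (2 * Y))
    (X3 := l ^+ 2 - 5 - 2 * X) : Y != 0 ->
  add_point E (short_point X Y) (short_point X Y) = short_point X3 (l * (X - X3) - Y).
Proof.
move=> Y0; rewrite /= eqxx /= !mul1r !addr0.
have sE : (Y - X) / 8 + (Y - X) / 8 + X / 4 = Y / 4.
  by field; rewrite ?numE.
rewrite sE mulf_eq0 invr_eq0 (negPf Y0) (negPf four_neq0) /= subr0.
have sl : (3 * (X / 4) ^+ 2 + 2 * 1%:~R * (X / 4) + (-2)%:~R - (Y - X) / 8) /
   (2 * ((Y - X) / 8) + X / 4) = (l - 1) / 2.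
  rewrite /l; field; rewrite ?(Y0, numE) /= (_ : _ + _ = 8 * Y); last by ring.
  by rewrite mulf_neq0.
rewrite sl /X3; move: l {sl X3} => l.
by congr (Some (_, _)); field; rewrite ?numE.
Qed.

Lemma short_dbl0 X : add_point E (short_point X 0) (short_point X 0) = None.
Proof.
apply: add_pointN; rewrite eqxx /= mul1r addr0; apply/eqP.
by field; rewrite ?numE.
Qed.
End ShortForm.

(** * Halving points *)

Section HalfCoordinates.
Variable F : fieldType.
Hypothesis char0 : [pchar F] =i pred0.

Let two_neq0 : 2 != 0 :> F := char0_natr char0 1.

(* Write e1, 0, e3 for the roots of X (X^2 + 5 X - 32); the r_i are square roots of
   X(2 R) - e_i, normalized so that X(R) - e_i = (r_i + r_j) (r_i + r_k). *)
Definition half_point (r1 r2 r3 : F) : point F :=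
  short_point ((r2 + r1) * (r2 + r3)) ((r1 + r2) * (r1 + r3) * (r2 + r3)).

(** With 0 as the middle root, e1 = r2^2 - r1^2 and e3 = r2^2 - r3^2, so these are Vieta's relations
    for x^2 + 5 x - 32. Which of its roots is e1 is left open. *)
Definition half_coord (r1 r2 r3 : F) : Prop :=
  (r2 ^+ 2 - r1 ^+ 2) + (r2 ^+ 2 - r3 ^+ 2) = - 5 /\
  (r2 ^+ 2 - r1 ^+ 2) * (r2 ^+ 2 - r3 ^+ 2) = - 32.

Lemma half_coord_swap r1 r2 r3 : half_coord r1 r2 r3 -> half_coord r3 r2 r1.
Proof. by case=> h1 h2; split; [rewrite addrC|rewrite mulrC]. Qed.

Lemma half_point_swap r1 r2 r3 : half_point r1 r2 r3 = half_point r3 r2 r1.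
Proof. by rewrite /half_point; congr short_point; ring. Qed.

Lemma half_coord_roots r1 r2 r3 : half_coord r1 r2 r3 ->
  [/\ r2 ^+ 2 - r1 ^+ 2 != 0, r2 ^+ 2 - r3 ^+ 2 != 0 & r1 ^+ 2 != r3 ^+ 2].
Proof.
case=> h1 h2.
have : (r2 ^+ 2 - r1 ^+ 2) * (r2 ^+ 2 - r3 ^+ 2) != 0.
  by rewrite h2 oppr_eq0 (char0_natr char0 31).
rewrite mulf_eq0 negb_or => /andP[e1 e3]; split=> //.
(* 153 = 5^2 + 4 * 32 is the discriminant (e1 - e3)^2. *)
apply/eqP => e13; move: (char0_natr char0 152).
rewrite (_ : 153%:R = (5 + ((r2 ^+ 2 - r1 ^+ 2) + (r2 ^+ 2 - r3 ^+ 2))) *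
  (5 - ((r2 ^+ 2 - r1 ^+ 2) + (r2 ^+ 2 - r3 ^+ 2))) + (r1 ^+ 2 - r3 ^+ 2) ^+ 2
  + 4 * ((r2 ^+ 2 - r1 ^+ 2) * (r2 ^+ 2 - r3 ^+ 2) + 32)); last by ring.
by rewrite h1 h2 e13 subrr addrN mul0r expr0n addNr mulr0 !addr0 eqxx.
Qed.

Lemma half_coord_sums r1 r2 r3 : half_coord r1 r2 r3 ->
  [/\ r1 + r2 != 0, r1 + r3 != 0 & r2 + r3 != 0].
Proof.
case/half_coord_roots; rewrite -[_ == r3 ^+ 2]subr_eq0 !subr_sqr !mulf_eq0 !negb_or.
by rewrite (addrC r1 r2) => /andP[_ ->] /andP[_ ->] /andP[_ ->].
Qed.

Lemma half_on_curve r1 r2 r3 : half_coord r1 r2 r3 -> on_curve E (half_point r1 r2 r3).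
Proof.
case=> h1 h2; rewrite short_on_curve //.
have -> : 5 = - ((r2 ^+ 2 - r1 ^+ 2) + (r2 ^+ 2 - r3 ^+ 2)) by rewrite h1 opprK.
have -> : 32 = - ((r2 ^+ 2 - r1 ^+ 2) * (r2 ^+ 2 - r3 ^+ 2)) by rewrite h2 opprK.
by apply/eqP; ring.
Qed.

Lemma half_opp r1 r2 r3 :
  opp_point E (half_point r1 r2 r3) = half_point (- r1) (- r2) (- r3).
Proof. by rewrite short_opp //; congr short_point; ring. Qed.

(** Once e1 is named, the pairwise sums of the r_i are the quotients of Y by X - e1, X and X - e3,
    and the sums determine the r_i because 2 is invertible. *)
Lemma half_point_inj r1 r2 r3 s1 s2 s3 :
  half_coord r1 r2 r3 -> half_coord s1 s2 s3 ->
  r2 ^+ 2 - r1 ^+ 2 = s2 ^+ 2 - s1 ^+ 2 ->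
  half_point r1 r2 r3 = half_point s1 s2 s3 -> [/\ r1 = s1, r2 = s2 & r3 = s3].
Proof.
move=> hr hs e1 /(short_point_inj char0) [eX eY].
have [n12 n13 n23] := half_coord_sums hr; have [m12 m13 m23] := half_coord_sums hs.
case: hr hs => [h1 _] [h1' _].
have e3 : r2 ^+ 2 - r3 ^+ 2 = s2 ^+ 2 - s3 ^+ 2.
  by apply: (addrI (r2 ^+ 2 - r1 ^+ 2)); rewrite h1 e1 h1'.
have a : r1 + r3 = s1 + s3.
  apply: (mulfI (mulf_neq0 n12 n23)); rewrite mulrAC eY.
  by rewrite (addrC r1) eX; ring.
have b : r2 + r3 = s2 + s3.
  have X1 : (r1 + r2) * (r1 + r3) = (s1 + s2) * (s1 + s3).
    transitivity ((r2 + r1) * (r2 + r3) - (r2 ^+ 2 - r1 ^+ 2)); first by ring.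
    by rewrite eX e1; ring.
  by apply: (mulfI (mulf_neq0 n12 n13)); rewrite eY X1.
have c : r1 + r2 = s1 + s2.
  have X3 : (r1 + r3) * (r2 + r3) = (s1 + s3) * (s2 + s3).
    transitivity ((r2 + r1) * (r2 + r3) - (r2 ^+ 2 - r3 ^+ 2)); first by ring.
    by rewrite eX e3; ring.
  by apply: (mulIf (mulf_neq0 n13 n23)); rewrite {2}X3 !mulrA eY.
split; apply: (mulfI two_neq0).
- transitivity ((r1 + r3) + (r1 + r2) - (r2 + r3)); first by ring.
  by rewrite a b c; ring.
- transitivity ((r2 + r3) + (r1 + r2) - (r1 + r3)); first by ring.
  by rewrite a b c; ring.
- transitivity ((r1 + r3) + (r2 + r3) - (r1 + r2)); first by ring.
  by rewrite a b c; ring.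
Qed.

Lemma half_point_surj e1 e3 X Y : e1 + e3 = - 5 -> e1 * e3 = - 32 ->
  on_curve E (short_point X Y) -> Y != 0 ->
  exists r1 r2 r3, [/\ half_coord r1 r2 r3, e1 = r2 ^+ 2 - r1 ^+ 2 &
    short_point X Y = half_point r1 r2 r3].
Proof.
move=> h1 h2; rewrite short_on_curve // => /eqP oc Y0.
have {}oc : Y ^+ 2 = X * (X - e1) * (X - e3).
  have E5 : 5 = - (e1 + e3) by rewrite h1 opprK.
  have E32 : 32 = - (e1 * e3) by rewrite h2 opprK.
  by rewrite oc E5 E32; ring.
have : X * (X - e1) * (X - e3) != 0 by rewrite -oc expf_neq0.
rewrite !mulf_eq0 !negb_or => /andP[/andP[X0 X1] X3].
pose a := Y / (X - e1); pose b := Y / X; pose c := Y / (X - e3).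
pose r1 := (b + c - a) / 2; pose r2 := (a + c - b) / 2; pose r3 := (a + b - c) / 2.
have r12 : r1 + r2 = c by rewrite /r1 /r2; field.
have r13 : r1 + r3 = b by rewrite /r1 /r3; field.
have r23 : r2 + r3 = a by rewrite /r2 /r3; field.
have E1 : e1 = r2 ^+ 2 - r1 ^+ 2.
  rewrite subr_sqr (addrC r2 r1) r12 (_ : r2 - r1 = a - b); last by rewrite /r1 /r2; field.
  transitivity (Y ^+ 2 * e1 / (X * (X - e1) * (X - e3))); first by rewrite -oc; field.
  by rewrite /a /b /c; field; rewrite X0 X1 X3.
have E3 : e3 = r2 ^+ 2 - r3 ^+ 2.
  rewrite subr_sqr r23 (_ : r2 - r3 = c - b); last by rewrite /r3 /r2; field.
  transitivity (Y ^+ 2 * e3 / (X * (X - e1) * (X - e3))); first by rewrite -oc; field.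
  by rewrite /a /b /c; field; rewrite X0 X1 X3.
exists r1, r2, r3; split=> //; first by rewrite /half_coord -E1 -E3.
rewrite /half_point (addrC r2 r1) r12 r13 r23; congr short_point.
  transitivity (X * (Y ^+ 2) / (X * (X - e1) * (X - e3))); first by rewrite -oc; field.
  by rewrite /a /b /c; field; rewrite X0 X1 X3.
transitivity (Y * (Y ^+ 2) / (X * (X - e1) * (X - e3))); first by rewrite -oc; field.
by rewrite /a /b /c; field; rewrite X0 X1 X3.
Qed.

(** The tangent at the point has slope r1 + r2 + r3. *)
Lemma half_dbl r1 r2 r3 : half_coord r1 r2 r3 ->
  add_point E (half_point r1 r2 r3) (half_point r1 r2 r3) =
  short_point (r2 ^+ 2) (r1 * r2 * r3).
Proof.
move=> hr; have [n12 n13 n23] := half_coord_sums hr; case: hr => h1 h2.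
rewrite short_dbl ?mulf_neq0 //.
have E5 : 5 = - ((r2 ^+ 2 - r1 ^+ 2) + (r2 ^+ 2 - r3 ^+ 2)) by rewrite h1 opprK.
have E32 : 32 = - ((r2 ^+ 2 - r1 ^+ 2) * (r2 ^+ 2 - r3 ^+ 2)) by rewrite h2 opprK.
set X := (r2 + r1) * _; set Y := _ * _ * _.
have lE : (3 * X ^+ 2 + 10 * X - 32) / (2 * Y) = r1 + r2 + r3.
  have E10 : 10 = 2 * 5 :> F by ring.
  rewrite E32 E10 E5.
  by rewrite /X /Y; field; rewrite n12 n13 n23 two_neq0.
rewrite lE E5 /X /Y; congr short_point; ring.
Qed.

(** Translation by a point of order two keeps the double, hence each r_i^2 and the product r1 r2 r3:
    two signs change, and the coordinate that is kept belongs to the root translated by. *)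
Lemma half_add_T1 r1 r2 r3 : half_coord r1 r2 r3 ->
  add_point E (half_point r1 r2 r3) (short_point (r2 ^+ 2 - r1 ^+ 2) 0) =
  half_point r1 (- r2) (- r3).
Proof.
move=> hr; have [n12 n13 n23] := half_coord_sums hr; case: hr => h1 h2.
have E5 : 5 = - ((r2 ^+ 2 - r1 ^+ 2) + (r2 ^+ 2 - r3 ^+ 2)) by rewrite h1 opprK.
have d : (r2 ^+ 2 - r1 ^+ 2) - (r2 + r1) * (r2 + r3) = - ((r1 + r2) * (r1 + r3)) by ring.
rewrite short_add //; last by rewrite eq_sym -subr_eq0 d oppr_eq0 mulf_neq0.
rewrite d E5 (_ : _ / - _ = r2 + r3); last by field; rewrite oppr_eq0 mulf_neq0.
by congr short_point; ring.
Qed.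

Lemma half_add_T2 r1 r2 r3 : half_coord r1 r2 r3 ->
  add_point E (half_point r1 r2 r3) (short_point 0 0) = half_point (- r1) r2 (- r3).
Proof.
move=> hr; have [n12 n13 n23] := half_coord_sums hr; case: hr => h1 h2.
have E5 : 5 = - ((r2 ^+ 2 - r1 ^+ 2) + (r2 ^+ 2 - r3 ^+ 2)) by rewrite h1 opprK.
rewrite short_add //; last by rewrite mulf_neq0 // addrC.
rewrite E5 (_ : _ / _ = r1 + r3).
  by congr short_point; ring.
by field; rewrite oppr_eq0 mulf_neq0 // addrC.
Qed.

(** The classical addition theorem for the square roots of wp(u) - e_i, taken at u = 2 R and u = 2
    S; [d] is X(2 S) - X(2 R). *)
Lemma half_add r1 r2 r3 s1 s2 s3 (d := s1 ^+ 2 - r1 ^+ 2) :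
  half_coord r1 r2 r3 -> half_coord s1 s2 s3 ->
  r2 ^+ 2 - r1 ^+ 2 = s2 ^+ 2 - s1 ^+ 2 -> d != 0 ->
  add_point E (half_point r1 r2 r3) (half_point s1 s2 s3) =
  half_point ((r1 * s2 * s3 - s1 * r2 * r3) / d) ((r2 * s1 * s3 - s2 * r1 * r3) / d)
    ((r3 * s1 * s2 - s3 * r1 * r2) / d).
Proof.
move=> hr hs e1 d0.
have [n12 n13 n23] := half_coord_sums hr; have [m12 m13 m23] := half_coord_sums hs.
case: hr hs => [h1 _] [h1' _].
have E5 : 5 = - ((r2 ^+ 2 - r1 ^+ 2) + (r2 ^+ 2 - r3 ^+ 2)) by rewrite h1 opprK.
have e3 : r2 ^+ 2 - r3 ^+ 2 = s2 ^+ 2 - s3 ^+ 2.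
  by apply: (addrI (r2 ^+ 2 - r1 ^+ 2)); rewrite h1 e1 h1'.
have : (r1 - s1) * (r1 + s1) != 0 by rewrite -subr_sqr -opprB oppr_eq0.
rewrite mulf_eq0 negb_or => /andP[m0 n0].
(* r_i^2 - s_i^2 has the same value m n for all i, so the six coordinates are rational functions of
   m, n, p, q and the claim becomes a rational identity. *)
pose m := r1 - s1; pose n := r1 + s1; pose p := r2 - s2; pose q := r3 - s3.
have p2 : p * (r2 + s2) = m * n.
  rewrite /p /m /n -!subr_sqr; apply/eqP; rewrite -subr_eq0.
  rewrite (_ : _ - _ = (r2 ^+ 2 - r1 ^+ 2) - (s2 ^+ 2 - s1 ^+ 2)); last by ring.
  by rewrite e1 subrr.
have q2 : q * (r3 + s3) = m * n.
  rewrite -p2 /q /p -!subr_sqr; apply/eqP; rewrite -subr_eq0.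
  rewrite (_ : _ - _ = (s2 ^+ 2 - s3 ^+ 2) - (r2 ^+ 2 - r3 ^+ 2)); last by ring.
  by rewrite e3 subrr.
have : p * (r2 + s2) != 0 by rewrite p2 mulf_neq0.
rewrite mulf_eq0 negb_or => /andP[p0 _].
have : q * (r3 + s3) != 0 by rewrite q2 mulf_neq0.
rewrite mulf_eq0 negb_or => /andP[q0 _].
have p2' : r2 + s2 = m * n / p by rewrite -p2 mulrAC mulfV // mul1r.
have q2' : r3 + s3 = m * n / q by rewrite -q2 mulrAC mulfV // mul1r.
have mp0 : m + p != 0.
  apply/eqP => mp; have e : r1 + r2 = s1 + s2.
    by apply/eqP; rewrite -subr_eq0 -mp /m /p; apply/eqP; ring.
  move: m0; rewrite -(inj_eq (mulIf two_neq0)) mul0r.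
  have e' : r2 - r1 = s2 - s1.
    by apply: (mulIf n12); rewrite {2}e [r1 + r2]addrC [s1 + s2]addrC -!subr_sqr.
  by rewrite (_ : _ * 2 = (r1 + r2) - (s1 + s2) - ((r2 - r1) - (s2 - s1)));
    [rewrite e e' !subrr eqxx|ring].
have mq0 : m + q != 0.
  apply/eqP => mq; have e : r1 + r3 = s1 + s3.
    by apply/eqP; rewrite -subr_eq0 -mq /m /q; apply/eqP; ring.
  move: m0; rewrite -(inj_eq (mulIf two_neq0)) mul0r.
  have e' : r1 - r3 = s1 - s3.
    apply: (mulIf n13); rewrite {2}e -!subr_sqr.
    transitivity ((r2 ^+ 2 - r3 ^+ 2) - (r2 ^+ 2 - r1 ^+ 2)); first by ring.
    by rewrite e1 e3; ring.
  by rewrite (_ : _ * 2 = (r1 + r3) - (s1 + s3) + ((r1 - r3) - (s1 - s3)));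
    [rewrite e e' !subrr addr0 eqxx|ring].
have pq0 : p + q != 0.
  apply/eqP => pq; have e : r2 + r3 = s2 + s3.
    by apply/eqP; rewrite -subr_eq0 -pq /p /q; apply/eqP; ring.
  move: p0; rewrite -(inj_eq (mulIf two_neq0)) mul0r.
  have e' : r2 - r3 = s2 - s3.
    by apply: (mulIf n23); rewrite {2}e -!subr_sqr.
  by rewrite (_ : _ * 2 = (r2 + r3) - (s2 + s3) + ((r2 - r3) - (s2 - s3)));
    [rewrite e e' !subrr addr0 eqxx|rewrite /p; ring].
have r1E : r1 = (n + m) / 2 by rewrite /n /m; field.
have s1E : s1 = (n - m) / 2 by rewrite /n /m; field.
have r2E : r2 = (m * n / p + p) / 2 by rewrite -p2' /p; field.
have s2E : s2 = (m * n / p - p) / 2 by rewrite -p2' /p; field.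
have r3E : r3 = (m * n / q + q) / 2 by rewrite -q2' /q; field.
have s3E : s3 = (m * n / q - q) / 2 by rewrite -q2' /q; field.
have dX : (s2 + s1) * (s2 + s3) - (r2 + r1) * (r2 + r3) =
    - (n * (p + q) * (m + p) * (m + q) / (2 * p * q)).
  by rewrite r1E s1E r2E s2E r3E s3E; field; rewrite p0 q0 two_neq0.
rewrite short_add //; last first.
  rewrite eq_sym -subr_eq0 dX oppr_eq0 !mulf_neq0 ?invr_eq0 ?mulf_neq0 //.
rewrite dX.
have dE : d = - (m * n) by rewrite /d /m /n; ring.
have D0 : - (n * (p + q) * (m + p) * (m + q)) != 0 by rewrite oppr_eq0 !mulf_neq0.
have d0' : - (m * n) != 0 by rewrite -dE.
rewrite E5 dE /half_point; congr short_point.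
  rewrite r1E s1E r2E s2E r3E s3E.
  by field; rewrite D0 d0' p0 q0 two_neq0.
rewrite r1E s1E r2E s2E r3E s3E.
by field; rewrite D0 d0' p0 q0 two_neq0.
Qed.

End HalfCoordinates.

(** * Pairs of points of order eight *)

Section Octal.
Variable F : fieldType.
Hypothesis char0 : [pchar F] =i pred0.

Let two_neq0 : 2 != 0 :> F := char0_natr char0 1.

Definition oct_e1 (rho v w : F) := rho ^+ 2 * w ^+ 2 / (2 * v ^+ 2).
Definition oct_e3 (rho v w z : F) := rho ^+ 2 * z ^+ 4 / (2 * v ^+ 2 * w ^+ 2).
Definition oct_kappa (rho v z : F) := - (rho ^+ 2 * z ^+ 2 / (2 * v ^+ 2)).

(** v, w, z determine the ratio e1 / e3 = (w / z)^4, thus the curve up to scaling, and rho is the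
    scale; the last two fields say that the curve is E. *)
Record oct_param (i t rho v w z : F) : Prop := OctParam {
  oct_i2 : i ^+ 2 = - 1;
  oct_t2 : t ^+ 2 = 2;
  oct_w2 : w ^+ 2 = 1 + v ^+ 4;
  oct_z2 : z ^+ 2 = 1 - v ^+ 4;
  oct_rho0 : rho != 0;
  oct_v0 : v != 0;
  oct_w0 : w != 0;
  oct_z0 : z != 0;
  oct_sum : oct_e1 rho v w + oct_e3 rho v w z = - 5;
  oct_prod : oct_e1 rho v w * oct_e3 rho v w z = - 32 }.

Definition oct_R (t rho v w : F) : point F :=
  half_point rho (rho * (1 + v ^+ 2) / (v * t)) (rho * (1 + v ^+ 2) / w).
Definition oct_S (i t rho v w z : F) : point F :=
  half_point (rho * i / v) (rho * i * z / (v * t)) (rho * i * z / (v * w)).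

(* Points R, S with 4 R = (e, 0) and 4 S = (0, 0); they determine a square root i
   of -1 and a square root t of 2, i.e. a primitive eighth root of unity
   (1 + i) / t, which plays the role of the Weil pairing of R and S.  If r and s are
   the half coordinates of R and S then v = r3 s2 / (r2 s3), w^2 = 1 + v^4 and
   z^2 = 1 - v^4; kappa = s2^2 is the X-coordinate of 2 S. *)
Variant octal (R S : point F) (i t kappa e : F) : Prop :=
  Octal rho v w z of oct_param i t rho v w z & R = oct_R t rho v w
    & S = oct_S i t rho v w z & kappa = oct_kappa rho v z & e = oct_e1 rho v w.

Section Param.
Variables i t rho v w z : F.
Hypothesis H : oct_param i t rho v w z.

Let i2 := oct_i2 H.
Let t2 := oct_t2 H.
Let w2 := oct_w2 H.
Let z2 := oct_z2 H.
Let rho0 := oct_rho0 H.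
Let v0 := oct_v0 H.
Let w0 := oct_w0 H.
Let z0 := oct_z0 H.

Lemma oct_i0 : i != 0.
Proof. by rewrite -sqrf_eq0 i2 oppr_eq0 oner_eq0. Qed.

Lemma oct_t0 : t != 0.
Proof. by rewrite -sqrf_eq0 t2. Qed.

Lemma oct_z2M : z ^+ 2 = (1 - v ^+ 2) * (1 + v ^+ 2).
Proof. by rewrite z2; ring. Qed.

Lemma oct_v2_neq0 : 1 + v ^+ 2 != 0.
Proof.
by have := z0; rewrite -sqrf_eq0 oct_z2M mulf_eq0 negb_or => /andP[].
Qed.

Let i0 := oct_i0.
Let t0 := oct_t0.

Lemma oct_r2 : (rho * (1 + v ^+ 2) / (v * t)) ^+ 2 =
  rho ^+ 2 * (1 + v ^+ 2) ^+ 2 / (2 * v ^+ 2).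
Proof. by rewrite expr_div_n !exprMn t2; field; rewrite v0 two_neq0. Qed.

Lemma oct_r3 : (rho * (1 + v ^+ 2) / w) ^+ 2 = rho ^+ 2 * (1 + v ^+ 2) ^+ 2 / w ^+ 2.
Proof. by rewrite expr_div_n !exprMn. Qed.

Lemma oct_r_e1 : (rho * (1 + v ^+ 2) / (v * t)) ^+ 2 - rho ^+ 2 = oct_e1 rho v w.
Proof. by rewrite oct_r2 /oct_e1 w2; field; rewrite v0 two_neq0. Qed.

Lemma oct_r_e3 : (rho * (1 + v ^+ 2) / (v * t)) ^+ 2 - (rho * (1 + v ^+ 2) / w) ^+ 2
  = oct_e3 rho v w z.
Proof.
have w40 : 1 + v ^+ 4 != 0 by rewrite -w2 expf_neq0.
rewrite oct_r2 oct_r3 /oct_e3 (_ : z ^+ 4 = (z ^+ 2) ^+ 2); last by ring.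
by rewrite z2 w2; field; rewrite v0 two_neq0 w40.
Qed.

Lemma oct_half_R : half_coord rho (rho * (1 + v ^+ 2) / (v * t)) (rho * (1 + v ^+ 2) / w).
Proof. by split; rewrite oct_r_e1 oct_r_e3; [exact: oct_sum H|exact: oct_prod H]. Qed.

Lemma oct_s1 : (rho * i / v) ^+ 2 = - (rho ^+ 2 / v ^+ 2).
Proof. by rewrite expr_div_n !exprMn i2; field. Qed.

Lemma oct_s2 : (rho * i * z / (v * t)) ^+ 2 = oct_kappa rho v z.
Proof.
by rewrite /oct_kappa expr_div_n !exprMn i2 t2; field; rewrite v0 two_neq0.
Qed.

Lemma oct_s3 : (rho * i * z / (v * w)) ^+ 2 = - (rho ^+ 2 * z ^+ 2 / (v ^+ 2 * w ^+ 2)).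
Proof. by rewrite expr_div_n !exprMn i2; field; rewrite v0 w0. Qed.

Lemma oct_s_e1 : (rho * i * z / (v * t)) ^+ 2 - (rho * i / v) ^+ 2 = oct_e1 rho v w.
Proof. by rewrite oct_s2 oct_s1 /oct_kappa /oct_e1 w2 z2; field; rewrite v0 two_neq0. Qed.

Lemma oct_s_e3 : (rho * i * z / (v * t)) ^+ 2 - (rho * i * z / (v * w)) ^+ 2
  = oct_e3 rho v w z.
Proof.
have w40 : 1 + v ^+ 4 != 0 by rewrite -w2 expf_neq0.
rewrite oct_s2 oct_s3 /oct_kappa /oct_e3 (_ : z ^+ 4 = (z ^+ 2) ^+ 2); last by ring.
by rewrite z2 w2; field; rewrite v0 two_neq0 w40.
Qed.

Lemma oct_half_S :
  half_coord (rho * i / v) (rho * i * z / (v * t)) (rho * i * z / (v * w)).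
Proof. by split; rewrite oct_s_e1 oct_s_e3; [exact: oct_sum H|exact: oct_prod H]. Qed.

Lemma oct_2R_e1 : (rho * w / (v * t)) ^+ 2 - 0 ^+ 2 = oct_e1 rho v w.
Proof. by rewrite /oct_e1 expr_div_n !exprMn t2; field; rewrite v0 two_neq0. Qed.

(** The first half coordinate of 2 R is a square root of X(4 R) - e1 = 0; for 2 S it is the second
    one that vanishes, as 4 S = (0, 0). *)
Lemma oct_half_2R : half_coord 0 (rho * w / (v * t)) (rho * v * t / w).
Proof.
have e3 : (rho * w / (v * t)) ^+ 2 - (rho * v * t / w) ^+ 2 = oct_e3 rho v w z.
  have w40 : 1 + v ^+ 4 != 0 by rewrite -w2 expf_neq0.
  rewrite !expr_div_n !exprMn t2 /oct_e3 (_ : z ^+ 4 = (z ^+ 2) ^+ 2); last by ring.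
  by rewrite z2 w2; field; rewrite v0 two_neq0 w40.
by split; rewrite oct_2R_e1 e3; [exact: oct_sum H|exact: oct_prod H].
Qed.

Lemma oct_dbl_R : add_point E (oct_R t rho v w) (oct_R t rho v w) =
  half_point 0 (rho * w / (v * t)) (rho * v * t / w).
Proof.
rewrite /oct_R half_dbl //; last exact: oct_half_R.
have w40 : 1 + v ^+ 4 != 0 by rewrite -w2 expf_neq0.
rewrite /half_point !add0r oct_r2; congr short_point.
  transitivity (rho ^+ 2 * (w ^+ 2 / (v ^+ 2 * t ^+ 2) + 1)).
    by rewrite w2 t2; field; rewrite v0 two_neq0.
  by field; rewrite v0 t0 w0.
transitivity (rho ^+ 3 * (w ^+ 2 + v ^+ 2 * t ^+ 2) / (v * t * w)).
  by rewrite w2 t2; field; rewrite v0 t0 w0.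
by field; rewrite v0 t0 w0.
Qed.

Lemma oct_4R : add_point E (half_point 0 (rho * w / (v * t)) (rho * v * t / w))
  (half_point 0 (rho * w / (v * t)) (rho * v * t / w)) = short_point (oct_e1 rho v w) 0.
Proof.
rewrite half_dbl // ?mul0r; last exact: oct_half_2R.
congr short_point; rewrite /oct_e1 expr_div_n !exprMn t2; field.
by rewrite v0 two_neq0.
Qed.

Lemma oct_half_2S : half_coord (rho * i * w / (v * t)) 0 (rho * i * z ^+ 2 / (v * t * w)).
Proof.
have e1 : 0 ^+ 2 - (rho * i * w / (v * t)) ^+ 2 = oct_e1 rho v w.
  by rewrite /oct_e1 expr_div_n !exprMn t2 i2; field; rewrite v0 two_neq0.
have e3 : 0 ^+ 2 - (rho * i * z ^+ 2 / (v * t * w)) ^+ 2 = oct_e3 rho v w z.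
  by rewrite !expr_div_n !exprMn t2 i2 /oct_e3; field; rewrite v0 two_neq0 w0.
by split; rewrite e1 e3; [exact: oct_sum H|exact: oct_prod H].
Qed.

Lemma oct_dbl_S : add_point E (oct_S i t rho v w z) (oct_S i t rho v w z) =
  half_point (rho * i * w / (v * t)) 0 (rho * i * z ^+ 2 / (v * t * w)).
Proof.
rewrite /oct_S half_dbl //; last exact: oct_half_S.
rewrite /half_point !add0r !addr0; congr short_point.
  by field; rewrite v0 t0 w0.
transitivity (rho ^+ 3 * i ^+ 3 * (1 + v ^+ 4 + (1 - v ^+ 4)) * z ^+ 2 /
  (v ^+ 3 * t ^+ 3 * w)).
  rewrite (_ : t ^+ 3 = t * t ^+ 2); last by ring.
  by rewrite t2; field; rewrite v0 t0 w0 two_neq0.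
by rewrite -{1}w2 -{1}z2; field; rewrite v0 t0 w0.
Qed.

Lemma oct_4S : add_point E (half_point (rho * i * w / (v * t)) 0 (rho * i * z ^+ 2 / (v * t * w)))
  (half_point (rho * i * w / (v * t)) 0 (rho * i * z ^+ 2 / (v * t * w))) = short_point 0 0.
Proof.
by rewrite half_dbl // ?expr0n ?mulr0 ?mul0r //; exact: oct_half_2S.
Qed.

End Param.
(** Determinant -1 negates i and fixes the square root of 2. On the parameters this is rho -> -
    rho. *)
Lemma octal_oppl R S i t k e :
  octal R S i t k e -> octal (opp_point E R) S (- i) t k e.
Proof.
case=> rho v w z H -> -> -> ->; case: (H) => i2 t2 w2 z2 rho0 v0 w0 z0 hs hp.
exists (- rho) v w z.
- by split; rewrite /oct_e1 /oct_e3 ?sqrrN ?oppr_eq0.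
- by rewrite half_opp // /oct_R; congr half_point; rewrite !mulNr.
- by rewrite /oct_S !mulrNN.
- by rewrite /oct_kappa sqrrN.
- by rewrite /oct_e1 sqrrN.
Qed.

Lemma octal_oppr R S i t k e :
  octal R S i t k e -> octal R (opp_point E S) (- i) t k e.
Proof.
case=> rho v w z H -> -> -> ->; case: (H) => i2 t2 w2 z2 rho0 v0 w0 z0 hs hp.
exists rho v w z => //; first by split; rewrite ?sqrrN.
by rewrite half_opp // /oct_S; congr half_point; rewrite mulrN !mulNr.
Qed.

(** Since 4 R = (e, 0), this replaces R by 5 R; determinant 5 fixes i and negates the square root of
    2. *)
Lemma octal_addT1 R S i t k e : octal R S i t k e ->
  octal (add_point E R (short_point e 0)) S i (- t) k e.
Proof.
case=> rho v w z H -> -> -> ->; case: (H) => i2 t2 w2 z2 rho0 v0 w0 z0 hs hp.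
exists rho v (- w) (- z).
- split; rewrite /oct_e1 /oct_e3 ?sqrrN ?oppr_eq0 //.
    by rewrite (_ : (- z) ^+ 4 = z ^+ 4) //; ring.
  by rewrite (_ : (- z) ^+ 4 = z ^+ 4) //; ring.
- rewrite -(oct_r_e1 H) half_add_T1 //; last exact: oct_half_R H.
  by rewrite /oct_R; congr half_point; rewrite ?mulrN ?invrN ?mulrN.
- by rewrite /oct_S; congr half_point; rewrite !mulrN ?invrN ?mulrNN.
- by rewrite /oct_kappa sqrrN.
- by rewrite /oct_e1 sqrrN.
Qed.

Lemma octal_addT2 R S i t k e : octal R S i t k e ->
  octal R (add_point E S (short_point 0 0)) i (- t) k e.
Proof.
case=> rho v w z H -> -> -> ->; case: (H) => i2 t2 w2 z2 rho0 v0 w0 z0 hs hp.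
exists rho (- v) w z.
- split; rewrite /oct_e1 /oct_e3 ?sqrrN ?oppr_eq0 //.
    by rewrite w2; ring.
  by rewrite z2; ring.
- by rewrite /oct_R sqrrN mulrNN.
- rewrite half_add_T2 //; last exact: oct_half_S H.
  by rewrite /oct_S; congr half_point; rewrite ?mulrNN ?mulNr ?invrN ?mulrN.
- by rewrite /oct_kappa sqrrN.
- by rewrite /oct_e1 sqrrN.
Qed.

Lemma octal_dblR R S i t k e : octal R S i t k e ->
  add_point E (add_point E R R) (add_point E R R) = short_point e 0.
Proof.
by case=> rho v w z H -> _ _ ->; rewrite (oct_dbl_R H) (oct_4R H).
Qed.

Lemma octal_dblS R S i t k e : octal R S i t k e ->
  add_point E (add_point E S S) (add_point E S S) = short_point 0 0.
Proof.
by case=> rho v w z H _ -> _ _; rewrite (oct_dbl_S H) (oct_4S H).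
Qed.

(** 2 S moves by 4 R to a half of (0, 0) other than 2 S and - 2 S, whose X-coordinate is the other
    square root of -32. The substitution is v -> 1/v. *)
Lemma octal_shear R S i t k e : octal R S i t k e ->
  octal R (add_point E S (add_point E R R)) i t (- k) e.
Proof.
case=> rho v w z H -> -> -> ->; case: (H) => i2 t2 w2 z2 rho0 v0 w0 z0 hs hp.
have t0 := oct_t0 H; have i0 := oct_i0 H; have c0 := oct_v2_neq0 H.
have kE : oct_kappa rho v^-1 (- (i * z / v ^+ 2)) = - oct_kappa rho v z.
  by rewrite /oct_kappa sqrrN expr_div_n exprMn i2; field; rewrite v0 two_neq0.
have e1E : oct_e1 rho v^-1 (w / v ^+ 2) = oct_e1 rho v w.
  by rewrite /oct_e1; field; rewrite v0 two_neq0.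
have e3E : oct_e3 rho v^-1 (w / v ^+ 2) (- (i * z / v ^+ 2)) = oct_e3 rho v w z.
  rewrite /oct_e3 (_ : (- _) ^+ 4 = (i ^+ 2) ^+ 2 * z ^+ 4 / v ^+ 8); last by field.
  by rewrite i2; field; rewrite v0 two_neq0 w0.
exists rho v^-1 (w / v ^+ 2) (- (i * z / v ^+ 2)); rewrite ?kE ?e1E //.
- split; rewrite ?e1E ?e3E ?oppr_eq0 ?mulf_neq0 ?invr_eq0 ?expf_neq0 //.
    by rewrite expr_div_n w2; field.
  by rewrite sqrrN expr_div_n exprMn i2 z2; field.
- by rewrite /oct_R; congr half_point; field; rewrite ?v0 ?t0 ?w0.
rewrite (oct_dbl_R H) half_add //; try exact: oct_half_S H; try exact: oct_half_2R H.
- rewrite /oct_S expr0n /= sub0r (oct_s1 H) opprK.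
  by congr half_point; field; rewrite ?(v0, t0, w0, rho0, oner_eq0).
- by rewrite (oct_s_e1 H) (oct_2R_e1 H).
by rewrite expr0n /= sub0r (oct_s1 H) opprK mulf_neq0 ?invr_eq0 ?expf_neq0.
Qed.

(** 4 (R + S) = (e1, 0) + (0, 0) = (e3, 0): the roots e1 and e3 are exchanged, hence also w and z,
    and v is multiplied by the primitive eighth root of unity (1 + i) / t. *)
Lemma octal_add R S i t k e : octal R S i t k e ->
  octal (add_point E R S) S i t k (- 5 - e).
Proof.
case=> rho v w z H -> -> -> ->; case: (H) => i2 t2 w2 z2 rho0 v0 w0 z0 hs hp.
have t0 := oct_t0 H; have i0 := oct_i0 H; have c0 := oct_v2_neq0 H.
have j2 : (1 + i) ^+ 2 = 2 * i.
  by transitivity (1 + i ^+ 2 + 2 * i); [ring|rewrite i2; ring].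
have j0 : 1 + i != 0 by rewrite -sqrf_eq0 j2 mulf_neq0.
pose rho' := rho * z * (1 + i) / (t * w); pose v' := v * (1 + i) / t.
have rho'2 : rho' ^+ 2 = rho ^+ 2 * z ^+ 2 * i / w ^+ 2.
  by rewrite /rho' expr_div_n !exprMn t2 j2; field; rewrite w0 two_neq0.
have v'2 : v' ^+ 2 = v ^+ 2 * i.
  by rewrite /v' expr_div_n !exprMn t2 j2; field.
have v'4 : v' ^+ 4 = - v ^+ 4.
  transitivity ((v' ^+ 2) ^+ 2); first by ring.
  by rewrite v'2 exprMn i2; ring.
have e1E : oct_e1 rho' v' z = oct_e3 rho v w z.
  by rewrite /oct_e1 /oct_e3 rho'2 v'2; field; rewrite v0 two_neq0 w0 i0.
have e3E : oct_e3 rho' v' z w = oct_e1 rho v w.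
  by rewrite /oct_e1 /oct_e3 rho'2 v'2; field; rewrite v0 two_neq0 w0 i0 z0.
have H' : oct_param i t rho' v' z w.
  split; rewrite ?e1E ?e3E ?v'4 ?opprK //; try by rewrite /rho' /v' !mulf_neq0 ?invr_eq0 ?mulf_neq0.
  + by rewrite addrC.
  + by rewrite mulrC.
have kE : oct_kappa rho' v' w = oct_kappa rho v z.
  by rewrite /oct_kappa rho'2 v'2; field; rewrite v0 two_neq0 w0 i0.
exists rho' v' z w; rewrite ?kE ?e1E //.
- rewrite half_add //; try exact: oct_half_R H; try exact: oct_half_S H.
  + have dE : - (rho ^+ 2 / v ^+ 2) - rho ^+ 2 = - (rho ^+ 2 * (1 + v ^+ 2) / v ^+ 2).
      by field.
    have D0 : - (rho ^+ 2 * (1 + v ^+ 2)) != 0.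
      by rewrite oppr_eq0 mulf_neq0 ?expf_neq0.
    rewrite (oct_s1 H) dE half_point_swap /oct_R; congr half_point.
    * transitivity (- (rho * z * (i ^+ 2 - i) / (t * w))).
        by field; rewrite ?v0 ?t0 ?w0 ?rho0 ?c0 ?D0.
      by rewrite i2 /rho'; field; rewrite ?v0 ?t0 ?w0 ?rho0.
    * transitivity (- (rho * z * (i ^+ 2 - i * v ^+ 2) / (v * t * w))).
        by field; rewrite ?v0 ?t0 ?w0 ?rho0 ?c0 ?D0.
      by rewrite i2 v'2 /rho' /v'; field; rewrite ?v0 ?t0 ?w0 ?rho0 ?j0.
    * transitivity (- (rho * (i ^+ 2 * z ^+ 2 / (1 + v ^+ 2) - i * (1 + v ^+ 2)) / (t * w))).
        by field; rewrite ?v0 ?t0 ?w0 ?rho0 ?c0 ?D0.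
      rewrite v'2 /rho'.
      transitivity (rho * (1 + i + v ^+ 2 * i + v ^+ 2 * i ^+ 2) / (t * w)); last first.
        by field; rewrite ?t0 ?w0 ?z0.
      by rewrite (oct_z2M H) i2; field; rewrite ?v0 ?t0 ?w0 ?rho0 ?c0 ?D0.
  + by rewrite (oct_s_e1 H) (oct_r_e1 H).
  + rewrite (oct_s1 H) (_ : _ - _ = - (rho ^+ 2 * (1 + v ^+ 2) / v ^+ 2)); last by field.
    by rewrite oppr_eq0 !mulf_neq0 ?invr_eq0 ?expf_neq0.
- rewrite /oct_S half_point_swap /rho' /v'.
  by congr half_point; field; rewrite ?v0 ?t0 ?w0 ?z0 ?j0.
- by rewrite -hs; ring.
Qed.

(** Equivalent to r1^4 = (r2^2 - r1^2)(r3^2 - r1^2), where r1 = rho, which expresses that 2 R is a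
    half of (e1, 0). It is not symmetric in r1 and r3 and thus singles out e1 from R alone. *)
Lemma oct_r_rel i t rho v w z (r2 := rho * (1 + v ^+ 2) / (v * t))
    (r3 := rho * (1 + v ^+ 2) / w) :
  oct_param i t rho v w z -> r2 ^+ 2 * r3 ^+ 2 = rho ^+ 2 * (r2 ^+ 2 + r3 ^+ 2).
Proof.
move=> H; case: (H) => i2 t2 w2 z2 rho0 v0 w0 z0 _ _.
have w40 : 1 + v ^+ 4 != 0 by rewrite -w2 expf_neq0.
by rewrite (oct_r2 H) oct_r3 w2; field; rewrite ?v0 ?two_neq0 ?w40.
Qed.

Lemma octal_uniq R S i t k e i' t' k' e' :
  octal R S i t k e -> octal R S i' t' k' e' -> [/\ i = i', t = t', k = k' & e = e'].
Proof.
case=> rho v w z H RE SE kE eE [rho' v' w' z' H' RE' SE' kE' eE'].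
have hR := oct_half_R H; have hR' := oct_half_R H'.
have hS := oct_half_S H; have hS' := oct_half_S H'.
have ee : e = e'.
  have [//|ne] := eqVneq e e'.
  have e3 : e' = oct_e3 rho v w z.
    have h1 := oct_sum H; have h2 := oct_prod H.
    have h1' := oct_sum H'; have h2' := oct_prod H'.
    rewrite -eE -eE' in h1 h1' h2 h2'.
    have : (e' - e) * (e' - oct_e3 rho v w z) = 0.
      transitivity (e' ^+ 2 - (e + oct_e3 rho v w z) * e' + e * oct_e3 rho v w z).
        by ring.
      rewrite h1 h2 -h1' -h2'; ring.
    by move/eqP; rewrite mulf_eq0 subr_eq0 eq_sym (negPf ne) subr_eq0 => /eqP.
  have /half_point_inj : half_point rho' (rho' * (1 + v' ^+ 2) / (v' * t'))
     (rho' * (1 + v' ^+ 2) / w') = half_point (rho * (1 + v ^+ 2) / w)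
      (rho * (1 + v ^+ 2) / (v * t)) rho.
    by rewrite -[LHS]/(oct_R t' rho' v' w') -RE' RE /oct_R half_point_swap.
  case=> //; first exact: half_coord_swap.
    by rewrite (oct_r_e1 H') (oct_r_e3 H) -eE' e3.
  (* If e' were the other root, r1 and r3 would be exchanged; [oct_r_rel] in both orders gives r1^2
     = r3^2, against e1 != e3. *)
  move=> q1 q2 q3; have r := oct_r_rel H; have r' := oct_r_rel H'.
  rewrite q2 q3 q1 in r'.
  have [_ _ /negP[]] := half_coord_roots char0 hR.
  move: r r' hR; set r2 := _ / (v * t); set r3 := _ / w => r r' hR.
  have r20 : r2 != 0.
    by rewrite !mulf_neq0 ?invr_eq0 ?mulf_neq0 ?(oct_rho0 H) ?(oct_v2_neq0 H) ?(oct_v0 H) ?(oct_t0 H).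
  rewrite -subr_eq0; apply/eqP; apply: (mulfI (mulf_neq0 two_neq0 (expf_neq0 2 r20))).
  rewrite mulr0.
  transitivity (r2 ^+ 2 * rho ^+ 2 - r3 ^+ 2 * (r2 ^+ 2 + rho ^+ 2)
    - (r2 ^+ 2 * r3 ^+ 2 - rho ^+ 2 * (r2 ^+ 2 + r3 ^+ 2))); first by ring.
  by rewrite r r' !subrr.
have [] := half_point_inj char0 hR hR' _ (etrans (esym RE) RE').
  by rewrite (oct_r_e1 H) (oct_r_e1 H') -eE -eE'.
have [] := half_point_inj char0 hS hS' _ (etrans (esym SE) SE').
  by rewrite (oct_s_e1 H) (oct_s_e1 H') -eE -eE'.
move=> s1 s2 s3 r1 r2 r3.
have formula i0 t0 rho0 v0 w0 z0 (r2' := rho0 * (1 + v0 ^+ 2) / (v0 * t0))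
   (r3' := rho0 * (1 + v0 ^+ 2) / w0) (s1' := rho0 * i0 / v0)
   (s2' := rho0 * i0 * z0 / (v0 * t0)) (s3' := rho0 * i0 * z0 / (v0 * w0)) :
   oct_param i0 t0 rho0 v0 w0 z0 ->
   v0 = r3' * s2' / (r2' * s3') /\
   (i0 = s1' * v0 / rho0 /\ t0 = (1 + v0 ^+ 2) * rho0 / (r2' * v0)).
  move=> H0; case: (H0) => _ _ _ _ a1 a2 a3 a4 _ _.
  have a5 := oct_t0 H0; have a6 := oct_i0 H0; have a7 := oct_v2_neq0 H0.
  rewrite /r2' /r3' /s1' /s2' /s3'; split; [|split]; field;
  by rewrite ?a1 ?a2 ?a3 ?a4 ?a5 ?a6 ?a7.
have [vE [iE tE]] := formula _ _ _ _ _ _ H.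
have [vE' [iE' tE']] := formula _ _ _ _ _ _ H'.
have vv : v = v' by rewrite vE vE' r2 r3 s2 s3.
split=> //.
- by rewrite iE iE' s1 r1 vv.
- by rewrite tE tE' r2 r1 vv.
- by rewrite kE kE' -(oct_s2 H) -(oct_s2 H') s2.
Qed.

Lemma octal_root2 R S i t k e : octal R S i t k e ->
  [/\ i ^+ 2 = - 1, t ^+ 2 = 2, k ^+ 2 = - 32 & (2 * e + 5) ^+ 2 = 153].
Proof.
case=> rho v w z H _ _ -> ->; case: (H) => i2 t2 w2 z2 rho0 v0 w0 z0 hs hp.
split=> //.
  by rewrite -hp /oct_kappa /oct_e1 /oct_e3; field; rewrite two_neq0 v0 w0.
move: hs hp; set a := oct_e1 _ _ _; set b := oct_e3 _ _ _ _ => hs hp.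
have -> : 2 * a + 5 = a - b - (a + b) * 0 by rewrite -[5]opprK -hs; ring.
transitivity ((a + b) ^+ 2 - 4 * (a * b)); first by ring.
by rewrite hs hp; ring.
Qed.

(** R and 2 R have half coordinates r_i and a_i, S and 2 S have s_i and b_i, with a1 = 0 and b2 = 0.
    The parameters are quotients of these, checked through their squares; for instance i = b1 / a2,
    where a2^2 = e and b1^2 = - e. *)
Lemma octal_exists R S (e : F) : on_curve E R -> on_curve E S ->
  e * (- 5 - e) = - 32 ->
  add_point E (add_point E R R) (add_point E R R) = short_point e 0 ->
  add_point E (add_point E S S) (add_point E S S) = short_point 0 0 ->
  exists i t k, octal R S i t k e.
Proof.
move=> oR oS he R4 S4.
have half T c : on_curve E T -> add_point E (add_point E T T) (add_point E T T) =
    short_point c 0 ->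
    exists r1 r2 r3 a1 a2 a3, [/\ half_coord r1 r2 r3, half_coord a1 a2 a3,
      e = r2 ^+ 2 - r1 ^+ 2, e = a2 ^+ 2 - a1 ^+ 2 &
      [/\ T = half_point r1 r2 r3, r2 ^+ 2 = (a2 + a1) * (a2 + a3),
       r1 * r2 * r3 = (a1 + a2) * (a1 + a3) * (a2 + a3), a2 ^+ 2 = c & a1 * a2 * a3 = 0]].
  move=> oT; case: T oT => [[x y]|] // oT T4.
  rewrite short_pointE // in oT T4 *.
  move: (4 * x) (8 * y + 4 * x) oT T4 => X Y oT T4.
  have Y0 : Y != 0 by apply/eqP => Y0; rewrite Y0 short_dbl0 in T4.
  have hs : e + (- 5 - e) = - 5 by ring.
  have [r1 [r2 [r3 [hr er TE]]]] := half_point_surj char0 hs he oT Y0.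
  rewrite TE half_dbl // in T4.
  have oT2 : on_curve E (short_point (r2 ^+ 2) (r1 * r2 * r3)).
    by rewrite -half_dbl //; apply: add_on_curve; rewrite half_on_curve.
  have Y20 : r1 * r2 * r3 != 0 by apply/eqP => Y20; rewrite Y20 short_dbl0 in T4.
  have [a1 [a2 [a3 [ha ea T2E]]]] := half_point_surj char0 hs he oT2 Y20.
  rewrite T2E half_dbl // in T4.
  have [c1 c2] := short_point_inj char0 T4.
  have [d1 d2] := short_point_inj char0 T2E.
  by exists r1, r2, r3, a1, a2, a3.
have [r1 [r2 [r3 [a1 [a2 [a3 [hr ha er ea [RE r2E rE a2E aE]]]]]]]] := half _ _ oR R4.
have [s1 [s2 [s3 [b1 [b2 [b3 [hs hb es eb [SE s2E sE b2E bE]]]]]]]] := half _ _ oS S4.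
have {a2E} a1E : a1 = 0.
  apply/eqP; rewrite -sqrf_eq0 -oppr_eq0; apply/eqP.
  by apply: (addrI (a2 ^+ 2)); rewrite -ea a2E addr0.
have {b2E} b2E : b2 = 0 by apply/eqP; rewrite -sqrf_eq0 b2E.
rewrite {a1}a1E in ha ea r2E rE {aE}; rewrite {b2}b2E in hb eb s2E sE {bE}.
have [a20 _ a30] := half_coord_roots char0 ha; have [_ _ a230] := half_coord_sums char0 ha.
have [b10 b30 _] := half_coord_roots char0 hb; have [_ b130 _] := half_coord_sums char0 hb.
have e3 (c1 c2 c3 : F) : half_coord c1 c2 c3 -> e = c2 ^+ 2 - c1 ^+ 2 ->
    c3 ^+ 2 = c2 ^+ 2 + e + 5.
  case=> h1 _ ->; rewrite -[5]opprK -h1; ring.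
have r3E := e3 _ _ _ hr er; have a3E := e3 _ _ _ ha ea.
have s3E := e3 _ _ _ hs es; have b3E := e3 _ _ _ hb eb.
rewrite expr0n /= subr0 in ea; rewrite expr0n /= sub0r in eb.
rewrite expr0n /= subr0 sqrf_eq0 in a20; rewrite expr0n /= eq_sym sqrf_eq0 in a30.
rewrite expr0n /= sub0r oppr_eq0 sqrf_eq0 in b10.
rewrite expr0n /= sub0r oppr_eq0 sqrf_eq0 in b30.
rewrite !(addr0, add0r) in r2E rE s2E sE.
have r1E : r1 ^+ 2 = a2 * a3.
  by transitivity (r2 ^+ 2 - e); [rewrite er; ring|rewrite r2E ea; ring].
have {}r3E : r3 ^+ 2 = a3 * (a2 + a3).
  transitivity (a3 ^+ 2 + r2 ^+ 2 - a2 ^+ 2); first by rewrite r3E a3E; ring.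
  by rewrite r2E; ring.
have s1E : s1 ^+ 2 = b1 * (b1 + b3).
  by transitivity (s2 ^+ 2 - e); [rewrite es; ring|rewrite s2E eb; ring].
have {}s3E : s3 ^+ 2 = b3 * (b1 + b3).
  transitivity (b3 ^+ 2 + s2 ^+ 2); first by rewrite s3E b3E; ring.
  by rewrite s2E; ring.
have n0 (x y : F) : x ^+ 2 = y -> y != 0 -> x != 0.
  by move=> <-; rewrite sqrf_eq0.
have r10 : r1 != 0 by apply: n0 r1E _; rewrite mulf_neq0.
have r20 : r2 != 0 by apply: n0 r2E _; rewrite mulf_neq0.
have r30 : r3 != 0 by apply: n0 r3E _; rewrite mulf_neq0.
have s10 : s1 != 0 by apply: n0 s1E _; rewrite mulf_neq0.
have s20 : s2 != 0 by apply: n0 s2E _; rewrite mulf_neq0.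
have s30 : s3 != 0 by apply: n0 s3E _; rewrite mulf_neq0.
have ab : a2 ^+ 2 = - b1 ^+ 2 by rewrite -ea.
have a3b : a3 ^+ 2 = b3 ^+ 2 - b1 ^+ 2 by rewrite a3E b3E -ab; ring.
pose v := r3 * s2 / (r2 * s3); pose i := s1 * v / r1.
have v0 : v != 0 by rewrite !mulf_neq0 ?invr_eq0 ?mulf_neq0.
have v2 : v ^+ 2 = a3 * b1 / (a2 * (b1 + b3)).
  by rewrite /v expr_div_n !exprMn r3E s2E r2E s3E; field; rewrite a20 a230 b30 b130.
have iE : i = b1 / a2.
  transitivity (s1 * s2 * s3 * (r1 * r2 * r3) / (s3 ^+ 2 * r1 ^+ 2 * r2 ^+ 2)).
    by rewrite /i /v; field; rewrite r10 r20 s30.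
  by rewrite rE sE s3E r1E r2E; field; rewrite a20 a30 a230 b30 b130.
have i2 : i ^+ 2 = - 1.
  by rewrite iE expr_div_n ab invrN mulrN divff // sqrf_eq0.
have c2 : (1 + v ^+ 2) ^+ 2 = 2 * b1 * (a2 + a3) / (a2 * (b1 + b3)).
  have h : a3 ^+ 2 * b1 ^+ 2 = - (b3 ^+ 2 - b1 ^+ 2) * a2 ^+ 2 by rewrite a3b ab; ring.
  rewrite v2; transitivity ((a2 ^+ 2 * (b1 + b3) ^+ 2 + 2 * a2 * a3 * b1 * (b1 + b3)
     + a3 ^+ 2 * b1 ^+ 2) / (a2 * (b1 + b3)) ^+ 2).
    by field; rewrite a20 b130.
  by rewrite h; field; rewrite a20 b130.
have c0 : 1 + v ^+ 2 != 0.
  by apply: n0 c2 _; rewrite !mulf_neq0 ?invr_eq0 ?mulf_neq0.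
have v4 : v ^+ 4 = (b1 - b3) / (b1 + b3).
  transitivity ((v ^+ 2) ^+ 2); first by ring.
  rewrite v2 expr_div_n !exprMn a3b ab; field; rewrite b130 ?oppr_eq0 ?sqrf_eq0 ?b10 //.
have s2v : s2 = v * r2 * s3 / r3 by rewrite /v; field; rewrite r20 r30 s30.
have is1 : s1 = r1 * i / v by rewrite /i; field; rewrite r10 v0.
pose w := r1 * (1 + v ^+ 2) / r3; pose z := w * s3 / s1.
pose t := (1 + v ^+ 2) * r1 / (r2 * v).
have w2 : w ^+ 2 = 2 * b1 / (b1 + b3).
  by rewrite /w expr_div_n exprMn c2 r1E r3E; field; rewrite a20 a230 a30 b130.
have z2 : z ^+ 2 = 2 * b3 / (b1 + b3).
  by rewrite /z expr_div_n exprMn w2 s1E s3E; field; rewrite b10 b130.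
have t2 : t ^+ 2 = 2.
  rewrite /t expr_div_n exprMn [(r2 * v) ^+ 2]exprMn c2 r1E r2E v2.
  by field; rewrite a20 a30 a230 b10 b130.
have w0 : w != 0 by rewrite !mulf_neq0 ?invr_eq0.
have z0 : z != 0 by rewrite !mulf_neq0 ?invr_eq0.
have t0 : t != 0 by apply: n0 t2 two_neq0.
have e1E : oct_e1 r1 v w = e.
  by rewrite /oct_e1 r1E w2 v2 ea; field; rewrite a20 a30 b10 b130 two_neq0.
have e3E : oct_e3 r1 v w z = - 5 - e.
  rewrite /oct_e3 (_ : z ^+ 4 = (z ^+ 2) ^+ 2); last by ring.
  transitivity (- b3 ^+ 2); last first.
    by rewrite -sub0r -[0](expr0n F 2) -[X in X - _]subr0 b3E expr0n; ring.
  transitivity (a2 ^+ 2 * b3 ^+ 2 / b1 ^+ 2).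
    by rewrite r1E z2 w2 v2; field; rewrite a20 a30 b10 b130 two_neq0.
  by rewrite ab; field.
have H : oct_param i t r1 v w z.
  split; rewrite ?e1E ?e3E // ?v4.
  - by rewrite w2; field.
  - by rewrite z2; field.
  - by ring.
exists i, t, (oct_kappa r1 v z), r1 v w z; rewrite ?e1E //.
  by rewrite RE /oct_R; congr half_point; rewrite /t /w; field;
    rewrite ?r10 ?r20 ?r30 ?v0 ?c0.
rewrite SE /oct_S -is1; congr half_point.
  transitivity (s1 * z / t); last by rewrite is1; field; rewrite v0 t0.
  by rewrite s2v /z /w /t; field; rewrite s10 r20 r30 v0 r10 c0.
transitivity (s1 * z / w); last by rewrite is1; field; rewrite v0 w0.
by rewrite /z; field; rewrite s10 w0.
Qed.

End Octal.

(** * The isogeny and duplication *)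

Section Isogeny.
Variable F : fieldType.
Hypothesis char0 : [pchar F] =i pred0.

Let two_neq0 : 2 != 0 :> F := char0_natr char0 1.
Let four_neq0 : 4 != 0 :> F := char0_natr char0 3.

(* z = 2 y + x completes the square on both curves. *)
Definition square_point (x z : F) : point F := Some (x, (z - x) / 2).

Lemma square_pointE (x y : F) : Some (x, y) = square_point x (2 * y + x).
Proof. by congr (Some (_, _)); field. Qed.

Lemma square_on_curve_E (x z : F) : on_curve E (square_point x z) ->
  z ^+ 2 = 4 * x ^+ 3 + 5 * x ^+ 2 - 8 * x.
Proof.
rewrite on_curve_E => /eqP oc.
transitivity (4 * (((z - x) / 2) ^+ 2 + x * ((z - x) / 2)) + x ^+ 2); first by field.
by rewrite oc; ring.
Qed.

Lemma square_dbl (W : weierstrass) (x z : F) (m := (6 * x ^+ 2 + 5 * x + 2 * (a4 W)%:~R) / z)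
    (x3 := (m ^+ 2 - 5) / 4 - 2 * x) :
  a1 W = 1 -> a2 W = 1 -> a3 W = 0 -> z != 0 ->
  add_point W (square_point x z) (square_point x z) = square_point x3 (m * (x - x3) - z).
Proof.
move=> h1 h2 h3 z0; rewrite /= h1 h2 h3 eqxx /= !mul1r !addr0.
have sE : (z - x) / 2 + (z - x) / 2 + x = z by field.
rewrite sE (negPf z0) /= subr0.
have sE2 : 2 * ((z - x) / 2) + x = z by field.
have -> : (3 * x ^+ 2 + 2 * 1%:~R * x + (a4 W)%:~R - (z - x) / 2) / (2 * ((z - x) / 2) + x)
   = (m - 1) / 2.
  rewrite /m; rewrite sE2; move: (a4 W)%:~R => c; field.
  by rewrite z0 two_neq0.
rewrite /x3; move: m {x3} => m.
by congr (Some (_, _)); field; rewrite ?two_neq0 ?four_neq0.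
Qed.

Lemma square_dbl0 (W : weierstrass) (x : F) : a1 W = 1 -> a3 W = 0 ->
  add_point W (square_point x 0) (square_point x 0) = None.
Proof.
move=> h1 h3; apply: add_pointN; rewrite eqxx h1 h3 /= mul1r addr0; apply/eqP.
by field.
Qed.

Lemma phi_square (x z : F) : x != 0 ->
  phi (square_point x z) = square_point ((x ^+ 2 - 2) / x) (z * (x ^+ 2 + 2) / x ^+ 2).
Proof.
by move=> x0; rewrite /= (negPf x0); congr (Some (_, _)); field; rewrite x0 two_neq0.
Qed.

(** The double of (x, z) has abscissa (x^2 + 2)^2 / z^2. Compatibility with duplication yields
    compatibility with multiplication by every power of two. *)
Lemma phi_dbl (T : point F) : on_curve E T ->
  phi (add_point E T T) = add_point E' (phi T) (phi T).
Proof.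
case: T => [[x y]|] //; rewrite square_pointE; move: (2 * y + x) => z {y} oc.
have zE := square_on_curve_E oc.
have [x0|x0] := eqVneq x 0.
  have z0 : z = 0 by apply/eqP; rewrite -sqrf_eq0 zE x0; apply/eqP; ring.
  by rewrite z0 square_dbl0 // /square_point /= x0 eqxx.
rewrite (phi_square _ x0).
have [z0|z0] := eqVneq z 0; first by rewrite z0 !mul0r !square_dbl0.
(* The equation of the curve solved for its coefficient 5, which lets [field] verify identities
   modulo the curve. *)
have E5 : 5 = (z ^+ 2 / x + 8 - 4 * x ^+ 2) / x by rewrite zE; field.
have x3E : (((6 * x ^+ 2 + 5 * x + 2 * (a4 E)%:~R) / z) ^+ 2 - 5) / 4 - 2 * x =
  (x ^+ 2 + 2) ^+ 2 / z ^+ 2.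
  by rewrite /= E5; field; rewrite x0 z0 four_neq0.
rewrite square_dbl // x3E.
(* In the first case 2 T = (0, 0) lies in the kernel, and phi(T) has order two. *)
have [c0|c0] := eqVneq (x ^+ 2 + 2) 0.
  by rewrite c0 mulr0 mul0r square_dbl0 // expr0n mul0r /phi /square_point eqxx.
rewrite phi_square ?square_dbl //; try by rewrite !mulf_neq0 ?invr_eq0 ?expf_neq0.
rewrite /= E5.
by congr square_point; field; rewrite ?x0 ?z0 ?c0 ?two_neq0 ?four_neq0.
Qed.

Lemma phi_eq_None (T : point F) : on_curve E T -> phi T = None ->
  T = None \/ T = Some (0, 0).
Proof.
case: T => [[x y]|]; last by left.
rewrite on_curve_E /=; have [->|] := eqVneq x 0 => // oc _; right.
have /eqP : y ^+ 2 = 0 by move/eqP: oc; rewrite mul0r addr0 => ->; ring.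
by rewrite sqrf_eq0 => /eqP ->.
Qed.

Lemma iter_dbl (W : weierstrass) (sm : smooth_curve F W) (T : elliptic sm) j :
  iter j (fun U => add_point W U U) (val T) = mul_point W (2 ^ j) (val T).
Proof.
rewrite -val_ellMn; elim: j => [|j IH] //=.
by rewrite IH -val_ellD -mulr2n -mulrnA expnSr.
Qed.

Lemma phi_mul_half j (T U : point F) : on_curve E T -> on_curve E' U ->
  phi T = mul_point E' 2 U ->
  phi (mul_point E (2 ^ j) T) = mul_point E' (2 ^ j.+1) U.
Proof.
move=> oT oU TU.
pose T' : elliptic (smooth_E char0) := Sub T oT.
pose U' : elliptic (smooth_E' char0) := Sub U oU.
rewrite -[T]/(val T') -iter_dbl -[U]/(val U').
have -> : phi (iter j (fun U => add_point E U U) (val T')) =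
    iter j (fun U => add_point E' U U) (phi T).
  elim: j => [|j IH]; first by []; rewrite !iterS -IH; apply: phi_dbl.
  by rewrite iter_dbl -val_ellMn; apply: valP.
rewrite TU -[U]/(val U') -val_ellMn iter_dbl -!val_ellMn -mulrnA.
by rewrite expnS.
Qed.

End Isogeny.

(** * The affine group *)

Section Matrices22.
Variable R : comNzRingType.

Definition rv2 (e f : R) : 'rV[R]_2 := \row_j if j == 0 then e else f.

Lemma forall_ord2 (Q : 'I_2 -> Prop) : Q 0 -> Q 1 -> forall i, Q i.
Proof.
move=> Q0 Q1 [[|[|//]] lt]; [move: Q0|move: Q1]; congr Q; exact: val_inj.
Qed.

Lemma mx2_eta (M : 'M[R]_2) : M = mx2 (M 0 0) (M 0 1) (M 1 0) (M 1 1).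
Proof.
by apply/matrixP; apply: forall_ord2; apply: forall_ord2; rewrite mxE.
Qed.

Lemma rv2_eta (v : 'rV[R]_2) : v = rv2 (v 0 0) (v 0 1).
Proof. by apply/rowP; apply: forall_ord2; rewrite mxE. Qed.

Lemma mx2M (a b c d a' b' c' d' : R) :
  mx2 a b c d *m mx2 a' b' c' d' =
  mx2 (a * a' + b * c') (a * b' + b * d') (c * a' + d * c') (c * b' + d * d').
Proof.
by apply/matrixP; apply: forall_ord2; apply: forall_ord2;
  rewrite !mxE !big_ord_recl big_ord0 !mxE addr0.
Qed.

Lemma rv2M (e f a b c d : R) :
  rv2 e f *m mx2 a b c d = rv2 (e * a + f * c) (e * b + f * d).
Proof.
by apply/rowP; apply: forall_ord2; rewrite !mxE !big_ord_recl big_ord0 !mxE addr0.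
Qed.

Lemma rv2D (e f e' f' : R) : rv2 e f + rv2 e' f' = rv2 (e + e') (f + f').
Proof. by apply/rowP; apply: forall_ord2; rewrite !mxE. Qed.

Lemma det_mx2 (a b c d : R) : \det (mx2 a b c d) = a * d - b * c.
Proof.
rewrite (expand_det_row _ ord0) !big_ord_recl big_ord0 /cofactor !det_mx11 !mxE /=.
by rewrite addr0 expr0 expr1; ring.
Qed.

Lemma mx2_1 : 1%:M = mx2 1 0 0 1 :> 'M[R]_2.
Proof. by apply/matrixP; apply: forall_ord2; apply: forall_ord2; rewrite !mxE. Qed.

End Matrices22.

Lemma map_mx2 (R S : comNzRingType) (f : R -> S) a b c d :
  map_mx f (mx2 a b c d) = mx2 (f a) (f b) (f c) (f d).
Proof. by apply/matrixP; apply: forall_ord2; apply: forall_ord2; rewrite !mxE. Qed.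

Section Affine.
Variable n : nat.
Local Notation R := 'Z_n.

(** A matrix whose determinant is not a unit is sent to the identity, whence the unit hypotheses
    below. *)
Definition agl (e f a b c d : R) : AGL2 n :=
  (rv2 e f, insubd (1%g : {'GL_2[R]}) (mx2 a b c d)).

Arguments agl (e f a b c d)%_R.

Lemma GLval_agl e f a b c d : a * d - b * c \is a GRing.unit ->
  GLval (agl e f a b c d).2 = mx2 a b c d.
Proof.
move=> u; rewrite /agl /=.
have := @insubdK _ _ _ (1%g : {'GL_2[R]}) (mx2 a b c d).
by apply; rewrite -topredE /= unitmxE det_mx2.
Qed.

Lemma aglP (g : AGL2 n) (M := GLval g.2) :
  g = agl (g.1 0 0) (g.1 0 1) (M 0 0) (M 0 1) (M 1 0) (M 1 1) /\
  M 0 0 * M 1 1 - M 0 1 * M 1 0 \is a GRing.unit.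
Proof.
have u : M 0 0 * M 1 1 - M 0 1 * M 1 0 \is a GRing.unit.
  by rewrite -det_mx2 -mx2_eta -unitmxE /M; case: (g.2).
split=> //; rewrite [LHS]surjective_pairing; congr (_, _); first exact: rv2_eta.
by apply: val_inj; rewrite [RHS](GLval_agl 0 0 u) -mx2_eta.
Qed.

Lemma aglM e f a b c d e' f' a' b' c' d' :
  a * d - b * c \is a GRing.unit -> a' * d' - b' * c' \is a GRing.unit ->
  (agl e f a b c d * agl e' f' a' b' c' d')%g =
  agl (e + (e' * a + f' * c)) (f + (e' * b + f' * d))
    (a' * a + b' * c) (a' * b + b' * d) (c' * a + d' * c) (c' * b + d' * d).
Proof.
move=> u u'; have e1 := GLval_agl e f u; have e2 := GLval_agl e' f' u'.
have u2 : (a' * a + b' * c) * (c' * b + d' * d) - (a' * b + b' * d) * (c' * a + d' * c)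
    \is a GRing.unit.
  rewrite (_ : _ - _ = (a * d - b * c) * (a' * d' - b' * c')); last by ring.
  by rewrite unitrM u u'.
rewrite -[LHS]/(agl_mul _ _) /agl_mul; congr (_, _).
  by rewrite e1 /= rv2M rv2D.
apply: val_inj; rewrite [RHS](GLval_agl 0 0 u2) -mx2M.
by rewrite -[mx2 a b c d]e1 -[mx2 a' b' c' d']e2.
Qed.

Lemma agl1 : 1%g = agl 0 0 1 0 0 1.
Proof.
congr (_, _); first by apply/rowP; apply: forall_ord2; rewrite !mxE.
apply: val_inj; rewrite [RHS](@GLval_agl 0 0) ?mul1r ?mulr0 ?subr0 ?unitr1 //.
exact: mx2_1.
Qed.

End Affine.

Arguments agl [n] (e f a b c d)%_R.

(** * The matrix group modulo 8, by enumeration *)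

Section EightTorsionImage.

(* Quadruples of natural numbers below 8 stand for 2 x 2 matrices over Z/8, so that
   the group H8 can be enumerated by computation. *)
Definition quad : Type := (nat * nat * nat * nat)%type.

Definition quad_mul (x y : quad) : quad :=
  let: (a, b, c, d) := x in let: (a', b', c', d') := y in
  ((a * a' + b * c') %% 8, (a * b' + b * d') %% 8,
   (c * a' + d * c') %% 8, (c * b' + d * d') %% 8)%N.

Definition quad_mx (x : quad) : 'M['Z_8]_2 :=
  let: (a, b, c, d) := x in mx2 a%:R b%:R c%:R d%:R.

Definition H8_gens : seq quad := [:: (1, 1, 0, 1); (7, 0, 2, 1); (5, 0, 2, 1)]%N.

Definition H8_step (s : seq quad) : seq quad :=
  undup (s ++ [seq quad_mul g x | g <- H8_gens, x <- s]).

Definition H8_words (m : nat) : seq quad := iter m H8_step [:: (1, 0, 0, 1)%N].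

(** A closed form of the group: a and d odd, c even, and c / 2 even exactly when the determinant is
    1 or 3 modulo 8. The 7 stands for -1 in the determinant. *)
Definition in_H8 (a b c d : nat) : bool :=
  let D := ((a * d + 7 * (b * c)) %% 8)%N in
  if (c %% 4 == 0)%N then (D == 1%N) || (D == 3%N)
  else (c %% 4 == 2)%N && ((D == 5%N) || (D == 7%N)).

Definition gens_stable (s : seq quad) :=
  all (fun g => all (fun x => quad_mul g x \in s) s) H8_gens.

Definition all_in_H8 (s : seq quad) := all (fun x : quad => let: (a, b, c, d) := x in
  [&& a < 8, b < 8, c < 8, d < 8 & in_H8 a b c d]%N) s.

Definition covers_H8 (s : seq quad) :=
  all (fun a => all (fun b => all (fun c => all (fun d =>
    in_H8 a b c d ==> ((a, b, c, d) \in s)) (iota 0 8)) (iota 0 8)) (iota 0 8)) (iota 0 8).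

Lemma H8_words_spec : [/\ gens_stable (H8_words 8), all_in_H8 (H8_words 8),
  covers_H8 (H8_words 8) & (1, 0, 0, 1)%N \in H8_words 8].
Proof. by split; vm_compute. Qed.

Lemma quad_mxM x y : quad_mx (quad_mul x y) = quad_mx x *m quad_mx y.
Proof.
have m8 m : (m %% 8)%:R = m%:R :> 'Z_8 by rewrite Zp_nat_mod.
case: x y => [[[a b] c] d] [[[a' b'] c'] d'] /=.
by rewrite mx2M !m8 !natrD !natrM.
Qed.

Lemma mx2_quad (a b c d : 'Z_8) : mx2 a b c d = quad_mx (a : nat, b : nat, c : nat, d : nat).
Proof. by rewrite /= !natr_Zp. Qed.

Lemma H8_gensE (g : {'GL_2['Z_8]}) :
    (GLval g \in [:: mx2 1 1 0 1; mx2 7 0 2 1; mx2 5 0 2 1]) =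
    (GLval g \in map quad_mx H8_gens).
Proof. by rewrite /= ?mulr1n. Qed.

Lemma H8_list_gen m x : x \in H8_words m ->
  quad_mx x \in [set GLval h | h in H8].
Proof.
elim: m x => [|m IH] x.
  rewrite inE => /eqP ->; apply/imsetP; exists 1%g; first exact: group1.
  by rewrite /quad_mx -mx2_1.
rewrite /H8_words iterS -/(H8_words m) /H8_step mem_undup mem_cat => /orP[/IH //|].
case/allpairsP => gy [gG /IH/imsetP[h hH yE] ->]; move: (gy.1) gG => g gG.
have [g' g'E] : exists g' : {'GL_2['Z_8]}, quad_mx g = GLval g'.
  have u : quad_mx g \in unitmx.
    by move: gG; rewrite !inE => /or3P[] /eqP ->; rewrite unitmxE det_mx2.
  by exists (FinRing.Unit u).
apply/imsetP; exists (g' * h)%g; last by rewrite quad_mxM g'E yE.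
apply: groupM => //; apply: mem_gen; rewrite inE H8_gensE -g'E.
exact: map_f.
Qed.

(** The computed list is hidden behind an existential, so that its 256 entries are not unfolded
    afterwards. *)
Lemma H8_listE : exists s : seq quad, [/\ gens_stable s, all_in_H8 s, covers_H8 s,
  (1, 0, 0, 1)%N \in s & forall x, x \in s -> quad_mx x \in [set GLval h | h in H8]].
Proof.
have [h1 h2 h3 h4] := H8_words_spec; exists (H8_words 8).
by split; [exact: h1|exact: h2|exact: h3|exact: h4|exact: H8_list_gen].
Qed.

(** In a finite group every element of a generated subgroup is a word in the generators, so it stays
    in a list that contains 1 and is stable under them; the list in turn consists of such words. *)
Lemma H8P (a b c d : 'Z_8) :
  (mx2 a b c d \in [set GLval h | h in H8]) = in_H8 a b c d.
Proof.
have [s [stab sub full one gen]] := H8_listE.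
apply/imsetP/idP => [[h hH e]|ok].
  have [x xS hx] : exists2 x, x \in s & GLval h = quad_mx x.
    case/gen_prodgP: hH => m [f fA ->].
    elim: m f fA => [|m IH] f fA.
      by exists (1, 0, 0, 1)%N; rewrite // big_ord0 /= -mx2_1.
    rewrite big_ord_recl.
    have [x xS xE] := IH (fun i => f (lift ord0 i)) (fun i => fA _).
    have := fA ord0; rewrite inE H8_gensE => /mapP[g gG gE].
    exists (quad_mul g x); first by have /allP/(_ _ gG)/allP/(_ _ xS) := stab.
    by rewrite quad_mxM -gE -xE.
  have /allP/(_ _ xS) := sub.
  move: e; rewrite hx; case: x {xS hx} => [[[a' b'] c'] d'] /= e /and5P[la lb lc ld].
  have := congr1 (fun M : 'M_2 => M 0 0) e; have := congr1 (fun M : 'M_2 => M 0 1) e.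
  have := congr1 (fun M : 'M_2 => M 1 0) e; have := congr1 (fun M : 'M_2 => M 1 1) e.
  by rewrite !mxE /= => -> -> -> ->; rewrite !val_Zp_nat // !modn_small.
have abcd : (a : nat, b : nat, c : nat, d : nat) \in s.
  have lt8 (x : 'Z_8) : (x : nat) \in iota 0 8 by rewrite mem_iota /= (ltn_ord x).
  have /allP/(_ _ (lt8 a))/allP/(_ _ (lt8 b)) := full.
  by move=> /allP/(_ _ (lt8 c))/allP/(_ _ (lt8 d))/implyP/(_ ok).
rewrite mx2_quad; have /imsetP[h hH hE] := gen _ abcd.
by exists h.
Qed.

End EightTorsionImage.

(** * Reduction modulo 8 *)

Section Mod8.
Variable k : nat.
Hypothesis hk : (3 <= k)%N.
Local Notation n := (2 ^ k)%N.
Local Notation R := 'Z_n.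
Local Notation m8 := (@mod8 n).

Lemma expn2_gt1 : (1 < n)%N.
Proof. by rewrite -[1%N](expn0 2) ltn_exp2l //; apply: leq_trans hk. Qed.

Lemma dvdn8_exp2 : (8 %| n)%N.
Proof. by rewrite -[8%N]/(2 ^ 3)%N dvdn_exp2l. Qed.

Lemma val_natr_exp2 m : (m%:R : R) = (m %% n)%N :> nat.
Proof. exact: val_Zp_nat expn2_gt1 m. Qed.

Lemma mod8_natr m : m8 m%:R = m%:R.
Proof.
rewrite /mod8 val_natr_exp2; apply: val_inj.
by rewrite /= !val_Zp_nat // modn_dvdm // dvdn8_exp2.
Qed.

Lemma mod8D x y : m8 (x + y) = m8 x + m8 y.
Proof. by rewrite -[x]natr_Zp -[y]natr_Zp -natrD !mod8_natr natrD. Qed.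

Lemma mod8M x y : m8 (x * y) = m8 x * m8 y.
Proof. by rewrite -[x]natr_Zp -[y]natr_Zp -natrM !mod8_natr natrM. Qed.

Lemma mod8_1 : m8 1 = 1.
Proof. exact: (mod8_natr 1). Qed.

Lemma mod8_0 : m8 0 = 0.
Proof. exact: (mod8_natr 0). Qed.

Lemma mod8N x : m8 (- x) = - m8 x.
Proof. by apply: (addIr (m8 x)); rewrite -mod8D !addNr mod8_0. Qed.

Lemma mod8B x y : m8 (x - y) = m8 x - m8 y.
Proof. by rewrite mod8D mod8N. Qed.

Lemma val_mod8 x : m8 x = (x %% 8)%N :> nat.
Proof. by rewrite /mod8 val_Zp_nat. Qed.

Lemma odd_mod8 (x : R) : odd (m8 x) = odd x.
Proof. by rewrite val_mod8 odd_mod. Qed.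

Lemma unit_odd (x : R) : (x \is a GRing.unit) = odd x.
Proof.
rewrite -{1}[x]natr_Zp unitZpE ?expn2_gt1 //.
by rewrite coprime_pexpl ?coprime2n // (leq_trans _ hk).
Qed.

Lemma mod8_eq0 (x : R) : m8 x = 0 -> exists y, x = 8 * y.
Proof.
move=> x0; have : (8 %| x)%N by rewrite /dvdn -val_mod8 x0.
by case/dvdnP => q e; exists q%:R; rewrite -[x]natr_Zp e natrM mulrC.
Qed.

Lemma all8P (Q : 'Z_8 -> bool) :
  all (fun m : nat => Q m%:R) (iota 0 8) -> forall x, Q x.
Proof.
by move=> /allP h x; rewrite -[x]natr_Zp; apply: h; rewrite mem_iota /= (ltn_ord x).
Qed.

Lemma even_half (x : R) : ~~ odd x -> exists y, x = 2 * y.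
Proof.
move=> ex; exists (x./2)%:R.
by rewrite -{1}[x]natr_Zp -[(x : nat) in LHS]even_halfK // -muln2 natrM mulrC.
Qed.

Lemma mod8_quarter (x : R) : m8 x \in [:: 0; 4] -> exists y, x = 4 * y.
Proof.
move=> x4; have : (4 %| x)%N.
  have : (4 %| m8 x)%N by move: x4; rewrite !inE => /orP[] /eqP ->.
  by rewrite val_mod8 /dvdn modn_dvdm.
by case/dvdnP => q e; exists q%:R; rewrite -[x]natr_Zp e natrM mulrC.
Qed.

Lemma odd_ZpD (x y : R) : odd (x + y)%R = odd x (+) odd y.
Proof.
rewrite -!(odd_mod8) mod8D; move: (m8 x) (m8 y) => a b.
by rewrite /= odd_mod // oddD.
Qed.

Lemma odd_ZpM (x y : R) : odd (x * y)%R = odd x && odd y.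
Proof.
rewrite -!(odd_mod8) mod8M; move: (m8 x) (m8 y) => a b.
by rewrite /= odd_mod // oddM.
Qed.

Lemma odd_Zp1 : odd (1%R : R) = true.
Proof. by rewrite -odd_mod8 mod8_1. Qed.

(* Hensel lifting of the square root of 1 mod 8. *)
Lemma sqrt_mod8 (y : R) : m8 y = 1 -> exists2 x : R, m8 x \in [:: 1; 3] & x ^+ 2 = y.
Proof.
move=> y1.
have lift j : exists x q : R, odd x /\ x ^+ 2 = y + 2 ^+ j.+3 * q.
  elim: j => [|j [x [q [ox e]]]].
    have [q yq] : exists q, 1 - y = 8 * q.
      by apply: mod8_eq0; rewrite mod8B mod8_1 y1 subrr.
    exists 1, q; split; first exact: odd_Zp1.
    rewrite expr1n (_ : 2 ^+ 3 = 8); last by ring.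
    by rewrite -yq; ring.
  case oq : (odd q); last first.
    have [r er] := even_half (negbT oq); exists x, r; split=> //.
    by rewrite e er [2 ^+ j.+4]exprS; ring.
  have : ~~ odd (q + x)%R by rewrite odd_ZpD oq ox.
  (* For odd q, shifting x by 2^(j+2) adds 2^(j+3) x to the square, up to higher powers of two, and
     makes the coefficient q + x even. *)
  case/even_half => r er; exists (x + 2 ^+ j.+2), (r + 2 ^+ j); split.
    by rewrite odd_ZpD ox exprS odd_ZpM -(odd_mod8 2) mod8_natr.
  rewrite sqrrD e; transitivity (y + 2 ^+ j.+3 * (q + x) + 2 ^+ j.+4 * 2 ^+ j).
    by rewrite !exprS; ring.
  by rewrite er [2 ^+ j.+4]exprS; ring.
have [x [q [ox e]]] := lift k.
have e2 : (2 : R) ^+ k = 0.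
  by rewrite -natrX; apply: val_inj; exact: etrans (val_natr_exp2 _) (modnn _).
have {}e : x ^+ 2 = y by rewrite e -addn3 exprD e2 !mul0r addr0.
(* The residues 1 and 3 are preferred because diag(x, 1) must have a determinant compatible with c =
   0 in [in_H8]. *)
have : (m8 x \in [:: 1; 3]) || (m8 (- x) \in [:: 1; 3]).
  move: ox; rewrite -odd_mod8 mod8N; apply/implyP.
  by move: (m8 x); apply: all8P.
by case/orP => h; [exists x|exists (- x); rewrite ?sqrrN].
Qed.

End Mod8.

Section Frattini.
Variable k : nat.
Hypothesis hk : (3 <= k)%N.
Local Notation n := (2 ^ k)%N.
Local Notation R := 'Z_n.
Local Notation m8 := (@mod8 n).
Local Notation agl := (@agl n).

Lemma all8_nat4 (Q : nat -> nat -> nat -> nat -> bool) :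
  all (fun a => all (fun b => all (fun c => all (Q a b c) (iota 0 8)) (iota 0 8))
    (iota 0 8)) (iota 0 8) -> forall a b c d : 'Z_8, Q a b c d.
Proof.
have lt8 (x : 'Z_8) : (x : nat) \in iota 0 8 by rewrite mem_iota /= (ltn_ord x).
move=> h a b c d; move: h => /allP/(_ _ (lt8 a))/allP/(_ _ (lt8 b)).
by move=> /allP/(_ _ (lt8 c))/allP/(_ _ (lt8 d)).
Qed.

Lemma in_H8_odd (a b c d : 'Z_8) : in_H8 a b c d -> [&& odd a, odd d & ~~ odd c].
Proof.
apply/implyP; move: a b c d.
by apply: (all8_nat4 (Q := fun a b c d => in_H8 a b c d ==> [&& odd a, odd d & ~~ odd c]));
  vm_compute.
Qed.

Lemma det_nat8 (a b c d : 'Z_8) : a * d - b * c = (a * d + 7 * (b * c))%N%:R.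
Proof.
rewrite natrD !natrM !natr_Zp (_ : 7 = - 1 :> 'Z_8) ?mulN1r //; exact: val_inj.
Qed.

Lemma in_H8_det1 (a b c d : 'Z_8) : in_H8 a b c d -> a * d - b * c = 1 -> c \in [:: 0; 4].
Proof.
move=> h /(congr1 (@nat_of_ord _)); rewrite det_nat8 val_Zp_nat // => h1.
suff : ((c : nat) == 0%N) || ((c : nat) == 4%N).
  by rewrite !inE => /orP[] /eqP e; apply/orP; [left|right]; apply/eqP/val_inj.
have {h1} : ((a * d + 7 * (b * c)) %% 8 == 1)%N by rewrite h1.
apply/implyP; move: h; apply/implyP; move: a b c d.
apply: (all8_nat4 (Q := fun a b c d => (in_H8 a b c d) ==>
   ((a * d + 7 * (b * c)) %% 8 == 1)%N ==> (c == 0%N) || (c == 4%N))).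
by vm_compute.
Qed.

Lemma in_Ik_agl e f a b c d : a * d - b * c \is a GRing.unit ->
  (agl e f a b c d \in Ik k) = in_H8 (m8 a) (m8 b) (m8 c) (m8 d) &&
    (~~ odd e == (m8 (a * d - b * c) \in [:: 1; 7])).
Proof.
by move=> u; rewrite inE (GLval_agl e f u) map_mx2 H8P det_mx2 mxE.
Qed.

Lemma in_H8M (a b c d a' b' c' d' : 'Z_8) : in_H8 a b c d -> in_H8 a' b' c' d' ->
  in_H8 (a * a' + b * c')%R (a * b' + b * d')%R (c * a' + d * c')%R (c * b' + d * d')%R.
Proof.
rewrite -!H8P -mx2M => /imsetP[g gH ->] /imsetP[h hH ->].
by apply/imsetP; exists (g * h)%g; rewrite ?groupM.
Qed.

(** The residues 1 and 7 form a subgroup of index two of the units modulo 8, so membership is a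
    quadratic character, the one of the square root of 2. *)
Lemma pm1_mod8M (x y : 'Z_8) : odd x -> odd y ->
  (x * y \in [:: 1; 7]) = ((x \in [:: 1; 7]) == (y \in [:: 1; 7])).
Proof.
move=> ox oy; apply/eqP; move: oy; apply/implyP; move: y; apply: all8P.
by move: x ox => x; apply/implyP; move: x; apply: all8P.
Qed.

Lemma Ik_aglP g : g \in Ik k -> exists e f a b c d, [/\ g = agl e f a b c d,
  a * d - b * c \is a GRing.unit, in_H8 (m8 a) (m8 b) (m8 c) (m8 d) &
  ~~ odd e = (m8 (a * d - b * c) \in [:: 1; 7])].
Proof.
have [gE u] := aglP g; rewrite {1}gE in_Ik_agl // => /andP[h /eqP h'].
by do 6 eexists; split; [exact: gE|exact: u|exact: h|exact: h'].
Qed.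

(** The first translation coordinate of a product is e + e' a + f' c with a odd and c even, so its
    parity is additive, like the character of the determinant it is tied to. *)
Lemma Ik_group_set : group_set (Ik k).
Proof.
apply/group_setP; split.
  have u : 1 * 1 - 0 * 0 \is a @GRing.unit R by rewrite mul0r subr0 mul1r unitr1.
  by rewrite agl1 in_Ik_agl // mul0r subr0 mul1r mod8_1 // mod8_0.
move=> g h /Ik_aglP[e [f [a [b [c [d [-> u hM he]]]]]]].
move=> /Ik_aglP[e' [f' [a' [b' [c' [d' [-> u' hM' he']]]]]]].
rewrite aglM // in_Ik_agl; last first.
  rewrite (_ : _ - _ = (a * d - b * c) * (a' * d' - b' * c')); last by ring.
  by rewrite unitrM u u'.
rewrite (_ : _ - _ = (a * d - b * c) * (a' * d' - b' * c')); last by ring.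
apply/andP; split; first by rewrite !(mod8D hk, mod8M hk) in_H8M.
move: u u'; rewrite !unit_odd // => u u'.
rewrite (mod8M hk) pm1_mod8M ?odd_mod8 // -he -he'.
have /and3P[oa od oc] := in_H8_odd hM.
rewrite !odd_mod8 // in oa od oc.
rewrite !odd_ZpD // !odd_ZpM // oa (negPf oc) andbT andbF addbF.
by case: (odd e); case: (odd e').
Qed.

Canonical Ik_group := Group Ik_group_set.

End Frattini.

(** * The Frattini subgroup of I_k *)

Section FrattiniSubgroup.
Variable k : nat.
Hypothesis hk : (3 <= k)%N.
Local Notation n := (2 ^ k)%N.
Local Notation R := 'Z_n.
Local Notation m8 := (@mod8 n).
Local Notation agl := (@agl n).
Variable K : {group AGL2 n}.
Hypothesis K_sq : forall g, g \in Ik k -> (g * g)%g \in K.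

Local Notation "a \isU" := (is_true (a \is a @GRing.unit R)) (at level 40).
Local Notation tr e f := (agl e f 1 0 0 1).
Local Notation up t := (agl 0 0 1 t 0 1).
Local Notation lo t := (agl 0 0 1 0 t 1).
Local Notation dg a d := (agl 0 0 a 0 0 d).

Lemma det_unit1 (a b c d : R) : a * d - b * c = 1 -> (a * d - b * c) \isU.
Proof. by move=> ->; rewrite unitr1. Qed.

Lemma det_unit_odd (a b c d : R) : odd (m8 (a * d - b * c)) -> (a * d - b * c) \isU.
Proof. by rewrite odd_mod8 // unit_odd. Qed.

Lemma agl_ext e f a b c d e' f' a' b' c' d' : e = e' -> f = f' -> a = a' -> b = b' ->
  c = c' -> d = d' -> agl e f a b c d = agl e' f' a' b' c' d'.
Proof. by move=> -> -> -> -> -> ->. Qed.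

Let mod8E := (mod8D hk, mod8N hk, mod8M hk, mod8_natr hk, mod8_1 hk, mod8_0 hk).

Ltac det1 := apply: det_unit1; ring.
Ltac detn := apply: det_unit_odd; rewrite !mod8E.

(** [K] is any subgroup containing the squares of elements of I_k. Then g x g^-1 = (g x)^2 x^-1
    g^-2, and for the commutators below x y x^-1 y^-1 = x^2 (x^-1 y)^2 y^-2. *)
Lemma K_conj g x y : g \in Ik k -> x \in Ik k -> x \in K -> (g * x = y * g)%g -> y \in K.
Proof.
move=> gI xI xK e; have -> : y = ((g * x) * (g * x) * x^-1 * (g * g)^-1)%g.
  by rewrite invMg !mulgA mulgK mulgK e mulgK.
have gxI : (g * x)%g \in Ik k by apply: (groupM (G := Ik_group hk)).
by apply: groupM; [apply: groupM; [exact: K_sq|rewrite groupV]|rewrite groupV K_sq].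
Qed.

Lemma K_comm x y z : x \in Ik k -> y \in Ik k -> (z * (y * x) = x * y)%g -> z \in K.
Proof.
move=> xI yI e; have -> : z = ((x * x) * ((x^-1 * y) * (x^-1 * y)) * (y * y)^-1)%g.
  apply: (mulIg (y * x)%g); rewrite e invMg !mulgA.
  by rewrite mulgK mulgKV mulgK mulgKV.
have xyI : (x^-1 * y)%g \in Ik k.
  by apply: (groupM (G := Ik_group hk)); rewrite // (groupV (Ik_group hk)).
by apply: groupM; [apply: groupM; exact: K_sq|rewrite groupV K_sq].
Qed.

Lemma up_Ik t : up t \in Ik k.
Proof.
rewrite in_Ik_agl //; last by det1.
rewrite !mod8E mulr0 subr0 mulr1 /= andbT; move: (m8 t).
by apply: all8P; vm_compute.
Qed.

Lemma upM s t : (up s * up t = up (s + t))%g.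
Proof. by rewrite aglM; [apply: agl_ext; ring|det1|det1]. Qed.

Lemma up_K t : up (2 * t) \in K.
Proof.
by have := K_sq (up_Ik t); rewrite upM (_ : t + t = 2 * t) //; ring.
Qed.

Lemma trM e f e' f' : (tr e f * tr e' f' = tr (e + e') (f + f'))%g.
Proof. by rewrite aglM; [apply: agl_ext; ring|det1|det1]. Qed.

Lemma trX e f m : (tr e f ^+ m)%g = tr (e * m%:R) (f * m%:R).
Proof.
elim: m => [|m IH]; first by rewrite expg0 agl1; apply: agl_ext; ring.
by rewrite expgS IH trM; apply: agl_ext; rewrite -?natr1; ring.
Qed.

(** The squares of the elements with translation (1, 0) and matrices [3 0; 0 1] and [3 1; 0 1]
    differ by [up 4] and this translation; determinant 3 is what makes e odd. *)
Lemma tr01_K : tr 0 1 \in K.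
Proof.
have b1 : agl 1 0 3 1 0 1 \in Ik k.
  by rewrite in_Ik_agl //; [rewrite !mod8E|detn].
have d1 : agl 1 0 3 0 0 1 \in Ik k.
  by rewrite in_Ik_agl //; [rewrite !mod8E|detn].
have x2 : (agl 1 0 3 0 0 1 * agl 1 0 3 0 0 1)%g = agl 4 0 9 0 0 1.
  by rewrite aglM; [apply: agl_ext; ring|detn|detn].
have y2 : (agl 1 0 3 1 0 1 * agl 1 0 3 1 0 1)%g = agl 4 1 9 4 0 1.
  by rewrite aglM; [apply: agl_ext; ring|detn|detn].
have xK := K_sq d1; have yK := K_sq b1; rewrite x2 in xK; rewrite y2 in yK.
have e : (tr 0 1 * (agl 4 0 9 0 0 1 * up (2 * 2)))%g = agl 4 1 9 4 0 1.
  rewrite [X in (_ * X)%g]aglM; [|by detn|by det1].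
  by rewrite aglM; [apply: agl_ext; ring|by det1|by detn].
rewrite -(groupMr _ (groupM xK (up_K 2))) e; exact: yK.
Qed.

(** Conjugating the translation by (0, 1) with an element whose lower left entry is 2 yields the
    translation by (2, 1). *)
Lemma tr20_K : tr 2 0 \in K.
Proof.
have qI : agl 1 0 5 0 2 1 \in Ik k.
  by rewrite in_Ik_agl //; [rewrite !mod8E|detn].
have tI : tr 0 1 \in Ik k.
  by rewrite in_Ik_agl //; [rewrite !mod8E|detn].
rewrite -(groupMr _ tr01_K) trM; apply: (K_conj qI tI tr01_K).
rewrite [LHS]aglM; [|by detn|by det1].
by rewrite [RHS]aglM; [apply: agl_ext; ring|by det1|by detn].
Qed.

Lemma tr_K (e f : R) : ~~ odd e -> tr e f \in K.
Proof.
case/even_half => y ->.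
have := groupM (groupX (y : nat) tr20_K) (groupX (f : nat) tr01_K).
by rewrite !trX trM !natr_Zp !mul0r addr0 add0r mul1r.
Qed.

(** y = x^2 with x = 1 or 3 modulo 8, and the parity of e is chosen to put the root in I_k; the
    translation left over in its square has even first coordinate, hence lies in [K]. *)
Lemma dg_mod8 y : m8 y = 1 -> dg y 1 \in K.
Proof.
move=> y1; have [x x13 xy] := sqrt_mod8 hk y1.
have ox : odd x by rewrite -odd_mod8; move: x13; rewrite !inE => /orP[] /eqP ->.
have u : (x * 1 - 0 * 0 : R) \isU by rewrite mulr1 mul0r subr0 unit_odd.
have [e xI eE] : exists2 e : R, agl e 0 x 0 0 1 \in Ik k & ~~ odd (e + e * x)%R.
  move: x13; rewrite !inE => /orP[] /eqP x8.
    exists 0; last by rewrite mul0r addr0.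
    by rewrite in_Ik_agl ?u // !mod8E x8.
  exists 1; last by rewrite mul1r odd_ZpD // ox odd_Zp1.
  by rewrite in_Ik_agl ?u // !mod8E x8.
have u' : (y * 1 - 0 * 0 : R) \isU by rewrite mulr1 mul0r subr0 unit_odd // -odd_mod8 y1.
have u1 : (1 * 1 - 0 * 0 : R) \isU by det1.
have x2 : (agl e 0 x 0 0 1 * agl e 0 x 0 0 1)%g = agl (e + e * x) 0 y 0 0 1.
  by rewrite (aglM _ _ _ _ u u) -xy; apply: agl_ext; ring.
have t2 : (tr (e + e * x) 0 * dg y 1)%g = agl (e + e * x) 0 y 0 0 1.
  by rewrite (aglM _ _ _ _ u1 u'); apply: agl_ext; ring.
have xK := K_sq xI; rewrite x2 in xK.
rewrite -(groupMl _ (tr_K 0 eE)) t2; exact: xK.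
Qed.

Lemma loM s t : (lo s * lo t = lo (s + t))%g.
Proof. by rewrite aglM; [apply: agl_ext; ring|det1|det1]. Qed.

Lemma loX s m : (lo s ^+ m)%g = lo (s * m%:R).
Proof.
elim: m => [|m IH]; first by rewrite expg0 agl1; apply: agl_ext; ring.
by rewrite expgS IH loM; apply: agl_ext; rewrite -?natr1; ring.
Qed.

(** Squaring an element with matrix [5 0; 2 1] gives [25 0; 12 1]. Removing diag(25, 1) and a
    translation leaves [lo (12 / 25)], whose powers reach all multiples of 4 because 3 and 25 are
    units. *)
Lemma lo_K r : lo (4 * r) \in K.
Proof.
have qI : agl 1 0 5 0 2 1 \in Ik k.
  by rewrite in_Ik_agl //; [rewrite !mod8E|detn].
have u25 : (25 : R) \isU by rewrite unit_odd // -odd_mod8 mod8E.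
have u3 : (3 : R) \isU by rewrite unit_odd // -odd_mod8 mod8E.
pose s : R := 12 / 25.
have sK : lo s \in K.
  have d25 : dg 25 1 \in K by apply: dg_mod8; rewrite mod8E; apply/eqP.
  have t6 : tr 6 0 \in K by apply: tr_K; rewrite -odd_mod8 mod8E.
  have qK := K_sq qI.
  have q2 : (agl 1 0 5 0 2 1 * agl 1 0 5 0 2 1)%g = agl 6 0 25 0 12 1.
    by rewrite aglM; [apply: agl_ext; ring|by detn|by detn].
  rewrite q2 in qK.
  have e : (tr 6 0 * (dg 25 1 * lo s))%g = agl 6 0 25 0 12 1.
    have s25 : s * 25 = 12 by rewrite /s divrK.
    have e1 : (dg 25 1 * lo s)%g = agl 0 0 25 0 12 1.
      by rewrite aglM; [rewrite s25; apply: agl_ext; ring|by detn|by det1].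
    have u1 : (1 * 1 - 0 * 0 : R) \isU by det1.
    have u2 : (25 * 1 - 0 * 12 : R) \isU by detn.
    by rewrite [X in (_ * X)%g]e1; apply: etrans (aglM _ _ _ _ u1 u2) _; apply: agl_ext; ring.
  rewrite -(groupMl _ d25) -(groupMl _ t6) e; exact: qK.
have := groupX (25 * r / 3 : R) sK; rewrite loX natr_Zp.
have -> : s * (25 * r / 3) = 4 * r; last by [].
apply: (mulIr u3); rewrite !mulrA mulrVK //.
transitivity ((s * 25) * r); first by ring.
by rewrite /s divrK //; ring.
Qed.

(* Every matrix with unit upper left entry is lower times diagonal times upper
   triangular; the group law of AGL2 reverses matrix products. *)
Lemma agl_LDU a b c d ai : a * ai = 1 -> (a * d - b * c) \isU ->
  agl 0 0 a b c d = (up (ai * b) * (dg a ((a * d - b * c) * ai) * lo (c * ai)))%g.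
Proof.
move=> aai u.
have u2 : a * ((a * d - b * c) * ai) - 0 * 0 = a * d - b * c.
  transitivity ((a * ai) * (a * d - b * c)); first by ring.
  by rewrite aai mul1r.
have u2' : (a * ((a * d - b * c) * ai) - 0 * 0) \isU by rewrite u2.
have u1 : (1 * 1 - 0 * (c * ai) : R) \isU by det1.
have u1' : (1 * 1 - (ai * b) * 0 : R) \isU by det1.
have u3 : (a * ((a * d - b * c) * ai) - 0 * c) \isU.
  by rewrite (_ : 0 * c = 0 * 0) ?u2 // !mul0r.
have e1 : (dg a ((a * d - b * c) * ai) * lo (c * ai))%g =
   agl 0 0 a 0 c ((a * d - b * c) * ai).
  rewrite (aglM _ _ _ _ u2' u1); apply: agl_ext; try by ring.
  by transitivity ((a * ai) * c); [ring|rewrite aai mul1r].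
rewrite [X in _ = (_ * X)%g]e1; apply: esym; apply: etrans (aglM _ _ _ _ u1' u3) _; apply: agl_ext.
- by ring.
- by ring.
- by ring.
- by transitivity ((a * ai) * b); [ring|rewrite aai mul1r].
- by ring.
- by transitivity ((a * ai) * d); [ring|rewrite aai mul1r].
Qed.

(** The commutator of [up (-1)] and the element of matrix [-1 0; 2 1] has matrix [-1 0; 4 -1]; the
    entry 4 is cleared by [lo_K]. *)
Lemma dg_neg1_K : dg (-1) (-1) \in K.
Proof.
have pI : agl 0 0 (-1) 0 2 1 \in Ik k.
  by rewrite in_Ik_agl //; [rewrite !mod8E|detn].
have zK : agl 0 0 (-1) 0 4 (-1) \in K.
  apply: (K_comm (up_Ik (-1)) pI).
  have e1 : (agl 0 0 (-1) 0 2 1 * up (-1))%g = agl 0 0 (-3) (-1) 2 1.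
    by rewrite aglM; [apply: agl_ext; ring|by detn|by det1].
  have e2 : (up (-1) * agl 0 0 (-1) 0 2 1)%g = agl 0 0 (-1) 1 2 (-1).
    by rewrite aglM; [apply: agl_ext; ring|by det1|by detn].
  have u1 : ((-1) * (-1) - 0 * 4 : R) \isU by detn.
  have u2 : ((-3) * 1 - (-1) * 2 : R) \isU by detn.
  by rewrite [X in (_ * X)%g = _]e1 [RHS]e2; apply: etrans (aglM _ _ _ _ u1 u2) _; apply: agl_ext; ring.
have u1 : ((-1) * (-1) - 0 * 4 : R) \isU by detn.
have u2 : (1 * 1 - 0 * (4 * 1) : R) \isU by det1.
have e : (agl 0 0 (-1) 0 4 (-1) * lo (4 * 1))%g = dg (-1) (-1).
  by apply: etrans (aglM _ _ _ _ u1 u2) _; apply: agl_ext; ring.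
rewrite -e; exact: groupM zK (lo_K 1).
Qed.

(** Conjugating [lo (4 * r)] by [up (-1)] gives a matrix of determinant one with first row (1 + 4 r,
    - 4 r); its triangular factors in [agl_LDU] lie in [K]. *)
Lemma dg_inv4_K r ai : (1 + 4 * r) * ai = 1 -> dg (1 + 4 * r) ai \in K.
Proof.
move=> aai; set a := 1 + 4 * r in aai *.
have yK : agl 0 0 a (- (4 * r)) (4 * r) (1 - 4 * r) \in K.
  have loI : lo (4 * r) \in Ik k.
    rewrite in_Ik_agl //; last by det1.
    rewrite !mod8E mul0r subr0 mulr1 /= andbT; move: (m8 r).
    by apply: all8P; vm_compute.
  apply: (K_conj (up_Ik (-1)) loI (lo_K r)).
  have u1 : (1 * 1 - (-1) * 0 : R) \isU by det1.
  have u2 : (1 * 1 - 0 * (4 * r) : R) \isU by det1.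
  have u3 : (a * (1 - 4 * r) - (- (4 * r)) * (4 * r)) \isU by rewrite /a; det1.
  apply: etrans (aglM _ _ _ _ u1 u2) _; apply: esym.
  by apply: etrans (aglM _ _ _ _ u3 u1) _; rewrite /a; apply: agl_ext; ring.
have d1 : a * (1 - 4 * r) - (- (4 * r)) * (4 * r) = 1 by rewrite /a; ring.
rewrite (agl_LDU aai (det_unit1 d1)) d1 mul1r in yK.
have upK : up (ai * - (4 * r)) \in K.
  by rewrite (_ : ai * _ = 2 * (- (2 * (r * ai)))); [exact: up_K|ring].
have loK : lo (4 * r * ai) \in K.
  by rewrite -mulrA; exact: lo_K.
by move: yK; rewrite (groupMl _ upK) (groupMr _ loK).
Qed.

Lemma dg_inv_K a ai : a * ai = 1 -> dg a ai \in K.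
Proof.
move=> aai; have ua : a \isU by apply/unitrPr; exists ai.
have oa : odd (m8 a) by rewrite odd_mod8 -unit_odd.
have : (m8 (a - 1) \in [:: 0; 4]) || (m8 (- a - 1) \in [:: 0; 4]).
  by move: oa; rewrite !mod8E; apply/implyP; move: (m8 a); apply: all8P; vm_compute.
case/orP => /mod8_quarter[r er].
  have aE : a = 1 + 4 * r by rewrite -er; ring.
  by rewrite aE; apply: dg_inv4_K; rewrite -aE.
have aE : - a = 1 + 4 * r by rewrite -er; ring.
have h : dg (- a) (- ai) \in K by rewrite aE; apply: dg_inv4_K; rewrite -aE mulrNN.
rewrite -(groupMr _ dg_neg1_K).
have u1 : (a * ai - 0 * 0) \isU by rewrite aai mul0r subr0 unitr1.
have u2 : ((-1) * (-1) - 0 * 0 : R) \isU by det1.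
rewrite (_ : (dg a ai * dg (-1) (-1))%g = dg (- a) (- ai)) //.
by apply: etrans (aglM _ _ _ _ u1 u2) _; apply: agl_ext; ring.
Qed.

(* The kernel of (b mod 2, det mod 8) on I_k lies in its Frattini subgroup. *)
Lemma Ik_frattini g (M := GLval g.2) :
  g \in Ik k -> ~~ odd (M 0 1) -> m8 (\det M) = 1 -> g \in K.
Proof.
rewrite /M => gI; have [e [f [a [b [c [d [gE u h8 eo]]]]]]] := Ik_aglP gI.
rewrite gE (GLval_agl e f u) det_mx2 mxE /= => ob det1'.
have ev : ~~ odd e by rewrite eo det1'.
have u0 : (1 * 1 - 0 * 0 : R) \isU by det1.
have ge : (tr e f * agl 0 0 a b c d)%g = agl e f a b c d.
  by apply: etrans (aglM _ _ _ _ u0 u) _; apply: agl_ext; ring.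
rewrite -ge (groupMl _ (tr_K f ev)).
have /and3P[oa _ _] := in_H8_odd h8; rewrite odd_mod8 -unit_odd // in oa.
have aai : a * a^-1 = 1 by rewrite mulrV.
have [b' bE] := even_half ob.
have [c' cE] : exists c', c = 4 * c'.
  apply: mod8_quarter; apply: in_H8_det1 h8 _.
  by rewrite -!mod8M // -mod8B.
set D := a * d - b * c in det1' u *.
have DDi : D * D^-1 = 1 by rewrite mulrV.
rewrite (agl_LDU aai u) -/D.
have upK : up (a^-1 * b) \in K by rewrite bE mulrCA; exact: up_K.
have loK : lo (c * a^-1) \in K by rewrite cE -mulrA; exact: lo_K.
rewrite (groupMl _ upK) (groupMr _ loK).
have i1 : (a * D^-1) * (D * a^-1) = 1.
  by transitivity ((a * a^-1) * (D * D^-1)); [ring|rewrite aai DDi mulr1].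
have u1 : (D * 1 - 0 * 0) \isU by rewrite mulr1 mul0r subr0.
have u2 : (a * D^-1 * (D * a^-1) - 0 * 0) \isU by rewrite i1 mul0r subr0 unitr1.
(* The diagonal factor is diag(D, 1), with D = 1 modulo 8, times a diagonal matrix of determinant
   one. *)
rewrite (_ : dg a (D * a^-1) = (dg D 1 * dg (a * D^-1) (D * a^-1))%g).
  exact: groupM (dg_mod8 det1') (dg_inv_K i1).
apply: esym; apply: etrans (aglM _ _ _ _ u1 u2) _; apply: agl_ext; try by ring.
by transitivity (a * (D * D^-1)); [ring|rewrite DDi mulr1].
Qed.

End FrattiniSubgroup.

(** * Maximal subgroups and the surjectivity criterion *)

(** In a 2-group a maximal subgroup is normal of index two, so [K] is the kernel of a nontrivial
    character to Z/2; the clauses state this on elements. *)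
Lemma two_group_index2 (gT : finGroupType) (H G : {group gT}) :
  (2.-group H)%g -> G \subset H -> G :!=: H -> exists K : {group gT},
  [/\ G \subset K, exists2 x, x \in H & x \notin K,
     forall x, x \in H -> (x * x)%g \in K &
     forall x y, x \in H -> y \in H -> x \notin K -> y \notin K -> (x * y)%g \in K].
Proof.
move=> pH sGH neq; have [e|[K mK sGK]] := maximal_exists sGH.
  by rewrite e eqxx in neq.
have nK := p_maximal_normal pH mK; have iK := p_maximal_index pH mK.
have sub : H \subset 'N(K)%g by apply: normal_norm.
have cH : #|(H / K)%g| = 2%N by rewrite card_quotient.
have prodK x y : x \in H -> y \in H -> x \notin K -> y \notin K -> (x * y)%g \in K.
  move=> xH yH xK yK.
  have xN := subsetP sub _ xH; have yN := subsetP sub _ yH.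
  have x1 : coset K x != 1%g by apply: contra xK => /eqP; apply: coset_idr.
  have y1 : coset K y != 1%g by apply: contra yK => /eqP; apply: coset_idr.
  have xHK := mem_quotient K xH; have yHK := mem_quotient K yH.
  have ox : #[coset K x]%g = 2%N.
    have := order_dvdG xHK; rewrite cH => /(@dvdn_leq _ 2 isT).
    by move: x1 (order_gt0 (coset K x)); rewrite -order_eq1; case: #[_]%g => [|[|[|]]].
  have cyc : <[coset K x]>%g = (H / K)%g.
    by apply/eqP; rewrite eqEcard cycle_subG xHK cH -orderE ox.
  have : coset K y \in <[coset K x]>%g by rewrite cyc.
  rewrite cycle2g // !inE (negPf y1) /= => /eqP yx.
  apply: coset_idr; first exact: groupM.
  have -> : coset K (x * y)%g = (coset K x * coset K y)%g by rewrite morphM.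
  by rewrite yx -expg2 -ox expg_order.
exists K; split=> //.
- have /properP[_ [x xH xK]] := maxgroupp mK; by exists x.
- move=> x xH; have [xK|xK] := boolP (x \in K); first exact: groupM.
  exact: prodK.
Qed.

Section SurjectivityCriterion.
Variable k : nat.
Hypothesis hk : (3 <= k)%N.
Local Notation n := (2 ^ k)%N.
Local Notation R := 'Z_n.
Local Notation m8 := (@mod8 n).
Local Notation agl := (@agl n).
Local Notation "a \isU" := (is_true (a \is a @GRing.unit R)) (at level 40).

Let mod8E := (mod8D hk, mod8N hk, mod8M hk, mod8_natr hk, mod8_1 hk, mod8_0 hk).

Definition congr1_mod2 j (g : AGL2 n) : Prop := exists e f a b c d : R,
  g = agl (2 ^+ j * e) (2 ^+ j * f) (1 + 2 ^+ j * a) (2 ^+ j * b) (2 ^+ j * c)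
    (1 + 2 ^+ j * d) /\
  ((1 + 2 ^+ j * a) * (1 + 2 ^+ j * d) - 2 ^+ j * b * (2 ^+ j * c)) \isU.

Lemma agl_sqr e f a b c d : (a * d - b * c) \isU ->
  (agl e f a b c d * agl e f a b c d)%g =
  agl (e + (e * a + f * c)) (f + (e * b + f * d)) (a * a + b * c) (a * b + b * d)
    (c * a + d * c) (c * b + d * d) /\
  ((a * a + b * c) * (c * b + d * d) - (a * b + b * d) * (c * a + d * c)) \isU.
Proof.
move=> u; split; first exact: (aglM _ _ _ _ u u).
rewrite (_ : _ - _ = (a * d - b * c) * (a * d - b * c)); last by ring.
by rewrite unitrM u.
Qed.

Lemma congr1_mod2_sqr j g : congr1_mod2 j.+1 g -> congr1_mod2 j.+2 (g * g)%g.
Proof.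
move=> [e [f [a [b [c [d [-> u]]]]]]].
have [-> {}u] := agl_sqr (2 ^+ j.+1 * e) (2 ^+ j.+1 * f) u.
pose q : R := 2 ^+ j.
exists (e + q * (e * a + f * c)), (f + q * (e * b + f * d)),
  (a + q * (a * a + b * c)), (b + q * (a * b + b * d)), (c + q * (c * a + d * c)),
  (d + q * (d * d + b * c)).
move: u; rewrite !exprS -/q => u; split; last first.
  by move: u; congr (_ \isU); ring.
by apply: (agl_ext); ring.
Qed.

(** Modulo 2 an element of I_k is a unitriangular matrix of size 3 with entries e, f, b, and such
    matrices over F_2 have fourth power 1. *)
Lemma Ik_sqr4 g : g \in Ik k -> congr1_mod2 1 (g * g * (g * g))%g.
Proof.
case/Ik_aglP => e [f [a [b [c [d [-> u h8 _]]]]]].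
have /and3P[oa od oc] := in_H8_odd h8; rewrite !odd_mod8 in oa od oc.
have odd_half (x : R) : odd x -> exists y, x = 1 + 2 * y.
  move=> ox; have [|y yE] := @even_half k (x - 1).
    by rewrite odd_ZpD // ox -odd_mod8 mod8E.
  by exists y; rewrite -yE; ring.
have [a' aE] := odd_half _ oa; have [d' dE] := odd_half _ od.
have [c' cE] := even_half oc.
have [-> {}u] := agl_sqr e f u.
have [-> {}u] := agl_sqr (e + (e * a + f * c)) (f + (e * b + f * d)) u.
pose e1 := e + e * a' + f * c'; pose f1 := f + f * d'; pose x := e * b.
pose a1 := 2 * a' + 2 * (a' * a') + b * c'; pose d1 := 2 * d' + 2 * (d' * d') + b * c'.
pose b1 := b * (1 + a' + d'); pose c1 := c' * 2 * (1 + a' + d').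
exists (2 * (e1 + e1 * a1) + (2 * f1 + x) * c1), (2 * f1 + x + (2 * f1 + x) * d1 + 2 * (e1 * b1)),
  (2 * a1 + 2 * (a1 * a1) + 2 * (b1 * c1)), (b1 * 2 * (1 + a1 + d1)),
  (c1 * 2 * (1 + a1 + d1)), (2 * d1 + 2 * (d1 * d1) + 2 * (b1 * c1)).
split; last first.
  by move: u; congr (_ \isU); rewrite aE dE cE /e1 /f1 /x /a1 /d1 /b1 /c1; ring.
by rewrite aE dE cE /e1 /f1 /x /a1 /d1 /b1 /c1; apply: agl_ext; ring.
Qed.

Lemma Ik_expg g : g \in Ik k -> (g ^+ (2 ^ (k + 2)) = 1)%g.
Proof.
move=> gI; have h j : congr1_mod2 j.+1 (g ^+ (2 ^ (j + 2)))%g.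
  elim: j => [|j IH].
    by rewrite (_ : g ^+ _ = g * g * (g * g))%g; [exact: Ik_sqr4|rewrite !expgS mulg1 !mulgA].
  by rewrite addSn expnSr expgM expg2; apply: congr1_mod2_sqr.
have [e [f [a [b [c [d [-> _]]]]]]] := h k.
have e2 : (2 : R) ^+ k.+1 = 0.
  rewrite exprSr -natrX (_ : (2 ^ k)%:R = 0 :> R) ?mul0r //.
  by apply: val_inj; exact: etrans (val_natr_exp2 hk _) (modnn _).
by rewrite agl1; apply: agl_ext; rewrite e2; ring.
Qed.

Lemma Ik_2group : (2.-group (Ik_group hk))%g.
Proof.
apply/pgroupP => p pr pd; have [x xI ox] := Cauchy pr pd.
have : (#[x]%g %| 2 ^ (k + 2))%N by rewrite order_dvdn; apply/eqP; apply: Ik_expg.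
by rewrite ox Euclid_dvdX // => /andP[]; rewrite dvdn_prime2 // inE.
Qed.

Definition b_char (g : AGL2 n) : bool := odd (GLval g.2 0 1).
Definition det_char (g : AGL2 n) : 'Z_8 := m8 (\det (GLval g.2)).

Lemma b_char_agl e f a b c d : (a * d - b * c) \isU -> b_char (agl e f a b c d) = odd b.
Proof. by move=> u; rewrite /b_char (GLval_agl e f u) mxE. Qed.

Lemma det_char_agl e f a b c d : (a * d - b * c) \isU ->
  det_char (agl e f a b c d) = m8 (a * d - b * c).
Proof. by move=> u; rewrite /det_char (GLval_agl e f u) det_mx2. Qed.

Lemma b_charM g h : g \in Ik k -> h \in Ik k -> b_char (g * h)%g = b_char g (+) b_char h.
Proof.
case/Ik_aglP => e [f [a [b [c [d [-> u h8 _]]]]]].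
case/Ik_aglP => e' [f' [a' [b' [c' [d' [-> u' h8' _]]]]]].
have [_ u2] : True /\ ((a' * a + b' * c) * (c' * b + d' * d)
    - (a' * b + b' * d) * (c' * a + d' * c)) \isU.
  split=> //; rewrite (_ : _ - _ = (a * d - b * c) * (a' * d' - b' * c')); last by ring.
  by rewrite unitrM u u'.
have /and3P[_ od _] := in_H8_odd h8; rewrite odd_mod8 in od.
have /and3P[oa _ _] := in_H8_odd h8'; rewrite odd_mod8 in oa.
apply: etrans (congr1 b_char (aglM _ _ _ _ u u')) _.
apply: etrans (b_char_agl _ _ u2) _.
apply: etrans (esym (congr2 addb (b_char_agl _ _ u) (b_char_agl _ _ u'))).
by rewrite odd_ZpD // !odd_ZpM // oa od andbT.
Qed.

Lemma det_charM (g h : AGL2 n) : det_char (g * h)%g = det_char g * det_char h.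
Proof.
by rewrite /det_char (_ : GLval (g * h)%g.2 = GLval h.2 *m GLval g.2) // det_mulmx mod8M // mulrC.
Qed.

Lemma det_char_odd g : g \in Ik k -> odd (det_char g).
Proof.
case/Ik_aglP => e [f [a [b [c [d [-> u h8 _]]]]]].
by rewrite (det_char_agl e f u) odd_mod8 -unit_odd.
Qed.

(** The quadratic characters of the quotient; on the image of Galois this one belongs to the square
    root of 17^x (-1)^y 2^z. *)
Definition parity (x y z : bool) (g : AGL2 n) : bool :=
  (x && b_char g) (+) ((y && (det_char g \in [:: 3; 7])) (+) (z && (det_char g \in [:: 3; 5]))).

Lemma Ik_generated (G : {group AGL2 n}) : G \subset Ik_group hk ->
  (forall x y z, [|| x, y | z] -> exists2 g, g \in G & parity x y z g) ->
  G :=: Ik k.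
Proof.
move=> sG surj; apply/eqP; apply/negPn/negP => neq.
have [K [sGK [g0 g0I g0K] sqK prK]] := two_group_index2 Ik_2group sG neq.
have nKM g h : g \in Ik k -> h \in Ik k ->
    ((g * h)%g \notin K) = (g \notin K) (+) (h \notin K).
  move=> gI hI; have [gK|gK] := boolP (g \in K); first by rewrite groupMl.
  have [hK|hK] := boolP (h \in K); first by rewrite groupMr // gK.
  by rewrite (prK g h).
(* Elements dual to the three basic characters: (b mod 2, det mod 8) is (1, 1), (0, -1) and (0,
   5). *)
pose g1 := agl 0 0 1 1 0 1; pose g2 := agl 0 0 (-1) 0 2 1; pose g3 := agl 1 0 5 0 2 1.
have u1 : (1 * 1 - 1 * 0 : R) \isU by apply: det_unit1; ring.
have u2 : ((-1) * 1 - 0 * 2 : R) \isU by apply: (det_unit_odd hk); rewrite !mod8E.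
have u3 : (5 * 1 - 0 * 2 : R) \isU by apply: (det_unit_odd hk); rewrite !mod8E.
have u0 : (1 * 1 - 0 * 0 : R) \isU by apply: det_unit1; ring.
have I1 : g1 \in Ik k by rewrite in_Ik_agl // !mod8E.
have I2 : g2 \in Ik k by rewrite in_Ik_agl // !mod8E.
have I3 : g3 \in Ik k by rewrite in_Ik_agl // !mod8E.
have b1 : b_char g1 = true by rewrite (b_char_agl _ _ u1) -odd_mod8 mod8E.
have b2 : b_char g2 = false by rewrite (b_char_agl _ _ u2) -odd_mod8 mod8E.
have b3 : b_char g3 = false by rewrite (b_char_agl _ _ u3) -odd_mod8 mod8E.
have d1 : det_char g1 = 1.
  by rewrite (det_char_agl _ _ u1) !mod8E; apply/eqP.
have d2 : det_char g2 = 7.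
  by rewrite (det_char_agl _ _ u2) !mod8E; apply/eqP.
have d3 : det_char g3 = 5.
  by rewrite (det_char_agl _ _ u3) !mod8E; apply/eqP.
clearbody g1 g2 g3; pose H := Ik_group hk.
have expI (c : bool) g : g \in Ik k -> (g ^+ c)%g \in Ik k.
  by move=> gI; case: c; rewrite ?expg1 // ?expg0 (group1 H).
have expK (c : bool) g : ((g ^+ c)%g \notin K) = c && (g \notin K).
  by case: c; rewrite ?expg1 // expg0 group1.
have claim g : g \in Ik k ->
    (g \notin K) = parity (g1 \notin K) (g2 \notin K) (g3 \notin K) g.
  move=> gI; pose x := b_char g.
  pose y := det_char g \in [:: 3; 7]; pose z := det_char g \in [:: 3; 5].
  (* [h] agrees with [g] in b modulo 2 and in the determinant modulo 8, so [g * h] falls under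
     [Ik_frattini], and whether [g] lies in [K] can be read on [h]. *)
  pose h := (g1 ^+ x * (g2 ^+ y * g3 ^+ z))%g.
  have h23I : (g2 ^+ y * g3 ^+ z)%g \in Ik k by apply: (groupM (G := H)); [exact: (expI y _ I2)|exact: (expI z _ I3)].
  have hI : h \in Ik k by apply: (groupM (G := H)); [exact: (expI x _ I1)|exact: h23I].
  have bexp (c : bool) (r : AGL2 n) : b_char (r ^+ c)%g = c && b_char r.
    by case: c; rewrite ?expg1 // expg0 agl1 (b_char_agl _ _ u0).
  have dexp (c : bool) (r : AGL2 n) : det_char (r ^+ c)%g = if c then det_char r else 1.
    case: c; rewrite ?expg1 // expg0 agl1 (det_char_agl _ _ u0).
    by rewrite !mod8E; apply/eqP.
  have ghK : (g * h)%g \in K.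
    apply: (Ik_frattini hk sqK (groupM (G := H) gI hI)).
      rewrite -/(b_char _) b_charM // /h b_charM ?expI // b_charM ?expI //.
      by rewrite !bexp b1 b2 b3 -/x !andbF andbT !addbF addbb.
    rewrite -/(det_char _) det_charM /h !det_charM !dexp d1 d2 d3.
    rewrite (_ : (if x then 1 else 1) = 1) ?mul1r; last by case: ifP.
    have := det_char_odd gI; rewrite /y /z; move: (det_char g) => D oD.
    by apply/eqP; move: D oD => D; apply/implyP; move: D; apply: all8P; vm_compute.
  have := nKM _ _ gI hI; rewrite ghK /h (nKM _ _ (expI x _ I1) h23I).
  rewrite (nKM _ _ (expI y _ I2) (expI z _ I3)) !expK /parity -/x -/y -/z.
  have aux (p X Y Z a b c : bool) :
      ~~ true = p (+) ((X && a) (+) ((Y && b) (+) (Z && c))) ->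
      p = (a && X) (+) ((b && Y) (+) (c && Z)) by case: p X Y Z a b c => [] [] [] [] [] [] [].
  exact: aux.
have nz : [|| g1 \notin K, g2 \notin K | g3 \notin K].
  move: g0K; rewrite (claim _ g0I) /parity.
  by case: (g1 \in K) (g2 \in K) (g3 \in K) => [] [] [].
have [g gG] := surj _ _ _ nz.
rewrite -(claim _ (subsetP sG _ gG)) => /negP; apply.
exact: (subsetP sGK _ gG).
Qed.

End SurjectivityCriterion.

(** * The action on torsion points *)

Section OctalAction.
Variable F : fieldType.
Hypothesis char0 : [pchar F] =i pred0.
Local Notation EF := (elliptic (smooth_E char0)).
Implicit Types R S : EF.

Lemma ell_mulr4 R : val (R *+ 4) = add_point E (add_point E (val R) (val R)) (add_point E (val R) (val R)).
Proof. by rewrite -!val_ellD -!mulr2n -mulrnA. Qed.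

Lemma octal_4R R S i t k e : octal (val R) (val S) i t k e -> val (R *+ 4) = short_point e 0.
Proof. by move=> o; rewrite ell_mulr4; exact: octal_dblR o. Qed.

Lemma octal_4S R S i t k e : octal (val R) (val S) i t k e -> val (S *+ 4) = short_point 0 0.
Proof. by move=> o; rewrite ell_mulr4; exact: octal_dblS o. Qed.

Lemma octal_8 R S i t k e : octal (val R) (val S) i t k e -> R *+ 8 = 0 /\ S *+ 8 = 0.
Proof.
move=> o; split; apply: val_inj; rewrite (mulrnA _ 4 2) mulr2n val_ellD.
  by rewrite (octal_4R o) short_dbl0.
by rewrite (octal_4S o) short_dbl0.
Qed.

(** For a primitive eighth root of unity zeta, [i_sign] and [t_sign] record whether zeta -> zeta^D
    negates i = zeta^2 and the square root zeta + zeta^-1 of 2. *)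
Definition i_sign (D : 'Z_8) : bool := D \in [:: 3; 7].
Definition t_sign (D : 'Z_8) : bool := D \in [:: 3; 5].

Lemma mulrn_mod8 R m : R *+ 8 = 0 -> R *+ (m %% 8) = R *+ m.
Proof. by move=> h; rewrite {2}(divn_eq m 8) mulrnDr mulnC mulrnA h mul0rn add0r. Qed.

Lemma odd_mod8_cases m : odd m -> exists2 r, r \in [:: 1; 3; 5; 7]%N & (m %% 8 = r)%N.
Proof.
move=> om; exists (m %% 8)%N => //.
have : odd (m %% 8) by rewrite odd_mod.
by have := ltn_pmod m (isT : 0 < 8)%N; case: (m %% 8)%N => [|[|[|[|[|[|[|[|]]]]]]]].
Qed.

(** Odd multiples modulo 8 come from -1 and 5: 5 R = R + 4 R is a translation by (e, 0), 3 R = - 5 R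
    and 7 R = - R. *)
Lemma octal_mulR R S i t k e a : odd a -> octal (val R) (val S) i t k e ->
  octal (val (R *+ a)) (val S) ((-1) ^+ i_sign a%:R * i) ((-1) ^+ t_sign a%:R * t) k e.
Proof.
move=> oa o; have [R8 _] := octal_8 o.
have o5 : octal (val (R *+ 5)) (val S) i (- t) k e.
  by rewrite mulrS val_ellD (octal_4R o); apply: octal_addT1.
rewrite -(mulrn_mod8 a R8) -(Zp_nat_mod (isT : 1 < 8)%N a).
have [r r8 ->] := odd_mod8_cases oa.
move: r8; rewrite !inE => /or4P[] /eqP ->.
- by rewrite (_ : i_sign 1%:R = false) // (_ : t_sign 1%:R = false) // !expr0 !mul1r.
- rewrite (_ : i_sign 3%:R = true) // (_ : t_sign 3%:R = true) // !expr1 !mulN1r (_ : R *+ 3 = - (R *+ 5)).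
    by rewrite val_ellN; apply: octal_oppl o5.
  by apply/eqP; rewrite -addr_eq0 -mulrnDr R8.
- by rewrite (_ : i_sign 5%:R = false) // (_ : t_sign 5%:R = true) // expr0 expr1 mul1r mulN1r.
- rewrite (_ : i_sign 7%:R = true) // (_ : t_sign 7%:R = false) // expr0 expr1 mul1r mulN1r (_ : R *+ 7 = - R).
    by rewrite val_ellN; apply: octal_oppl o.
  by apply/eqP; rewrite -addr_eq0 -mulrSr R8.
Qed.

Lemma octal_mulS R S i t k e d : odd d -> octal (val R) (val S) i t k e ->
  octal (val R) (val (S *+ d)) ((-1) ^+ i_sign d%:R * i) ((-1) ^+ t_sign d%:R * t) k e.
Proof.
move=> od o; have [_ S8] := octal_8 o.
have o5 : octal (val R) (val (S *+ 5)) i (- t) k e.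
  by rewrite mulrS val_ellD (octal_4S o); apply: octal_addT2.
rewrite -(mulrn_mod8 d S8) -(Zp_nat_mod (isT : 1 < 8)%N d).
have [r r8 ->] := odd_mod8_cases od.
move: r8; rewrite !inE => /or4P[] /eqP ->.
- by rewrite (_ : i_sign 1%:R = false) // (_ : t_sign 1%:R = false) // !expr0 !mul1r.
- rewrite (_ : i_sign 3%:R = true) // (_ : t_sign 3%:R = true) // !expr1 !mulN1r (_ : S *+ 3 = - (S *+ 5)).
    by rewrite val_ellN; apply: octal_oppr o5.
  by apply/eqP; rewrite -addr_eq0 -mulrnDr S8.
- by rewrite (_ : i_sign 5%:R = false) // (_ : t_sign 5%:R = true) // expr0 expr1 mul1r mulN1r.
- rewrite (_ : i_sign 7%:R = true) // (_ : t_sign 7%:R = false) // expr0 expr1 mul1r mulN1r (_ : S *+ 7 = - S).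
    by rewrite val_ellN; apply: octal_oppr o.
  by apply/eqP; rewrite -addr_eq0 -mulrSr S8.
Qed.

Lemma octal_addS R S i t k e b : octal (val R) (val S) i t k e ->
  octal (val (R + S *+ b)) (val S) i t k (if odd b then - 5 - e else e).
Proof.
move=> o; elim: b => [|b IH]; first by rewrite addr0.
rewrite mulrSr addrA val_ellD; have := octal_add char0 IH; rewrite /=.
by case: (odd b) => //=; rewrite (_ : - 5 - (- 5 - e) = e) //; ring.
Qed.

Lemma octal_add2R R S i t k e m : octal (val R) (val S) i t k e ->
  octal (val R) (val (S + R *+ m.*2)) i t ((-1) ^+ odd m * k) e.
Proof.
move=> o; elim: m => [|m IH]; first by rewrite addr0 mul1r.
rewrite doubleS -addn2 mulrnDr addrA val_ellD mulr2n val_ellD.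
have := octal_shear char0 IH; rewrite -mulNr -signrN /=.
by [].
Qed.

(** Elimination modulo 8, where a^2 = 1: R becomes R + a b S, and a times this is R' = a R + b S; S
    becomes d' S with d' = d - a b c, and adding the even multiple c a of R' gives c R + d S. The
    determinant is a d'. *)
Lemma octal_action R S i t k e (a b c d : nat) (D : 'Z_8 := a%:R * d%:R - b%:R * c%:R) :
  octal (val R) (val S) i t k e -> odd a -> odd d -> ~~ odd c ->
  octal (val (R *+ a + S *+ b)) (val (R *+ c + S *+ d))
    ((-1) ^+ i_sign D * i) ((-1) ^+ t_sign D * t) ((-1) ^+ odd c./2 * k)
    (if odd b then - 5 - e else e).
Proof.
move=> o oa od ec; have [R8 S8] := octal_8 o.
have cE : c = (c./2).*2 by rewrite -[LHS]odd_double_half (negPf ec).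
have aa : (a * a %% 8 = 1)%N.
  rewrite -modnMm; have [r r8 ->] := odd_mod8_cases oa.
  by move: r8; rewrite !inE => /or4P[] /eqP ->.
pose d' := (d + 7 * (c * a * b))%N.
have od' : odd d' by rewrite /d' oddD !oddM (negPf ec) od.
have o1 := octal_addS (a * b) o; rewrite oddM oa andTb in o1.
have o2 := octal_mulR oa o1; have o3 := octal_mulS od' o2.
have o4 := octal_add2R (c./2 * a) o3.
have RE : (R + S *+ (a * b)) *+ a = R *+ a + S *+ b.
  rewrite mulrnDl -mulrnA; congr (_ + _).
  by rewrite -[LHS](mulrn_mod8 _ S8) mulnAC -modnMml aa mul1n mulrn_mod8.
have SE : S *+ d' + (R + S *+ (a * b)) *+ a *+ (c./2 * a).*2 = R *+ c + S *+ d.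
  rewrite RE doubleMl -cE mulrnDl -!mulrnA addrCA; congr (_ + _).
    by rewrite -[LHS](mulrn_mod8 _ R8) mulnCA -modnMmr aa muln1 mulrn_mod8.
  rewrite -mulrnDr /d' (_ : d + _ + _ = d + 8 * (c * a * b))%N; last by ring.
  by rewrite mulrnDr mulrnA S8 mul0rn addr0.
rewrite SE RE in o4.
have DE : D = a%:R * d'%:R.
  rewrite /D /d' natrD !natrM mulrDr (_ : 7 = -1 :> 'Z_8); last exact: val_inj.
  rewrite (_ : a%:R * (-1 * (c%:R * a%:R * b%:R)) = - ((a * a)%:R * (b%:R * c%:R))).
    by rewrite -(Zp_nat_mod (isT : 1 < 8)%N (a * a)) aa mul1r.
  by rewrite natrM; ring.
have signs (f : 'Z_8 -> bool) (u : F) : (forall x y : 'Z_8, odd x -> odd y -> f (x * y) = f x (+) f y) ->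
    (-1) ^+ f d'%:R * ((-1) ^+ f a%:R * u) = (-1) ^+ f D * u.
  move=> fM; rewrite mulrA -signr_addb DE fM; first by rewrite addbC.
    by rewrite val_Zp_nat // odd_mod.
  by rewrite val_Zp_nat // odd_mod.
have iM (x y : 'Z_8) : odd x -> odd y -> i_sign (x * y) = i_sign x (+) i_sign y.
  move=> ox oy; apply/eqP; move: oy; apply/implyP; move: y; apply: all8P.
  by move: x ox => x; apply/implyP; move: x; apply: all8P.
have tM (x y : 'Z_8) : odd x -> odd y -> t_sign (x * y) = t_sign x (+) t_sign y.
  move=> ox oy; apply/eqP; move: oy; apply/implyP; move: y; apply: all8P.
  by move: x ox => x; apply/implyP; move: x; apply: all8P.
by rewrite (signs _ _ iM) (signs _ _ tM) oddM oa andbT in o4.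
Qed.

End OctalAction.

Section EllMap.
Variables (F F' : fieldType) (W : weierstrass) (f : {rmorphism F -> F'}).
Variables (sm : smooth_curve F W) (sm' : smooth_curve F' W).

Definition ell_map (T : elliptic sm) : elliptic sm' :=
  Sub (map_point f (val T)) (etrans (on_curve_map W f (val T)) (valP T)).

Lemma val_ell_map T : val (ell_map T) = map_point f (val T).
Proof. by []. Qed.

Lemma ell_mapD : {morph ell_map : S T / S + T}.
Proof. by move=> S T; apply: val_inj; exact: map_point_add. Qed.

Lemma ell_map0 : ell_map 0 = 0.
Proof. exact: val_inj. Qed.

Lemma ell_mapMn T m : ell_map (T *+ m) = ell_map T *+ m.
Proof. by elim: m => [|m IH]; rewrite ?mulr0n ?ell_map0 // !mulrS ell_mapD IH. Qed.

Lemma ell_map_inj : injective ell_map.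
Proof. by move=> S T /(congr1 val) /= /map_point_inj /val_inj. Qed.

End EllMap.

Section OctalMap.
Variables (F F' : fieldType) (f : {rmorphism F -> F'}).

Lemma map_half_point (r1 r2 r3 : F) :
  map_point f (half_point r1 r2 r3) = half_point (f r1) (f r2) (f r3).
Proof.
rewrite /half_point /short_point /=.
by congr (Some (_, _)); rewrite !(rmorph_nat, fmorphV, rmorphB, rmorphD, rmorphM).
Qed.

Lemma half_coord_map (r1 r2 r3 : F) :
  half_coord r1 r2 r3 -> half_coord (f r1) (f r2) (f r3).
Proof.
case=> h1 h2; split.
  by rewrite -!rmorphXn -!rmorphB -rmorphD h1 rmorphN rmorph_nat.
by rewrite -!rmorphXn -!rmorphB -rmorphM h2 rmorphN rmorph_nat.
Qed.

Lemma octal_map R S i t k e : octal R S i t k e ->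
  octal (map_point f R) (map_point f S) (f i) (f t) (f k) (f e).
Proof.
case=> rho v w z [i2 t2 w2 z2 rho0 v0 w0 z0 hs hp] -> -> -> ->.
have e1E : f (oct_e1 rho v w) = oct_e1 (f rho) (f v) (f w).
  by rewrite /oct_e1 !(rmorph_nat, fmorphV, rmorphXn, rmorphM).
have e3E : f (oct_e3 rho v w z) = oct_e3 (f rho) (f v) (f w) (f z).
  by rewrite /oct_e3 !(rmorph_nat, fmorphV, rmorphXn, rmorphM).
exists (f rho) (f v) (f w) (f z).
- split; rewrite ?fmorph_eq0 //.
  + by rewrite -rmorphXn i2 rmorphN1.
  + by rewrite -rmorphXn t2 rmorph_nat.
  + by rewrite -!rmorphXn w2 rmorphD rmorph1.
  + by rewrite -!rmorphXn z2 rmorphB rmorph1.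
  + by rewrite -e1E -e3E -rmorphD hs rmorphN rmorph_nat.
  + by rewrite -e1E -e3E -rmorphM hp rmorphN rmorph_nat.
- by rewrite /oct_R map_half_point !(rmorph1, fmorphV, rmorphXn, rmorphD, rmorphM).
- by rewrite /oct_S map_half_point !(fmorphV, rmorphXn, rmorphM).
- by rewrite /oct_kappa !(rmorph_nat, fmorphV, rmorphXn, rmorphN, rmorphM).
- exact: e1E.
Qed.

End OctalMap.

Section HalfLabel.
Variable F : fieldType.
Hypothesis char0 : [pchar F] =i pred0.

(** Exchanging e1 and e3, as an automorphism may do, exchanges r1 and r3, whereas r2 belongs to the
    rational root 0 and is unaffected. *)
Lemma half_point_r2 (r1 r2 r3 s1 s2 s3 : F) : half_coord r1 r2 r3 -> half_coord s1 s2 s3 ->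
  half_point r1 r2 r3 = half_point s1 s2 s3 -> r2 = s2.
Proof.
move=> hr hs e; case: (hr) (hs) => h1 h2 [h1' h2'].
have : ((r2 ^+ 2 - r1 ^+ 2) - (s2 ^+ 2 - s1 ^+ 2)) *
   ((r2 ^+ 2 - r1 ^+ 2) - (s2 ^+ 2 - s3 ^+ 2)) = 0.
  move: h1 h2 h1' h2'.
  move: (_ - r1 ^+ 2) (_ - r3 ^+ 2) (_ - s1 ^+ 2) (_ - s3 ^+ 2) => a b c d h1 h2 h1' h2'.
  transitivity (a * ((a + b) - (c + d)) - (a * b - c * d)); first by ring.
  by rewrite h1 h2 h1' h2' !subrr mulr0 subr0.
move/eqP; rewrite mulf_eq0 !subr_eq0 => /orP[] /eqP e1.
  by have [] := half_point_inj char0 hr hs e1 e.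
rewrite (half_point_swap s1) in e.
by have [] := half_point_inj char0 hr (half_coord_swap hs) e1 e.
Qed.

End HalfLabel.

Section Action.
Variables (F : fieldType) (k : nat).
Hypothesis char0 : [pchar F] =i pred0.
Hypothesis hk : (3 <= k)%N.
Local Notation n := (2 ^ k)%N.
Local Notation EF := (elliptic (smooth_E char0)).
Variables A B beta : EF.
Hypothesis A_tors : A *+ n = 0.
Hypothesis B_tors : B *+ n = 0.
Hypothesis AB_span : forall U : EF, U *+ n = 0 ->
  exists c : nat * nat, [/\ (c.1 < n)%N, (c.2 < n)%N & U = A *+ c.1 + B *+ c.2].
Hypothesis AB_free : forall c1 c2 d1 d2, (c1 < n)%N -> (c2 < n)%N -> (d1 < n)%N -> (d2 < n)%N ->
  A *+ c1 + B *+ c2 = A *+ d1 + B *+ d2 -> c1 = d1 /\ c2 = d2.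
Hypothesis B_half : val (B *+ 2 ^ k.-1) = Some (0, 0).
Hypothesis beta_div : val (beta *+ n) = P F.

Local Notation T1 := (A *+ 2 ^ k.-1).
Local Notation T2 := (B *+ 2 ^ k.-1).
Local Notation R := (A *+ 2 ^ (k - 3)).
Local Notation S := (B *+ 2 ^ (k - 3)).

Let two_neq0 : 2 != 0 :> F := char0_natr char0 1.

Lemma half_lt : (2 ^ k.-1 < n)%N.
Proof. by rewrite ltn_exp2l // prednK // (leq_trans _ hk). Qed.

Lemma expn2_half : (2 ^ k.-1 * 2 = n)%N.
Proof. by rewrite -expnSr prednK // (leq_trans _ hk). Qed.

Lemma expn2_gt0 : (0 < n)%N.
Proof. by rewrite expn_gt0. Qed.

Lemma T1_neq0 : T1 != 0.
Proof.
apply/eqP => h; have [] := @AB_free (2 ^ k.-1) 0 0 0 half_lt expn2_gt0 expn2_gt0 expn2_gt0.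
  by rewrite h !mulr0n.
by move/eqP; rewrite expn_eq0.
Qed.

Lemma T1_neqT2 : T1 != T2.
Proof.
apply/eqP => h; have [] := @AB_free (2 ^ k.-1) 0 0 (2 ^ k.-1) half_lt expn2_gt0 expn2_gt0 half_lt.
  by rewrite h !mulr0n addr0 add0r.
by move/eqP; rewrite expn_eq0.
Qed.

Lemma T2_neq0 : T2 != 0.
Proof. by apply/eqP => /(congr1 val); rewrite B_half. Qed.

Lemma dbl_T1 : T1 *+ 2 = 0.
Proof. by rewrite -mulrnA expn2_half. Qed.

Lemma dbl_T2 : T2 *+ 2 = 0.
Proof. by rewrite -mulrnA expn2_half. Qed.

Lemma mulrn_odd (T : EF) m : T *+ 2 = 0 -> T *+ m = if odd m then T else 0.
Proof.
move=> h; rewrite -[in LHS](odd_double_half m) mulrnDr -mul2n mulrnA h mul0rn addr0.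
by case: (odd m).
Qed.

Lemma oct_half : (2 ^ (k - 3) * 4 = 2 ^ k.-1)%N.
Proof. by rewrite -[4%N]/(2 ^ 2)%N -expnD; congr (2 ^ _)%N; lia. Qed.

Lemma T2E : val T2 = short_point 0 0.
Proof. by rewrite B_half /short_point subr0 !mul0r. Qed.

Lemma T1E : exists e : F, val T1 = short_point e 0 /\ e * (- 5 - e) = - 32.
Proof.
have d1 : add_point E (val T1) (val T1) = None.
  by rewrite -val_ellD -mulr2n dbl_T1.
have n1 := T1_neq0; have n12 := T1_neqT2.
have [X [Y E1]] : exists X Y, val T1 = short_point X Y.
  case E1 : (val T1) => [[x y]|]; last by case/eqP: n1; apply: val_inj.
  by exists (4 * x), (8 * y + 4 * x); rewrite short_pointE.
rewrite E1 in d1.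
have Y0 : Y = 0.
  by apply/eqP/negPn/negP => Y0; rewrite short_dbl // in d1.
exists X; rewrite E1 Y0; split=> //.
have := valP T1; rewrite /= -[sval _]/(val T1) E1 Y0 short_on_curve // expr0n => /eqP oc.
have X0 : X != 0.
  apply/eqP => X0; case/eqP: n12; apply: val_inj.
  by rewrite E1 T2E Y0 X0.
apply: (mulfI X0); apply/eqP; rewrite -subr_eq0; apply/eqP.
rewrite (_ : _ - _ = - (X ^+ 3 + 5 * X ^+ 2 - 32 * X)); last by ring.
by rewrite -oc oppr0.
Qed.

Lemma octal_basis : exists i t kap e, octal (val R) (val S) i t kap e /\ val T1 = short_point e 0.
Proof.
have [e [T1e he]] := T1E.
have four (T : EF) : add_point E (add_point E (val (T *+ 2 ^ (k - 3))) (val (T *+ 2 ^ (k - 3))))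
    (add_point E (val (T *+ 2 ^ (k - 3))) (val (T *+ 2 ^ (k - 3)))) = val (T *+ 2 ^ k.-1).
  by rewrite -ell_mulr4 -mulrnA oct_half.
have [i [t [kap o]]] := octal_exists char0 (valP R) (valP S) he
   (etrans (four A) T1e) (etrans (four B) T2E).
by exists i, t, kap, e.
Qed.

Section Endo.
Variable f : {rmorphism F -> F}.
Local Notation phif := (@ell_map F F E f (smooth_E char0) (smooth_E char0)).

Definition acts (g : AGL2 n) : Prop :=
  [/\ phif beta = beta + (A *+ g.1 0 0 + B *+ g.1 0 1),
      phif A = A *+ (GLval g.2 0 0) + B *+ (GLval g.2 0 1) &
      phif B = A *+ (GLval g.2 1 0) + B *+ (GLval g.2 1 1)].

Lemma phif_T2 : phif T2 = T2.
Proof. by apply: val_inj; rewrite val_ell_map B_half /= rmorph0. Qed.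

(** (0, 0) = 2^(k-1) B is rational, hence fixed by [f]: this makes d odd and c even, and injectivity
    of [f] makes a odd. *)
Lemma act_parity a b c d : phif A = A *+ a + B *+ b -> phif B = A *+ c + B *+ d ->
  [/\ odd a, odd d & ~~ odd c].
Proof.
move=> hA hB.
have hT1 : phif T1 = T1 *+ a + T2 *+ b.
  by rewrite ell_mapMn hA mulrnDl (mulrnAC A) (mulrnAC B).
have hT2 : T2 = T1 *+ c + T2 *+ d.
  by rewrite -[LHS]phif_T2 ell_mapMn hB mulrnDl (mulrnAC A) (mulrnAC B).
rewrite (mulrn_odd _ dbl_T1) (mulrn_odd _ dbl_T2) in hT1.
rewrite (mulrn_odd _ dbl_T1) (mulrn_odd _ dbl_T2) in hT2.
have n1 := T1_neq0; have n2 := T2_neq0; have n12 := T1_neqT2.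
split.
- apply/negPn/negP => oa; rewrite (negPf oa) add0r in hT1.
  case: (odd b) hT1 => hT1.
    by case/eqP: n12; apply: (@ell_map_inj _ _ _ f _ (smooth_E char0)); rewrite hT1 phif_T2.
  by case/eqP: n1; apply: (@ell_map_inj _ _ _ f _ (smooth_E char0)); rewrite hT1 ell_map0.
- apply/negPn/negP => od; rewrite (negPf od) addr0 in hT2.
  case: (odd c) hT2 => hT2; first by rewrite hT2 eqxx in n12.
  by rewrite hT2 eqxx in n2.
- apply/negP => oc; rewrite oc in hT2.
  case: (odd d) hT2 => hT2.
    have : T1 = 0 by apply: (addIr T2); rewrite -hT2 add0r.
    by move/eqP; rewrite (negPf n1).
  by rewrite hT2 addr0 eqxx in n12.
Qed.

Lemma phif_tors (U : EF) : U *+ n = 0 -> phif U *+ n = 0.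
Proof. by move=> h; rewrite -ell_mapMn h ell_map0. Qed.

Lemma acts_exists : exists g, acts g.
Proof.
have [[a b] [la lb hA]] := AB_span (phif_tors A_tors).
have [[c d] [lc ld hB]] := AB_span (phif_tors B_tors).
(* P is rational, so [beta] and its image have the same multiple by 2^k. *)
have hU : (phif beta - beta) *+ n = 0.
  rewrite mulrnBl -ell_mapMn; apply/eqP; rewrite subr_eq0; apply/eqP/val_inj.
  by rewrite val_ell_map beta_div /= rmorph_nat.
have [[e f'] [le lf hb]] := AB_span hU; rewrite /= in la lb lc ld le lf hA hB hb.
have [oa od oc] := act_parity hA hB.
have vE m : (m < n)%N -> ((m%:R : 'Z_n) : nat) = m.
  by move=> lm; rewrite (val_natr_exp2 hk) modn_small.
have u : (a%:R * d%:R - b%:R * c%:R : 'Z_n) \is a GRing.unit.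
  rewrite unit_odd // odd_ZpD // !odd_ZpM // vE // vE // oa od.
  have : ~~ odd (- (b%:R * c%:R : 'Z_n))%R.
    rewrite -odd_mod8 (mod8N hk) (mod8M hk) !mod8_natr //.
    have [c' cE] : exists c', c = (2 * c')%N.
      by exists c./2; rewrite mul2n -[LHS]odd_double_half (negPf oc).
    rewrite cE natrM; move: (b%:R : 'Z_8) (c'%:R : 'Z_8) => x y.
    by move: y; apply: all8P; move: x; apply: all8P.
  by move/negPf => ->.
exists (agl e%:R f'%:R a%:R b%:R c%:R d%:R); split.
- by rewrite !mxE /= !vE // -hb addrC subrK.
- by rewrite (GLval_agl _ _ u) !mxE /= !vE.
- by rewrite (GLval_agl _ _ u) !mxE /= !vE.
Qed.

Section Acting.
Variables (g : AGL2 n).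
Hypothesis fg : acts g.
Local Notation M := (GLval g.2).

Lemma acts_odd : [/\ odd (M 0 0), odd (M 1 1) & ~~ odd (M 1 0)].
Proof. by case: fg => _ hA hB; apply: act_parity hA hB. Qed.

Variables (i t kap e : F).
Hypothesis o : octal (val R) (val S) i t kap e.
Hypothesis T1e : val T1 = short_point e 0.

Lemma det_charE :
  det_char g = (M 0 0 : nat)%:R * (M 1 1 : nat)%:R - (M 0 1 : nat)%:R * (M 1 0 : nat)%:R.
Proof.
by rewrite /det_char [X in \det X]mx2_eta det_mx2 (mod8B hk) !(mod8M hk).
Qed.

Lemma acts_octal : [/\ f i = (-1) ^+ i_sign (det_char g) * i,
  f t = (-1) ^+ t_sign (det_char g) * t,
  f kap = (-1) ^+ odd (M 1 0 : nat)./2 * kap &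
  f e = if b_char g then - 5 - e else e].
Proof.
have [oa od oc] := acts_odd; case: fg => _ hA hB.
have o1 : octal (val (phif R)) (val (phif S)) (f i) (f t) (f kap) (f e) := octal_map f o.
have RE : phif R = R *+ M 0 0 + S *+ M 0 1.
  by rewrite ell_mapMn hA mulrnDl (mulrnAC A) (mulrnAC B).
have SE : phif S = R *+ M 1 0 + S *+ M 1 1.
  by rewrite ell_mapMn hB mulrnDl (mulrnAC A) (mulrnAC B).
have o2 := octal_action (M 0 1) o oa od oc.
rewrite RE SE in o1; have [-> -> -> ->] := octal_uniq char0 o1 o2.
by rewrite -det_charE.
Qed.

Lemma signr_inj (b c : bool) (x : F) : x != 0 -> (-1) ^+ b * x = (-1) ^+ c * x -> b = c.
Proof.
have n0 (y : F) : y != 0 -> - y = y -> False.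
  move=> y0 h; have : 2 * y = 0 by rewrite -[RHS](addNr y) h; ring.
  by move/eqP; rewrite mulf_eq0 (negPf two_neq0) (negPf y0).
by case: b c => [] [] // x0; rewrite expr0 expr1 mulN1r mul1r => h; case: (n0 x x0).
Qed.

(** Both [kap] and 4 i t square to -32, so they agree up to sign, and the sign of [f] on [kap] is
    the product of its signs on i and t. *)
Lemma acts_kappa : odd (M 1 0 : nat)./2 = i_sign (det_char g) (+) t_sign (det_char g).
Proof.
have [i2 t2 k2 _] := octal_root2 char0 o; have [fi ft fk _] := acts_octal.
have k0 : kap != 0 by rewrite -sqrf_eq0 k2 oppr_eq0 (char0_natr char0 31).
have [s kE] : exists s : bool, kap = (-1) ^+ s * (4 * i * t).
  have : (kap - 4 * i * t) * (kap + 4 * i * t) = 0.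
    transitivity (kap ^+ 2 - 16 * (i ^+ 2 * t ^+ 2)); first by ring.
    by rewrite k2 i2 t2; ring.
  move/eqP; rewrite mulf_eq0 subr_eq0 addr_eq0 => /orP[] /eqP h.
    by exists false; rewrite mul1r.
  by exists true; rewrite mulN1r.
apply: (signr_inj k0); rewrite -fk {1}kE !rmorphM rmorph_sign !rmorph_nat fi ft.
rewrite signr_addb kE.
by move: ((-1) ^+ i_sign _) ((-1) ^+ t_sign _) ((-1) ^+ s) => x y z; ring.
Qed.

(** [ga] is a half of P, and X(P) = 8 in the short model, so its second half coordinate r2 is 2 t up
    to sign. The image of [ga] is [ga] translated by [T1] and [T2] according to the parities of the
    two translation coordinates; [T1] negates r2 and [T2] keeps it. *)
Lemma acts_e : odd (g.1 0 0) = t_sign (det_char g).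
Proof.
have [_ t2 _ e153] := octal_root2 char0 o; have [_ ft _ fe] := acts_octal.
have [[oa od oc] [hb _ _]] := (acts_odd, fg).
pose ga := beta *+ 2 ^ k.-1.
have ga2 : add_point E (val ga) (val ga) = short_point 8 24.
  rewrite -val_ellD -mulr2n -mulrnA expn2_half beta_div /P /short_point.
  by congr (Some (_, _)); field; rewrite ?(char0_natr char0 3) ?(char0_natr char0 7).
have [r1 [r2 [r3 [hr er gaE]]]] : exists r1 r2 r3, [/\ half_coord r1 r2 r3,
    e = r2 ^+ 2 - r1 ^+ 2 & val ga = half_point r1 r2 r3].
  have [X [Y gaE]] : exists X Y, val ga = short_point X Y.
    case gaE : (val ga) ga2 => [[x y]|] // _.
    by exists (4 * x), (8 * y + 4 * x); rewrite short_pointE.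
  have Y0 : Y != 0.
    by apply/eqP => Y0; move: ga2; rewrite gaE Y0 short_dbl0.
  have oc' : on_curve E (short_point X Y) by rewrite -gaE; apply: valP.
  have [e' [T1e' he]] := T1E.
  have ee : e' = e by have [] := short_point_inj char0 (etrans (esym T1e') T1e).
  rewrite ee in he; have hs : e + (- 5 - e) = - 5 by ring.
  have [r1 [r2 [r3 [? ? ?]]]] := half_point_surj char0 hs he oc' Y0.
  by exists r1, r2, r3; rewrite gaE.
have r22 : r2 ^+ 2 = 8.
  by move: ga2; rewrite gaE half_dbl // => /(short_point_inj char0)[].
have r20 : r2 != 0 by rewrite -sqrf_eq0 r22 (char0_natr char0 7).
have [s r2E] : exists s : bool, r2 = (-1) ^+ s * (2 * t).
  have : (r2 - 2 * t) * (r2 + 2 * t) = 0.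
    transitivity (r2 ^+ 2 - 4 * t ^+ 2); first by ring.
    by rewrite r22 t2; ring.
  move/eqP; rewrite mulf_eq0 subr_eq0 addr_eq0 => /orP[] /eqP h.
    by exists false; rewrite mul1r.
  by exists true; rewrite mulN1r.
have fr2 : f r2 = (-1) ^+ t_sign (det_char g) * r2.
  rewrite {1}r2E !rmorphM rmorph_sign rmorph_nat ft r2E.
  by move: ((-1) ^+ t_sign _) ((-1) ^+ s) => x y; ring.
have fga : phif ga = ga + T1 *+ odd (g.1 0 0) + T2 *+ odd (g.1 0 1).
  rewrite ell_mapMn hb !mulrnDl addrA (mulrnAC A) (mulrnAC B).
  rewrite (mulrn_odd (g.1 0 0) dbl_T1) (mulrn_odd (g.1 0 1) dbl_T2) -/ga.
  by case: (odd (g.1 0 0)); case: (odd (g.1 0 1)); rewrite ?mulr1n ?mulr0n.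
have [s1 [s3 [hs ss]]] : exists s1 s3, half_coord s1 ((-1) ^+ odd (g.1 0 0) * r2) s3 /\
    val (phif ga) = half_point s1 ((-1) ^+ odd (g.1 0 0) * r2) s3.
  have [q1 [q3 [hq qq eq]]] : exists q1 q3, [/\ half_coord q1 ((-1) ^+ odd (g.1 0 0) * r2) q3,
     val (ga + T1 *+ odd (g.1 0 0)) = half_point q1 ((-1) ^+ odd (g.1 0 0) * r2) q3 & True].
    case: (odd _); last by exists r1, r3; rewrite mulr0n addr0 mul1r gaE.
    exists r1, (- r3); rewrite mulN1r mulr1n val_ellD gaE T1e er half_add_T1 //.
    by split=> //; case: hr => h1 h2; split; rewrite !sqrrN.
  rewrite fga; case: (odd (g.1 0 1)); last by exists q1, q3; rewrite mulr0n addr0.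
  exists (- q1), (- q3); rewrite mulr1n val_ellD qq T2E half_add_T2 //.
  by split=> //; case: hq => h1 h2; split; rewrite !sqrrN.
have fgaE : val (phif ga) = half_point (f r1) (f r2) (f r3).
  by rewrite val_ell_map gaE map_half_point.
apply: (signr_inj r20); rewrite -fr2.
exact: (half_point_r2 char0 hs (half_coord_map f hr) (etrans (esym ss) fgaE)).
Qed.

End Acting.
End Endo.
End Action.

(** * Membership of the image in I_k, and compatibility with composition *)

Lemma in_H8_signs (a b c d : 'Z_8) (D := a * d - b * c) : odd a -> odd d -> ~~ odd c ->
  odd (c : nat)./2 = i_sign D (+) t_sign D -> in_H8 a b c d.
Proof.
move=> oa od oc hc.
pose q (a b c d : nat) := ((a * d + 7 * (b * c)) %% 8)%N.
pose s (a b c d : nat) := let D := q a b c d in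
  (((D == 3) || (D == 7)) (+) ((D == 3) || (D == 5)))%N.
have DE : (D : nat) = q a b c d by rewrite /D det_nat8 val_Zp_nat.
have sE : i_sign D (+) t_sign D = s a b c d by rewrite /s -DE /i_sign /t_sign !inE.
have := @all8_nat4 (fun a b c d => [&& odd a, odd d, ~~ odd c &
  odd c./2 == s a b c d] ==> in_H8 a b c d) _ a b c d.
rewrite oa od oc hc sE eqxx /=; apply.
by vm_compute.
Qed.

Lemma odd_half_mod8 m : odd (m %% 8)./2 = odd m./2.
Proof.
rewrite {2}(divn_eq m 8) (_ : m %/ 8 * 8 = ((m %/ 8).*2.*2).*2)%N; last by lia.
by rewrite halfD odd_double doubleK /= add0n oddD odd_double.
Qed.

Section ActionInIk.
Variables (F : fieldType) (k : nat).
Hypothesis char0 : [pchar F] =i pred0.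
Hypothesis hk : (3 <= k)%N.
Local Notation n := (2 ^ k)%N.
Local Notation EF := (elliptic (smooth_E char0)).
Variables A B beta : EF.
Hypothesis A_tors : A *+ n = 0.
Hypothesis B_tors : B *+ n = 0.
Hypothesis AB_free : forall c1 c2 d1 d2, (c1 < n)%N -> (c2 < n)%N -> (d1 < n)%N -> (d2 < n)%N ->
  A *+ c1 + B *+ c2 = A *+ d1 + B *+ d2 -> c1 = d1 /\ c2 = d2.
Hypothesis B_half : val (B *+ 2 ^ k.-1) = Some (0, 0).
Hypothesis beta_div : val (beta *+ n) = P F.

Lemma mulrn_ZpD (T : EF) (x y : 'Z_n) : T *+ n = 0 -> T *+ (x + y)%R = T *+ x + T *+ y.
Proof.
move=> T0; rewrite -[in LHS](natr_Zp x) -[in LHS](natr_Zp y) -natrD (val_natr_exp2 hk).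
by rewrite -mulrnDr [in RHS](divn_eq (x + y) n) mulrnDr mulnC mulrnA T0 mul0rn add0r.
Qed.

Lemma mulrn_ZpM (T : EF) (x y : 'Z_n) : T *+ n = 0 -> T *+ (x * y)%R = T *+ y *+ x.
Proof.
move=> T0; rewrite -[in LHS](natr_Zp x) -[in LHS](natr_Zp y) -natrM (val_natr_exp2 hk).
rewrite -mulrnA (mulnC y) [in RHS](divn_eq (x * y) n) mulrnDr.
by rewrite (mulnC _ n) mulrnA T0 mul0rn add0r.
Qed.

Lemma acts_Ik (f : {rmorphism F -> F}) (g : AGL2 n) : acts A B beta f g -> g \in Ik k.
Proof.
move=> fg; have [i [t [kap [e [o T1e]]]]] := octal_basis hk A_tors AB_free B_half.
have [oa od oc] := acts_odd hk A_tors B_tors AB_free B_half fg.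
have hc := acts_kappa hk A_tors B_tors AB_free B_half fg o.
have he := acts_e hk A_tors B_tors AB_free B_half beta_div fg o T1e.
have [gE u] := aglP g.
have dE : det_char g = mod8 (GLval g.2 0 0 * GLval g.2 1 1 - GLval g.2 0 1 * GLval g.2 1 0).
  by rewrite /det_char [X in \det X]mx2_eta det_mx2.
have dodd : odd (det_char g) by rewrite dE odd_mod8 // -unit_odd.
rewrite gE (in_Ik_agl _ _ u) -dE; apply/andP; split.
  apply: in_H8_signs; rewrite ?odd_mod8 // -!(mod8M hk) -(mod8B hk) -dE.
  by rewrite val_mod8 // odd_half_mod8.
rewrite he; move: dodd; rewrite /t_sign; apply/implyP.
by move: (det_char g); apply: all8P.
Qed.

Lemma acts_uniq (f : {rmorphism F -> F}) (g h : AGL2 n) :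
  acts A B beta f g -> acts A B beta f h -> g = h.
Proof.
case=> b1 A1 B1 [b2 A2 B2].
have lt (x : 'Z_n) : (x < n)%N.
  by rewrite -[x]natr_Zp (val_natr_exp2 hk) ltn_mod expn_gt0.
have free (x y x' y' : 'Z_n) : A *+ x + B *+ y = A *+ x' + B *+ y' -> x = x' /\ y = y'.
  by move/(AB_free (lt _) (lt _) (lt _) (lt _)) => [ex ey]; split; apply: val_inj.
have [e1 e2] := free _ _ _ _ (addrI beta (etrans (esym b1) b2)).
have [e3 e4] := free _ _ _ _ (etrans (esym A1) A2).
have [e5 e6] := free _ _ _ _ (etrans (esym B1) B2).
rewrite [g]surjective_pairing [h]surjective_pairing; congr (_, _).
  by rewrite [LHS]rv2_eta [RHS]rv2_eta e1 e2.
apply: val_inj; apply: etrans (mx2_eta _) _; apply: etrans _ (esym (mx2_eta _)).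
by rewrite -[val g.2]/(GLval g.2) -[val h.2]/(GLval h.2) e3 e4 e5 e6.
Qed.

(** Coordinates are rows: applying [f] to beta plus the combination with row v' gives beta plus the
    one with row v + v' M, and the matrix of [f'] multiplies that of [f] from the left. *)
Lemma acts_mul (f f' : {rmorphism F -> F}) (g g' : AGL2 n) :
  acts A B beta f g -> acts A B beta f' g' -> acts A B beta (f \o f') (g * g')%g.
Proof.
have comp T : @ell_map _ _ E (f \o f') (smooth_E char0) (smooth_E char0) T =
    @ell_map _ _ E f (smooth_E char0) (smooth_E char0)
     (@ell_map _ _ E f' (smooth_E char0) (smooth_E char0) T).
  by apply: val_inj; rewrite !val_ell_map; case: (val T) => [[]|].
case=> b1 A1 B1 [b2 A2 B2].
have lin (a b c d x y : 'Z_n) : (A *+ a + B *+ b) *+ x + (A *+ c + B *+ d) *+ y =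
    A *+ (x * a + y * c)%R + B *+ (x * b + y * d)%R.
  by rewrite !mulrn_ZpD // !mulrn_ZpM // !mulrnDl addrACA.
have ME i j : GLval (g * g')%g.2 i j = (GLval g'.2 *m GLval g.2) i j by [].
have vE j : (g * g')%g.1 0 j = (g.1 + g'.1 *m GLval g.2) 0 j by [].
have mulE m (X : 'M['Z_n]_(m, 2)) (Y : 'M['Z_n]_2) r j :
    (X *m Y) r j = X r 0 * Y 0 j + X r 1 * Y 1 j.
  by rewrite mxE !big_ord_recl big_ord0 addr0; congr (_ + X r _ * Y _ j); exact: val_inj.
have addE (v w : 'rV['Z_n]_2) j : (v + w) 0 j = v 0 j + w 0 j by rewrite mxE.
split; rewrite comp.
- rewrite b2 !ell_mapD !ell_mapMn b1 A1 B1 lin !vE !addE !mulE.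
  by rewrite !(@mulrn_ZpD _ (g.1 0 _)) // -addrA addrACA.
- by rewrite A2 !ell_mapD !ell_mapMn A1 B1 lin !ME !mulE.
- by rewrite B2 !ell_mapD !ell_mapMn A1 B1 lin !ME !mulE.
Qed.

End ActionInIk.

(** * Square classes of rationals and the Galois image *)

Lemma rat_sqr_natr (q : rat) (m : nat) : q ^+ 2 = m%:R -> exists r, m = (r ^ 2)%N.
Proof.
move=> qm; pose N := `|numq q|%N; pose D := `|denq q|%N.
have e : (N ^ 2 = m * D ^ 2)%N.
  rewrite /N /D -!abszX -[m]/(`|m%:Z|%N) -abszM; congr absz; apply: (@intr_inj rat).
  by rewrite !(rmorphXn, rmorphM) /= numqE exprMn qm.
have D1 : D = 1%N.
  have : (D ^ 2 %| N ^ 2)%N by rewrite e dvdn_mull.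
  rewrite dvdn_pexp2r // => DN; have := coprime_num_den q.
  by rewrite /coprime gcdnC -/D -/N (gcdn_idPl DN) => /eqP.
by exists N; rewrite e D1 muln1.
Qed.

Lemma not_sqr m r j : (j ^ 2 < m < j.+1 ^ 2)%N -> m = (r ^ 2)%N -> False.
Proof. by move=> + e; rewrite e !ltn_exp2r //= ltnS => /andP[/leq_trans h /h]; rewrite ltnn. Qed.

(* 17, -1 and 2 are independent in rat modulo squares. *)
Lemma rat_not_sqr (x y z : bool) (q : rat) : [|| x, y | z] ->
  q ^+ 2 <> (-1) ^+ y * (153 ^ x * 2 ^ z)%N%:R.
Proof.
have m0 : (0 < 153 ^ x * 2 ^ z)%N by rewrite muln_gt0 !expn_gt0.
case: y => xyz.
  rewrite expr1 mulN1r => h; have := Num.Theory.sqr_ge0 q.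
  by rewrite h Num.Theory.oppr_ge0 Num.Theory.lern0 eqn0Ngt m0.
rewrite expr0 mul1r => /rat_sqr_natr[r]; case: x z xyz {m0} => -[] // _.
- exact: (@not_sqr 306 _ 17 isT).
- exact: (@not_sqr 153 _ 12 isT).
- exact: (@not_sqr 2 _ 1 isT).
Qed.

Lemma gal_fixed_rat (L : splittingFieldType rat) (u : L) :
  (forall s : gal_of {:L}, s u = u) -> exists q : rat, u = q%:A.
Proof.
move=> fu; have : u \in fixedField 'Gal({:L} / 1)%g.
  by apply/fixedFieldP => //; rewrite memvf.
have /galois_fixedField -> : galois 1%AS {:L}%AS.
  rewrite /galois sub1v normalFieldf andbT /=; apply/separableP => y _.
  by apply: pcharf0_separable; apply: ftrans (fmorph_pchar (in_alg L)) (Num.Theory.pchar_num _).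
by move/vlineP.
Qed.

Section GaloisImage.
Variables (k : nat) (L : splittingFieldType rat).
Hypothesis hk : (3 <= k)%N.
Hypothesis char0 : [pchar L] =i pred0.
Local Notation n := (2 ^ k)%N.
Local Notation EL := (elliptic (smooth_E char0)).
Variables A B beta : EL.
Hypothesis A_tors : A *+ n = 0.
Hypothesis B_tors : B *+ n = 0.
Hypothesis AB_span : forall U : EL, U *+ n = 0 ->
  exists c : nat * nat, [/\ (c.1 < n)%N, (c.2 < n)%N & U = A *+ c.1 + B *+ c.2].
Hypothesis AB_free : forall c1 c2 d1 d2, (c1 < n)%N -> (c2 < n)%N -> (d1 < n)%N -> (d2 < n)%N ->
  A *+ c1 + B *+ c2 = A *+ d1 + B *+ d2 -> c1 = d1 /\ c2 = d2.
Hypothesis B_half : val (B *+ 2 ^ k.-1) = Some (0, 0).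
Hypothesis beta_div : val (beta *+ n) = P L.

Local Notation act s := (@acts L k char0 A B beta (gal_repr s)).

Lemma acts_asP (s : gal_of {:L}) (g : AGL2 n) :
  reflect (act s g) (acts_as (val A) (val B) (val beta) s g).
Proof.
apply: (iffP and3P) => -[].
  move=> /eqP hb /eqP hA /eqP hB; split; apply: val_inj.
  - by rewrite val_ell_map val_ellD val_ell_lin_comb.
  - by rewrite val_ell_map val_ell_lin_comb.
  - by rewrite val_ell_map val_ell_lin_comb.
move=> hb hA hB; split; rewrite -val_ell_lin_comb -?val_ellD.
- by rewrite -hb.
- by rewrite -hA.
- by rewrite -hB.
Qed.

Lemma gal_acts_exists (s : gal_of {:L}) : exists g : AGL2 n, act s g.
Proof. exact: acts_exists. Qed.

(** A product in [gal_of] applies its left factor first, which reverses the order. *)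
Lemma gal_acts_mul (s t : gal_of {:L}) (g h : AGL2 n) :
  act s g -> act t h -> act (t * s)%g (g * h)%g.
Proof.
move=> sg th; have [b0 A0 B0] := acts_mul hk A_tors B_tors sg th.
have e T : @ell_map _ _ E (gal_repr (t * s)%g) (smooth_E char0) (smooth_E char0) T =
   @ell_map _ _ E (gal_repr s \o gal_repr t) (smooth_E char0) (smooth_E char0) T.
  apply: val_inj; rewrite !val_ell_map; case: (val T) => [[x y]|] //=.
  by rewrite !galM ?memvf.
by split; rewrite e.
Qed.

Definition galois_image : {set AGL2 n} :=
  [set g | [exists s : gal_of {:L}, acts_as (val A) (val B) (val beta) s g]].

Lemma galois_imageP (g : AGL2 n) :
  reflect (exists s : gal_of {:L}, act s g) (g \in galois_image).
Proof.
rewrite inE; apply: (iffP existsP) => -[s] /acts_asP; first by exists s.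
by move=> ?; exists s.
Qed.

Lemma galois_image_group_set : group_set galois_image.
Proof.
apply/group_setP; split.
  (* The image of the identity is idempotent, hence equal to 1. *)
  have [g g1] := gal_acts_exists 1%g; have := gal_acts_mul g1 g1.
  rewrite mulg1 => /(acts_uniq hk AB_free g1) => gg.
  apply/galois_imageP; exists 1%g; suff <- : g = 1%g by [].
  by apply: (mulgI g); rewrite mulg1 -gg.
move=> g h /galois_imageP[s sg] /galois_imageP[t th].
by apply/galois_imageP; exists (t * s)%g; apply: gal_acts_mul.
Qed.

(** Otherwise every automorphism fixes [u], which is then rational with square (-1)^y 153^x 2^z. Its
    factor 2 e + 5 is the difference of the roots e and - 5 - e, negated exactly when they are
    exchanged. *)
Lemma galois_image_parity (x y z : bool) : [|| x, y | z] ->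
  exists2 g, g \in galois_image & parity x y z g.
Proof.
move=> xyz; have [i [t [kap [e [o T1e]]]]] := octal_basis hk A_tors AB_free B_half.
have [i2 t2 _ e2] := octal_root2 char0 o.
case: (pickP (fun g => (g \in galois_image) && parity x y z g)) => [g /andP[]|no].
  by exists g.
pose w := 2 * e + 5; pose u := w ^+ x * i ^+ y * t ^+ z.
have [q uq] : exists q : rat, u = in_alg L q.
  apply: gal_fixed_rat => s; have [g sg] := gal_acts_exists s.
  have := no g; have -> /= : g \in galois_image by apply/galois_imageP; exists s.
  have [si st _ se] := acts_octal hk A_tors B_tors AB_free B_half sg o.
  have sw : (gal_repr s : {rmorphism L -> L}) w = (-1) ^+ b_char g * w.
    rewrite /w rmorphD rmorphM !rmorph_nat se.
    by case: (b_char g); rewrite ?expr1 ?expr0; ring.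
  have pow (b c : bool) (v : L) : ((-1) ^+ b * v) ^+ c = (-1) ^+ (c && b) * v ^+ c.
    by case: c; rewrite ?expr0 ?mul1r.
  rewrite /u !rmorphM !rmorphXn si st sw !pow /parity.
  move: (x && _) (y && _) (z && _) => a b c h.
  transitivity ((-1) ^+ (a (+) (b (+) c)) * u); last by rewrite h mul1r.
  rewrite !signr_addb /u; move: ((-1) ^+ a) ((-1) ^+ b) ((-1) ^+ c) => p1 p2 p3.
  by move: (w ^+ x) (i ^+ y) (t ^+ z) => p4 p5 p6; ring.
case: (rat_not_sqr xyz (q := q)); apply: (fmorph_inj (in_alg L)).
transitivity (u ^+ 2); first by rewrite uq rmorphXn.
rewrite /u !exprMn -!exprM !(mulnC _ 2) !exprM e2 i2 t2.
by rewrite rmorphM rmorphXn rmorphN1 rmorph_nat natrM !natrX; ring.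
Qed.

Lemma galois_image_Ik : galois_image = Ik k.
Proof.
apply: (@Ik_generated k hk (Group galois_image_group_set) _ galois_image_parity).
apply/subsetP => g /galois_imageP[s]; exact: acts_Ik.
Qed.

Lemma rho_Some (s : gal_of {:L}) (g : AGL2 n) : act s g ->
  rho k (val A) (val B) (val beta) s = Some g.
Proof.
move=> sg; rewrite /rho; case: pickP => [h /acts_asP sh|/(_ g)].
  by congr Some; apply: acts_uniq sh sg.
by move/acts_asP: sg => ->.
Qed.

Lemma rho_image : [set rho k (val A) (val B) (val beta) s | s in 'Gal({:L} / 1)%g] =
  [set Some g | g in Ik k].
Proof.
apply/setP => r; apply/imsetP/imsetP => [[s _ ->]|[g]].
  have [g sg] := gal_acts_exists s; exists g; last exact: rho_Some.
  by rewrite -galois_image_Ik; apply/galois_imageP; exists s.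
rewrite -galois_image_Ik => /galois_imageP[s sg] ->; exists s; last by rewrite (rho_Some sg).
rewrite gal_kHom ?sub1v // k1HomE; apply/ahom_inP.
by split=> [a b _ _|]; [apply: rmorphM|apply: rmorph1].
Qed.

End GaloisImage.

(** * Compatibility with the isogeny, and transfer of the bases to L *)

(** phi kills 2^(k-1) T, its image being 2^k U, and the kernel of phi is generated by (0, 0); the
    multiple is not zero because zero has a unique expression in the basis. *)
Lemma torsion_basis_half (F : fieldType) (k : nat) (S T U : point F) : [pchar F] =i pred0 ->
  (0 < k)%N -> torsion_basis E (2 ^ k) S T -> torsion E' (2 ^ k) U ->
  phi T = mul_point E' 2 U -> mul_point E (2 ^ k.-1) T = Some (0, 0).
Proof.
move=> char0 k0 [/andP[oS _] /andP[oT nT] uniqST] /andP[oU /eqP nU] TU.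
pose T' : elliptic (smooth_E char0) := Sub T oT.
pose S' : elliptic (smooth_E char0) := Sub S oS.
have lt : (2 ^ k.-1 < 2 ^ k)%N by rewrite ltn_exp2l // prednK.
have h := phi_mul_half char0 k.-1 oT oU TU.
rewrite prednK // nU in h; rewrite -[T]/(val T') -val_ellMn in h *.
case: (phi_eq_None (valP _) h) => // e0.
exfalso; have T'0 : T' *+ 2 ^ k.-1 = 0 by apply: val_inj.
have gt0 : (0 < 2 ^ k)%N by rewrite expn_gt0.
have [|c [_ cu]] := uniqST None; first by rewrite /torsion /=; elim: (2 ^ k)%N => //= m /eqP ->.
have c1 := cu (Ordinal gt0, Ordinal gt0) erefl.
have : c = (Ordinal gt0, Ordinal lt).
  apply: cu; rewrite -[S]/(val S') -[T]/(val T') -val_ell_lin_comb.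
  by rewrite /= T'0.
rewrite c1 => /(congr1 (fun c => nat_of_ord c.2)) /= h0.
by move/esym/eqP: h0; apply/negP; rewrite -lt0n expn_gt0.
Qed.

Close Scope ring_scope.

Theorem theorem4p7 (k : nat) (hk : (3 <= k)%N)
  (L : splittingFieldType rat) (iota : {rmorphism L -> algC})
  (hL : is_division_field k iota)
  (A B : point L) (C D : point algC)
  (hAB : torsion_basis E (2 ^ k) (map_point iota A) (map_point iota B))
  (hCD : torsion_basis E' (2 ^ k) C D)
  (hA : phi (map_point iota A) = C)
  (hB : phi (map_point iota B) = mul_point E' 2 D)
  (beta : point L)
  (hbeta : on_curve E beta)
  (hP : mul_point E (2 ^ k) beta = P L) :
  [set @rho k L A B beta sigma | sigma in 'Gal({:L} / 1)%g] =
  [set Some g | g in Ik k].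
Proof.
have charC : [pchar algC]%R =i pred0 := Num.Theory.pchar_num _.
have char0 : [pchar L]%R =i pred0.
  by apply: ftrans (fmorph_pchar (in_alg L)) (Num.Theory.pchar_num _).
have [_ tD _] := hCD.
have hB2 := torsion_basis_half charC (ltnW (ltnW hk)) hAB tD hB.
have [tA tB span] := hAB.
(* The basis property is stated over [algC], the points live over [L]; since [iota] is an injective
   field morphism, torsion and linear combinations correspond. *)
have torsE T : torsion E (2 ^ k) (map_point iota T) = torsion E (2 ^ k) T.
  rewrite /torsion on_curve_map -map_point_mul; case: (on_curve _ _) => //=.
  by case: (mul_point _ _ _) => [[]|].
rewrite torsE in tA; rewrite torsE in tB.
have combE m n S T : lin_comb E m n (map_point iota S) (map_point iota T) =
    map_point iota (lin_comb E m n S T).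
  by rewrite map_point_add !map_point_mul.
have /andP[oA /eqP nA] := tA; have /andP[oB /eqP nB] := tB.
pose EL := elliptic (smooth_E char0).
pose A' : EL := Sub A oA; pose B' : EL := Sub B oB; pose b' : EL := Sub beta hbeta.
have nA' : (A' *+ 2 ^ k = 0)%R by apply: val_inj; rewrite val_ellMn.
have nB' : (B' *+ 2 ^ k = 0)%R by apply: val_inj; rewrite val_ellMn.
have comb_tors (S T : EL) a b : (S *+ 2 ^ k = 0 -> T *+ 2 ^ k = 0 ->
    (S *+ a + T *+ b) *+ 2 ^ k = 0)%R.
  by move=> S0 T0; rewrite mulrnDl (mulrnAC S) (mulrnAC T) S0 T0 !mul0rn addr0.
apply: (@rho_image k L hk char0 A' B' b' nA' nB').
- move=> U nU; have [|c [cU _]] := span (map_point iota (val U)).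
    by rewrite torsE /torsion -val_ellMn nU eqxx andbT; apply: valP.
  exists (c.1 : nat, c.2 : nat); split; try exact: ltn_ord.
  apply: val_inj; rewrite val_ell_lin_comb; apply: (map_point_inj (f := iota)).
  by rewrite -combE cU.
- move=> c1 c2 d1 d2 lc1 lc2 ld1 ld2 /(congr1 val); rewrite !val_ell_lin_comb => e.
  have [|c [_ cu]] := span (map_point iota (val (A' *+ c1 + B' *+ c2)%R)).
    by rewrite torsE /torsion -val_ellMn comb_tors // eqxx andbT; apply: valP.
  rewrite val_ell_lin_comb -combE in cu.
  have e1 := cu (Ordinal lc1, Ordinal lc2) erefl.
  have e2 : c = (Ordinal ld1, Ordinal ld2) by apply: cu; rewrite !combE [in LHS]e.
  by move: e2; rewrite e1 => -[].
- rewrite val_ellMn; apply: (map_point_inj (f := iota)); rewrite map_point_mul hB2 /=.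
  by rewrite rmorph0.
- by rewrite val_ellMn.
Qed.
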